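(* Let $\lambda>0$, $T>0$, $\Omega^*=(\lambda,+\infty)$, $Q_T^*=\Omega^*\times(0,T)$ and $\gamma(p)=p\sqrt{p^2-\lambda^2}$. Let the initial data be $f(p,0)=f_0(p)$, $p\in\mathbb{R}_p$, and $W(k,0)=W_0(k)$, $k\in\mathbb{R}_k$, where $f_0\in C^\infty(\mathbb{R}_p)$ and $W_0\in C^\infty(\mathbb{R}_k)$, $W_0\ge 0$. Define $\varphi_0:\Omega^*\to[0,+\infty)$ and $g_0:\Omega^*\to\mathbb{R}$ by $$\varphi_0(p)=(p^2-\lambda^2)^{-3/2}\,W_0\!\left(\frac{1}{\sqrt{p^2-\lambda^2}}\right),\qquad g_0(p)=p\sqrt{p^2-\lambda^2}\;\partial_p\big(f_0(p)-\partial_p\varphi_0(p)\big).$$ Suppose there is $u\in L^2(0,T;W_0^{1,2}(\Omega^* ))$ such that for every $\eta\in\mathcal V=\{\eta\in C^1(Q_T^* )\cap L^\infty(Q_T^* ):\eta(\cdot,T)=0\}$ $$-(u,\partial_t\eta)_{Q_T^*}+\Big(\tfrac{\gamma}{2}\partial_p u^2,\partial_p\eta\Big)_{Q_T^*}=\big(-\gamma(\partial_p u)^2,\eta\big)_{Q_T^*}+\Big(-\tfrac{\partial_p\gamma}{2}\partial_p u^2,\eta\Big)_{Q_T^*}+(g_0u,\eta)_{Q_T^*}+(\varphi_0,\eta(\cdot,0))_{\Omega^*}.$$ Define $$W(k,t)=\begin{cases}\dfrac{1}{k^3}\,u\!\left(\dfrac{(1+\lambda^2k^2)^{1/2}}{k},t\right),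 & k\in(0,+\infty),\\ 0,&\text{otherwise,}\end{cases}\qquad f(p,t)=f_0(p)+\begin{cases}\partial_pu(p,t)-\partial_p\varphi_0(p),&p\in(\lambda,+\infty),\\0,&\text{otherwise.}\end{cases}$$ If there exists a constant $\varepsilon>0$ such that $\operatorname{supp}W(\cdot,t)\subset(\varepsilon,\tfrac1\varepsilon)$ for every $t\in(0,T)$, then for every $\zeta\in C^\infty(\mathbb{R}_p\times[0,T])$ with $\zeta(\cdot,t)\in C_c^\infty(\mathbb{R}_p)$ for all $t\in[0,T]$ and $\zeta(\cdot,T)=0$, and every $\xi\in C^\infty(\mathbb{R}_k\times[0,T])$ with $\xi(\cdot,t)\in C_c^\infty(\mathbb{R}_k)$ for all $t\in[0,T]$ and $\xi(\cdot,T)=0$, the following two identities hold: $$-\int_0^T(f,\partial_t\zeta)_p\,dt-(f_0,\zeta(\cdot,0))_p=\int_0^T\langle\partial_p\Phi,\;fW\,\partial_p\zeta\rangle_{pk}\,dt+\int_0^T\langle\Phi,\;fW\,\partial_p^2\zeta\rangle_{pk}\,dt,$$ $$-\int_0^T(W,\partial_t\xi)_k\,dt-(W_0,\xi(\cdot,0))_k=-\int_0^T\langle\partial_p\Phi,\;fW\xi\,\partial_pE\rangle_{pk}\,dt-\int_0^T\langle\Phi,\;fW\xi\,\partial_p^2E\rangle_{pk}\,dt.$$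
   Context: $(\cdot,\cdot)_D$ denotes the integral over $D$ of the product of the two functions; $(\cdot,\cdot)_p$ and $(\cdot,\cdot)_k$ are the integrals over $\mathbb{R}_p=\mathbb{R}$ and $\mathbb{R}_k=\mathbb{R}$. $E(p)=p^2/2$ is the (normalized) kinetic energy, so $\partial_pE=p$ and $\partial_p^2E=1$. $\Phi$ stands for the kernel $\delta\big((1+\lambda^2k^2)^{1/2}-pk\big)$; the pairings with it and with its $p$-derivative, against products $y(p)z(k)$ of a function of $p$ and a function of $k$, are defined by $$\langle\Phi,\,y(p)z(k)\rangle_{pk}:=\int_{(-\infty,-\lambda)\cup(\lambda,+\infty)}\frac{|p|}{p^2-\lambda^2}\,y(p)\,z\!\left(\frac{\operatorname{sgn}(p)}{\sqrt{p^2-\lambda^2}}\right)dp,$$ $$\langle\partial_p\Phi,\,y(p)z(k)\rangle_{pk}:=\int_{(-\infty,-\lambda)\cup(\lambda,+\infty)}y(p)\,\partial_p\!\left(\frac{|p|}{p^2-\lambda^2}\,z\!\left(\frac{\operatorname{sgn}(p)}{\sqrt{p^2-\lambda^2}}\right)\right)dp.$$ In the first identity $z=W(\cdot,t)$, with $y=f\,\partial_p\zeta$ or $y=f\,\partial_p^2\zeta$; in the second identity $z=W(\cdot,t)\xi(\cdot,t)$, with $y=f\,\partial_pE$ or $y=f\,\partial_p^2E$.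
   Formalization: Two conditions are added, without which the statement fails: W_0(k)=0 for k≤0 (as forced by W=0 there), and the supports of ζ(·,t), t∈[0,T], lie in one common compact set. *)

(* Defs.v *)
From HB Require Import structures.
From mathcomp Require Import all_boot all_order all_algebra.
From mathcomp Require Import all_classical all_reals all_analysis.

Set Implicit Arguments.
Unset Strict Implicit.
Unset Printing Implicit Defensive.

Import Order.TTheory GRing.Theory Num.Theory.
Import numFieldNormedType.Exports.

Local Open Scope classical_set_scope.
Local Open Scope ring_scope.

(* Functions of (p, t) or (k, t) are uncurried, with time as second
   component. *)

Section Definitions.
Context {R : realType}.

Local Notation mu := (@lebesgue_measure R).

Definition Omega (lambda : R) : set R := `]lambda, +oo[.

Definition QT (lambda T : R) : set (R * R) := Omega lambda `*` `]0, T[.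

Definition smooth (h : R -> R) : Prop :=
  forall n x, derivable (derive1n n h) x 1.

Definition Cc_smooth (D : set R) (h : R -> R) : Prop :=
  [/\ smooth h, compact (closure [set x | h x != 0])
    & closure [set x | h x != 0] `<=` D].

Definition dp (h : R * R -> R) (z : R * R) : R :=
  derive1 (fun x => h (x, z.2)) z.1.

Definition dt (h : R * R -> R) (z : R * R) : R :=
  derive1 (fun s => h (z.1, s)) z.2.

(* C^n(I x [0, T]) for I open: d i j is the continuous extension of
   (d/dp)^i (d/dt)^j h from I x (0, T) to I x [0, T]. *)
Definition Cn_cyl (n : nat) (I : set R) (T : R) (h : R * R -> R) : Prop :=
  exists d : nat -> nat -> R * R -> R,
  [/\ forall z, (I `*` `[0, T]) z -> d 0 0 z = h z,
      forall i j, (i + j <= n)%N -> {within I `*` `[0, T], continuous (d i j)}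
    & forall i j, (i + j < n)%N -> forall p t, I p -> 0 < t < T ->
        is_derive p 1 (fun x => d i j (x, t)) (d i.+1 j (p, t)) /\
        is_derive t 1 (fun s => d i j (p, s)) (d i j.+1 (p, t))].

Definition smooth_cyl (I : set R) (T : R) (h : R * R -> R) : Prop :=
  forall n, Cn_cyl n I T h.

(* zeta in C^oo(R x [0, T]), zeta(., t) in C_c^oo(R), zeta(., T) = 0 *)
Definition test_fun (T : R) (zeta : R * R -> R) : Prop :=
  [/\ smooth_cyl setT T zeta,
      forall t : R, 0 <= t <= T -> Cc_smooth setT (fun p => zeta (p, t))
    & forall p, zeta (p, T) = 0].

Definition uniform_compact_support (T : R) (zeta : R * R -> R) : Prop :=
  exists M : R, forall p t, 0 <= t <= T -> M < `|p| -> zeta (p, t) = 0.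

(* The space V.  Since eta(., 0) and eta(., T) are used, C^1 is understood up
   to t = 0 and t = T. *)
Definition calV (lambda T : R) (eta : R * R -> R) : Prop :=
  [/\ Cn_cyl 1 (Omega lambda) T eta,
      exists M : R, {ae (mu \x mu)%E, forall z, QT lambda T z -> `|eta z| <= M}
    & forall p, Omega lambda p -> eta (p, T) = 0].

Definition is_weak_deriv (D : set R) (h g : R -> R) : Prop :=
  [/\ locally_integrable D h, locally_integrable D g &
      forall phi, Cc_smooth D phi ->
        (\int[mu]_(x in D) (h x * derive1 phi x)) =
        - (\int[mu]_(x in D) (g x * phi x))].

(* Some representative of the weak derivative of h on D; it is unique up to
   a null set, and its value is irrelevant when h has no weak derivative. *)
Definition weak_deriv (D : set R) (h : R -> R) : R -> R :=
  xget (fun=> 0) [set g | is_weak_deriv D h g].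

(* the square of the W^{1,2}(D) norm of h when g is its weak derivative *)
Definition W12_sqnorm (D : set R) (h g : R -> R) : \bar R :=
  (\int[mu]_(x in D) (h x ^+ 2 + g x ^+ 2)%:E)%E.

(* h is in W^{1,2}_0(D), the closure of C_c^oo(D) in W^{1,2}(D), and g is a
   representative of its weak derivative. *)
Definition W012 (D : set R) (h g : R -> R) : Prop :=
  [/\ is_weak_deriv D h g, (W12_sqnorm D h g < +oo)%E &
      exists phi : nat -> R -> R, (forall n, Cc_smooth D (phi n)) /\
        W12_sqnorm D (phi n \- h) (derive1 (phi n) \- g) @[n --> \oo] --> 0%E].

Definition W012_simple (D : set R) (s ds : R -> R -> R) : Prop :=
  exists (m : nat) (A : nat -> set R) (h g : nat -> R -> R),
  [/\ forall i, measurable (A i),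
      forall i, W012 D (h i) (g i),
      forall t p, s t p = \sum_(i < m) \1_(A i) t * h i p
    & forall t p, ds t p = \sum_(i < m) \1_(A i) t * g i p].

(* u is in the Bochner space L^2(0, T; W^{1,2}_0(Omega)) and du represents
   its weak p-derivative; u and du are jointly measurable representatives. *)
Definition L2_W012 (lambda T : R) (u du : R * R -> R) : Prop :=
  [/\ measurable_fun (QT lambda T) u /\ measurable_fun (QT lambda T) du,
      {ae mu, forall t : R, 0 < t < T ->
        W012 (Omega lambda) (fun p => u (p, t)) (fun p => du (p, t))},
      exists s ds : nat -> R -> R -> R,
        (forall n, W012_simple (Omega lambda) (s n) (ds n)) /\
        {ae mu, forall t : R, 0 < t < T ->
          W12_sqnorm (Omega lambda) (fun p => s n t p - u (p, t))
            (fun p => ds n t p - du (p, t)) @[n --> \oo] --> 0%E}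
    & (\int[mu]_(t in `]0%R, T[) W12_sqnorm (Omega lambda)
         (fun p => u (p, t)) (fun p => du (p, t)) < +oo)%E].

Definition is_weak_dp (lambda T : R) (v dv : R * R -> R) : Prop :=
  measurable_fun (QT lambda T) dv /\
  {ae mu, forall t : R, 0 < t < T ->
    is_weak_deriv (Omega lambda) (fun p => v (p, t)) (fun p => dv (p, t))}.

(* the support of an a.e.-class: the complement of the largest open set on
   which h vanishes almost everywhere *)
Definition ess_support (h : R -> R) : set R :=
  [set x | forall U, nbhs x U -> ~ {ae mu, forall y, U y -> h y = 0}].

Definition gamma (lambda p : R) : R := p * Num.sqrt (p ^+ 2 - lambda ^+ 2).

Definition phi0 (lambda : R) (W0 : R -> R) (p : R) : R :=
  (p ^+ 2 - lambda ^+ 2) `^ (- (3 / 2)) *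
  W0 (1 / Num.sqrt (p ^+ 2 - lambda ^+ 2)).

Definition g0 (lambda : R) (f0 W0 : R -> R) (p : R) : R :=
  p * Num.sqrt (p ^+ 2 - lambda ^+ 2) *
  derive1 (fun q => f0 q - derive1 (phi0 lambda W0) q) p.

(* du and du2 represent the weak p-derivatives of u and of u^2. *)
Definition weak_form (lambda T : R) (f0 W0 : R -> R) (u du du2 eta : R * R -> R)
    : Prop :=
  - (\int[(mu \x mu)%E]_(z in QT lambda T) (u z * dt eta z))
  + (\int[(mu \x mu)%E]_(z in QT lambda T)
       (gamma lambda z.1 / 2 * du2 z * dp eta z))
  = (\int[(mu \x mu)%E]_(z in QT lambda T)
       (- (gamma lambda z.1 * du z ^+ 2) * eta z))
  + (\int[(mu \x mu)%E]_(z in QT lambda T)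
       (- (derive1 (gamma lambda) z.1 / 2 * du2 z) * eta z))
  + (\int[(mu \x mu)%E]_(z in QT lambda T) (g0 lambda f0 W0 z.1 * u z * eta z))
  + (\int[mu]_(p in Omega lambda) (phi0 lambda W0 p * eta (p, 0))).

Definition Wsol (lambda : R) (u : R * R -> R) (z : R * R) : R :=
  let: (k, t) := z in
  if 0 < k then 1 / k ^+ 3 * u (Num.sqrt (1 + lambda ^+ 2 * k ^+ 2) / k, t)
  else 0.

Definition fsol (lambda : R) (f0 W0 : R -> R) (du : R * R -> R) (z : R * R) : R :=
  let: (p, t) := z in
  f0 p + (if lambda < p then du (p, t) - derive1 (phi0 lambda W0) p else 0).

Definition Ekin (p : R) : R := p ^+ 2 / 2.

Definition Phi_dom (lambda : R) : set R := `]-oo, - lambda[ `|` `]lambda, +oo[.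

(* |p| / (p^2 - lambda^2) * z(sgn(p) / sqrt(p^2 - lambda^2)) *)
Definition Phi_slice (lambda : R) (z : R -> R) (p : R) : R :=
  `|p| / (p ^+ 2 - lambda ^+ 2) *
  z (Num.sg p / Num.sqrt (p ^+ 2 - lambda ^+ 2)).

Definition pair_Phi (lambda : R) (y z : R -> R) : R :=
  \int[mu]_(p in Phi_dom lambda) (y p * Phi_slice lambda z p).

(* z involves W(., t), which has only Sobolev regularity: the p-derivative is
   the weak one. *)
Definition pair_dPhi (lambda : R) (y z : R -> R) : R :=
  \int[mu]_(p in Phi_dom lambda)
    (y p * weak_deriv (Phi_dom lambda) (Phi_slice lambda z) p).

End Definitions.

(* Main.v *)
From HB Require Import structures.
From mathcomp Require Import all_boot all_order all_algebra.
From mathcomp Require Import all_classical all_reals all_analysis.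
From mathcomp Require Import measurable_realfun ring lra.
Require Import Defs.

Set Implicit Arguments.
Unset Strict Implicit.
Unset Printing Implicit Defensive.

Import Order.TTheory GRing.Theory Num.Theory.
Import numFieldNormedType.Exports.

Local Open Scope classical_set_scope.
Local Open Scope ring_scope.

(** The substitution k = (p^2 - lambda^2)^(-1/2) turns both pairings with the
    kernel into integrals over (lambda, +oo): the slice of the kernel against
    W m is gamma m u, whose weak p-derivative is (gamma m)' u + gamma m u'.
    Hence, with eta = m n, the two pairings on the right-hand sides add up to
    the integral of f (gamma eta u)', where f = F + u' and
    F = f0 - phi0'.  Integrating the F-part by parts and using
    (u^2)' = 2 u u' gives exactly the terms of the weak formulation tested
    with eta; eta = d_p zeta gives the first identity and
    eta = p xi(k(p), t) the second.  The support hypothesis confines u, and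
    (testing with functions supported elsewhere) phi0, to a compact interval
    [A, B] of (lambda, +oo), so eta may be multiplied by a cutoff to become
    bounded. *)

(** Real-valued integrals take default values on non-integrable functions, and the pairings contain
    a weak derivative chosen separately for each t, about whose dependence on t nothing is known.
    Integrals are therefore compared through almost everywhere equality alone, and Fubini is applied
    only to explicit integrands on the rectangle [A, B] x (0, T), where u and u' are square
    integrable and all coefficients are bounded. The functions that u is integrated against, such as
    F gamma m n, are only C^1 and have no compact support, so the definition of the weak derivative
    does not cover them. Instead of regularizing them, u is approximated by the smooth functions
    that membership in W_0^{1,2} provides, and classical integration by parts passes to the limit.
    The interval is chosen twice: phi0 is first shown to vanish off some [A0, B0]; a larger [A, B]
    then has phi0 = 0 at its endpoints, which removes the boundary terms. The branch p < -lambda of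
    the kernel contributes nothing, because it evaluates W at negative k. *)

(** * Integrals of almost everywhere equal functions *)

Section ae_integral.
Context d (T : measurableType d) (R : realType).
Variable m : {measure set T -> \bar R}.
Import HBNNSimple.

Lemma aeS (P Q : T -> Prop) : (forall x, P x -> Q x) ->
  {ae m, forall x, P x} -> {ae m, forall x, Q x}.
Proof. by move=> PQ; apply: negligibleS => x /= nQ; apply: contra_not nQ; exact: PQ. Qed.

Lemma aeI (P Q : T -> Prop) : {ae m, forall x, P x} -> {ae m, forall x, Q x} ->
  {ae m, forall x, P x /\ Q x}.
Proof.
move=> mP mQ; apply: negligibleS (negligibleU mP mQ) => x /= nPQ.
by have [Px|nPx] := pselect (P x); [right => Qx; exact: nPQ|left].
Qed.

(** This is the expression to which the integral of a nonnegative function unfolds; working with it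
    directly avoids any measurability of f. *)
Let nnintegral (f : T -> \bar R) := ereal_sup [set sintegral m h |
  h in [set h : {nnsfun T >-> R} | forall x, ((h x)%:E <= f x)%E]].

(** A simple function below f, set to 0 on the exceptional null set N, lies below g everywhere and
    keeps its integral. *)
Lemma le_ae_nnintegral (f g : T -> \bar R) : (forall x, 0 <= g x)%E ->
  {ae m, forall x, f x = g x} -> (nnintegral f <= nnintegral g)%E.
Proof.
move=> g0 [N [mN N0 sN]]; apply: ge_ereal_sup => _ [h hf <-].
apply: ereal_sup_ubound.
exists (proj_nnsfun h (measurableC mN)).
  move=> x; rewrite /= mindicE; case: (boolP (x \in ~` N)) => xN /=.
    rewrite mulr1 (le_trans (hf x))//.
    suff -> : f x = g x by [].
    by apply: contrapT => fg; move/set_mem: xN; apply; apply: sN.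
  by rewrite mulr0.
rewrite -!integralT_nnsfun; apply: ae_eq_integral => //.
- exact/measurable_EFinP.
- exact/measurable_EFinP.
exists N; split => // x /= /not_implyP[_]; apply: contra_notP => Nx.
by rewrite /= mindicE mem_set//= mulr1.
Qed.

Lemma ae_eq_nnintegral (f g : T -> \bar R) :
  (forall x, 0 <= f x)%E -> (forall x, 0 <= g x)%E ->
  {ae m, forall x, f x = g x} -> nnintegral f = nnintegral g.
Proof.
move=> f0 g0 fg; apply/eqP; rewrite eq_le !le_ae_nnintegral//.
by move: fg; apply: filterS => x ->.
Qed.

(* no measurability is assumed, contrary to [ae_eq_integral] *)
Lemma ae_integral (D : set T) (f g : T -> \bar R) :
  {ae m, forall x, D x -> f x = g x} ->
  (\int[m]_(x in D) f x = \int[m]_(x in D) g x)%E.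
Proof.
move=> fg; rewrite /integral.
have {}fg : {ae m, forall x, (f \_ D) x = (g \_ D) x}.
  move: fg; apply: filterS => x fgx; rewrite !patchE.
  by case: ifPn => // /set_mem /fgx.
congr (_ - _)%E; apply: ae_eq_nnintegral => //.
- by move: fg; apply: filterS => x; rewrite !funeposE => ->.
- by move: fg; apply: filterS => x; rewrite !funenegE => ->.
Qed.

Lemma ae_Rintegral (D : set T) (f g : T -> R) :
  {ae m, forall x, D x -> f x = g x} ->
  \int[m]_(x in D) f x = \int[m]_(x in D) g x.
Proof.
move=> fg; congr fine; apply: ae_integral.
by move: fg; apply: filterS => x fgx /fgx ->.
Qed.

End ae_integral.

(** * Smooth bump functions *)

Section bump.
Context {R : realType}.
Implicit Types (x c d : R) (n : nat).

(** The powers of 1/x are included so that derivatives stay in the linear span of the family. *)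
Definition flat n x : R := if 0 < x then x^-1 ^+ n * expR (- x^-1) else 0.

Lemma flat_ge0 n x : 0 <= flat n x.
Proof.
rewrite /flat; case: ifPn => // x0.
by rewrite mulr_ge0 ?expR_ge0 // exprn_ge0// invr_ge0 ltW.
Qed.

Lemma flat0_le1 x : flat 0 x <= 1.
Proof.
rewrite /flat; case: ifPn => // x0.
by rewrite expr0 mul1r expR_le1 oppr_le0 invr_ge0 ltW.
Qed.

(** The factorial comes from the term of order n + 2 of the exponential series at 1/x. A quadratic
    bound is all that differentiability at 0 requires. *)
Lemma flat_le_sqr n x : flat n x <= (n.+2)`!%:R * x ^+ 2.
Proof.
rewrite /flat; case: ifPn => [x0|_]; last by rewrite mulr_ge0// sqr_ge0.
have y0 : 0 < x^-1 by rewrite invr_gt0.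
have := expR_ge1Dxn n.+1 (ltW y0).
rewrite expRN => h.
have {}h : x^-1 ^+ n.+2 / (n.+2)`!%:R <= expR x^-1 by apply: le_trans h; rewrite lerDr.
rewrite ler_pdivrMr ?expR_gt0// mulrAC -ler_pdivrMr ?exprn_gt0//.
rewrite -exprVn -exprD addn2 -ler_pdivrMl ?ltr0n ?fact_gt0// mulrC.
exact: h.
Qed.

Lemma is_derive0_le_sqr (f : R -> R) (C : R) :
  (forall x, `|f x| <= C * x ^+ 2) -> is_derive (0:R) 1 f 0.
Proof.
move=> fC; have f0 : f 0 = 0.
  by apply/eqP; rewrite -normr_le0 (le_trans (fC 0))// expr0n/= mulr0.
have C0 : 0 <= C by have := fC 1; rewrite expr1n mulr1; apply: le_trans.
have H : h^-1 *: (f (h *: 1 + 0) - f 0) @[h --> 0^'] --> (0:R).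
  apply/cvgrPdist_le => e e0; near=> h.
  rewrite sub0r normrN f0 subr0 addr0 /GRing.scale/= mulr1 normrM normfV.
  have hn0 : 0 < `|h| by rewrite normr_gt0; near: h; exact: nbhs_dnbhs_neq.
  rewrite mulrC ler_pdivrMr// (le_trans (fC h))//.
  rewrite -real_normK ?num_real// expr2 mulrA ler_wpM2r//.
  (* C may be 0, hence the denominator C + 1. *)
  have : `|h| <= e / (C + 1) by near: h; apply: dnbhs0_le; rewrite divr_gt0// ltr_wpDl.
  rewrite ler_pdivlMr ?ltr_wpDl//; apply: le_trans.
  by rewrite mulrDr mulr1 mulrC lerDl.
apply: DeriveDef; first by apply/cvg_ex; exists 0.
exact: cvg_lim H.
Unshelve. all: by end_near. Qed.

Lemma is_derive_mul (f g : R -> R) x (a b : R) :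
  is_derive x 1 f a -> is_derive x 1 g b ->
  is_derive x 1 (fun y => f y * g y) (f x * b + g x * a).
Proof. exact: is_deriveM. Qed.

Lemma is_derive_add (f g : R -> R) x (a b : R) :
  is_derive x 1 f a -> is_derive x 1 g b ->
  is_derive x 1 (fun y => f y + g y) (a + b).
Proof. exact: is_deriveD. Qed.

Lemma is_derive_comp (f g : R -> R) x (a b : R) :
  is_derive (g x) 1 f a -> is_derive x 1 g b ->
  is_derive x 1 (fun y => f (g y)) (a * b).
Proof. exact: is_derive1_comp. Qed.

Lemma is_derive_const c x : is_derive x 1 (fun=> c) 0.
Proof. exact: is_derive_cst. Qed.

Lemma is_derive_idfun x : is_derive x 1 (fun y : R => y) 1.
Proof. exact: is_derive_id. Qed.

Lemma is_derive_continuous (f : R -> R) x (a : R) :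
  is_derive x 1 f a -> {for x, continuous f}.
Proof.
by case=> df _; apply: differentiable_continuous; exact/derivable1_diffP.
Qed.

Lemma is_derive_exprn n x : is_derive x 1 (fun y : R => y ^+ n) (n%:R * x ^+ n.-1).
Proof.
split; first exact: exprn_derivable.
by rewrite exp_derive /GRing.scale/= mulr1.
Qed.

Lemma is_derive_flat n x :
  is_derive x 1 (flat n) (flat n.+2 x - n%:R * flat n.+1 x).
Proof.
have [x0|x0|->] := ltgtP x 0.
- have -> : flat n.+2 x - n%:R * flat n.+1 x = 0.
    by rewrite /flat ltNge (ltW x0)/= mulr0 subrr.
  apply: (@near_eq_is_derive _ _ _ (cst 0)) => //.
  near=> y; rewrite /flat ltNge.
  suff -> : y <= 0 by [].
  near: y; exact: lt_le_nbhsl.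
- have xn0 : x != 0 by rewrite gt_eqF.
  apply: (@near_eq_is_derive _ _ _ (fun y : R => y^-1 ^+ n * expR (- y^-1))) => //.
    near=> y; rewrite /flat; suff -> : 0 < y by [].
    near: y; exact: lt_nbhsr.
  rewrite /flat x0.
  have dV : is_derive x 1 (fun y : R => y^-1) (- x ^- 2).
    by apply: is_derive_eq; [exact: (@is_deriveV _ id)|rewrite /GRing.scale/= mulr1].
  have dX : is_derive x 1 (fun y : R => y^-1 ^+ n) (n%:R * x^-1 ^+ n.-1 * - x ^- 2).
    exact: (@is_derive1_comp _ (fun z => z ^+ n) (fun y => y^-1) _ _ _ (is_derive_exprn _ _)).
  have dE : is_derive x 1 (fun y : R => expR (- y^-1)) (expR (- x^-1) * - (- x ^- 2)).
    exact: (@is_derive1_comp _ expR (fun y => - y^-1)).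
  apply: (is_derive_eq (is_derive_mul dX dE)).
  rewrite /GRing.scale/=.
  case: n {dX} => [|n] /=; rewrite ?exprS ?expr0; field => //.
- have -> : flat n.+2 0 - n%:R * flat n.+1 0 = 0 :> R by rewrite /flat ltxx mulr0 subrr.
  apply: (@is_derive0_le_sqr _ (n.+2)`!%:R) => y.
  by rewrite ger0_norm ?flat_ge0// flat_le_sqr.
Unshelve. all: by end_near. Qed.

(** A class closed under differentiation: smoothness of its members follows by induction on the
    order, without any formula for higher derivatives. *)
Inductive flat_alg : (R -> R) -> Prop :=
| flat_alg_cst c : flat_alg (cst c)
| flat_alg_flat n c d : flat_alg (fun x => flat n (c * x + d))
| flat_alg_add f g : flat_alg f -> flat_alg g -> flat_alg (fun x => f x + g x)
| flat_alg_mul f g : flat_alg f -> flat_alg g -> flat_alg (fun x => f x * g x).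

Lemma flat_alg_derive f : flat_alg f ->
  exists2 g, flat_alg g & forall x, is_derive x 1 f (g x).
Proof.
elim=> {f} [c|n c d|f g _ [f' Cf' df] _ [g' Cg' dg]|
    f g Cf [f' Cf' df] Cg [g' Cg' dg]].
- by exists (cst 0) => [|x]; [exact: flat_alg_cst|exact: is_derive_cst].
- exists (fun x => (flat n.+2 (c * x + d) + - n%:R * flat n.+1 (c * x + d)) * c).
    apply: flat_alg_mul; last exact: flat_alg_cst.
    apply: flat_alg_add; first exact: flat_alg_flat.
    by apply: flat_alg_mul; [exact: flat_alg_cst|exact: flat_alg_flat].
  move=> x; have := is_derive_flat n (c * x + d); rewrite -mulNr => H.
  apply: (@is_derive1_comp _ (flat n) (fun x => c * x + d)).
  apply: (is_derive_eq (is_derive_add (is_derive_mul (is_derive_cst c x 1)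
    (is_derive_id x 1)) (is_derive_cst d x 1))).
  by rewrite mulr1 mulr0 !addr0.
- exists (fun x => f' x + g' x); first exact: flat_alg_add.
  by move=> x; exact: is_deriveD.
- exists (fun x => f x * g' x + g x * f' x).
    by apply: flat_alg_add; apply: flat_alg_mul.
  by move=> x; exact: is_deriveM.
Qed.

Lemma flat_alg_smooth f : flat_alg f -> smooth f.
Proof.
move=> Cf n; suff: flat_alg (derive1n n f).
  by move=> /flat_alg_derive[g _ dg] x; case: (dg x).
elim: n => //= n /flat_alg_derive[g Cg dg].
suff -> : derive1 (derive1n n f) = g by [].
by apply/funext => x; rewrite derive1E; apply: derive_val.
Qed.

(** As n grows these test functions, with values in [0, 1], converge pointwise to the indicator of
    ]c, d[. *)
Definition bump c d n x : R := flat 0 (n%:R * (x - c)) * flat 0 (n%:R * (d - x)).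

Lemma bump_smooth c d n : smooth (bump c d n).
Proof.
have -> : bump c d n = (fun x =>
    flat 0 (n%:R * x + n%:R * - c) * flat 0 (- n%:R * x + n%:R * d)).
  by apply/funext => x; rewrite /bump; congr (flat _ _ * flat _ _); ring.
by apply/flat_alg_smooth/flat_alg_mul; exact: flat_alg_flat.
Qed.

Lemma bump_ge0 c d n x : 0 <= bump c d n x.
Proof. by rewrite mulr_ge0// flat_ge0. Qed.

Lemma bump_le1 c d n x : bump c d n x <= 1.
Proof. by rewrite mulr_ile1// ?flat_ge0// flat0_le1. Qed.

Lemma bump_eq0 c d n x : ~~ (c < x < d) -> bump c d n x = 0.
Proof.
rewrite /bump negb_and -!leNgt => /orP[xc|dx].
  by rewrite {1}/flat ltNge mulr_ge0_le0 ?subr_le0//= mul0r.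
by rewrite [X in _ * X]/flat ltNge mulr_ge0_le0 ?subr_le0//= mulr0.
Qed.

Lemma bump_Cc_smooth (D : set R) c d n : `[c, d] `<=` D -> Cc_smooth D (bump c d n).
Proof.
move=> cdD; have sub : closure [set x | bump c d n x != 0] `<=` `[c, d].
  rewrite [X in _ `<=` X](closure_id _).1; last exact: interval_closed.
  apply: closureS => x /=; apply: contra_neqP => /negP xcd; apply: bump_eq0.
  by apply: contra xcd => /andP[cx xd]; rewrite in_itv/= !ltW.
split; first exact: bump_smooth.
- apply: subclosed_compact sub; first exact: closed_closure.
  exact: segment_compact.
- exact: subset_trans sub cdD.
Qed.

Lemma bump_cvg c d x : c < x < d -> bump c d n x @[n --> \oo] --> (1:R).
Proof.
move=> /andP[cx xd].
have flat_cvg y : 0 < y -> flat 0 (n%:R * y) @[n --> \oo] --> (1:R).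
  move=> y0; have H : - (n%:R * y)^-1 @[n --> \oo] --> (- 0:R).
    apply: cvgN; rewrite -[X in _ --> X](mul0r y^-1).
    under eq_fun do rewrite invfM.
    apply: cvgMl; apply/gtr0_cvgV0; last exact: cvgr_idn.
    by exists 1%N => // n /= n0; rewrite ltr0n.
  have E0 : expR (- 0) = 1 :> R by rewrite oppr0 expR0.
  rewrite -[X in _ --> X]E0; apply: cvg_trans (continuous_cvg _ (@continuous_expR _ (- 0)) H).
  apply: near_eq_cvg; near=> n.
  have n0 : (0 < n)%N by near: n; exact: nbhs_infty_gt.
  by rewrite /flat mulr_gt0 ?ltr0n// expr0 mul1r.
rewrite -[X in _ --> X](mulr1 1); apply: cvgM; apply: flat_cvg; by rewrite subr_gt0.
Unshelve. all: by end_near. Qed.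

End bump.

Lemma Rdominated_cvg d (T : measurableType d) (R : realType)
    (m : {measure set T -> \bar R}) (D : set T) (f_ : nat -> T -> R) (f g : T -> R) :
  measurable D -> (forall n, measurable_fun D (f_ n)) ->
  (forall x, D x -> f_ n x @[n --> \oo] --> f x) ->
  m.-integrable D (EFin \o g) ->
  (forall n x, D x -> `|f_ n x| <= g x) ->
  \int[m]_(x in D) f_ n x @[n --> \oo] --> \int[m]_(x in D) f x.
Proof.
move=> mD mf_ ff ig fg.
have mE n : measurable_fun D (EFin \o f_ n) by exact/measurable_EFinP.
have cE x : D x -> (f_ n x)%:E @[n --> \oo] --> (f x)%:E.
  by move=> Dx; apply: cvg_EFin; [near=> n|exact: ff].
have dE n x : D x -> (`|(f_ n x)%:E| <= (g x)%:E)%E by move=> Dx; rewrite lee_fin fg.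
have mf : measurable_fun D (EFin \o f) by exact: (emeasurable_fun_cvg _ _ mE cE).
have [if_ _] := @dominated_convergence _ _ _ m _ mD (fun n x => (f_ n x)%:E)
  (EFin \o f) (EFin \o g) mE mf (aeW m cE) ig (aeW m (fun x n => dE n x)).
have /fineK <- : (\int[m]_(x in D) (f x)%:E)%E \is a fin_num by exact: integrable_fin_num.
by move=> /fine_cvgP[].
Unshelve. all: by end_near. Qed.

(** * The fundamental lemma of the calculus of variations *)

Section lindelof.
Context {R : realType}.
Local Notation mu := (@lebesgue_measure R).

(** Intervals with rational endpoints form a countable base. The exceptional set is covered by the
    exceptional sets of the good rational intervals, those on which P holds almost everywhere; the
    other intervals contribute the empty set. *)
Lemma ae_locally (D : set R) (P : R -> Prop) :
  (forall x, D x -> exists2 U, nbhs x U & {ae mu, forall y, U y -> P y}) ->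
  {ae mu, forall x, D x -> P x}.
Proof.
move=> DP.
pose I (q : rat * rat) : set R := [set` `](ratr q.1 : R), ratr q.2[].
pose good q := {ae mu, forall y, I q y -> P y}.
pose F n : set R := if unpickle n is Some q then
  [set y | [/\ good q, I q y & ~ P y]] else set0.
suff : mu.-negligible (\bigcup_n F n).
  apply: negligibleS => x /= /not_implyP[Dx nPx].
  have [U /nbhs_ballP[r /= r0 rU] UP] := DP x Dx.
  have xr1 : x - r < x by rewrite ltrBlDr ltrDl.
  have xr2 : x < x + r by rewrite ltrDl.
  have [q1 q1x] := rat_in_itvoo xr1.
  have [q2 q2x] := rat_in_itvoo xr2.
  exists (pickle (q1, q2)); first exact: Logic.I.
  rewrite /F pickleK; split; last exact: nPx.
    apply: aeS UP => y UPy; rewrite /I/= in_itv/= => /andP[qy yq]; apply: UPy.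
    apply: rU; rewrite /ball/= ltr_distlC.
    move: q1x q2x; rewrite !in_itv/= => /andP[? _] /andP[_ ?].
    by rewrite (lt_trans _ qy)// (lt_trans yq).
  by move: q1x q2x; rewrite /I/= !in_itv/= => /andP[_ ->] /andP[->].
apply: negligible_bigcup => n; rewrite /F; case: unpickle => [q|]; last exact: negligible_set0.
have [g|ng] := pselect (good q).
  by apply: negligibleS g => y [_ Iy nPy] /= /(_ Iy).
by apply: (@negligibleS _ _ _ _ set0); [move=> y [] | exact: negligible_set0].
Qed.

Lemma locally_integrable_itv (D : set R) (h : R -> R) c d :
  locally_integrable D h -> `[c, d] `<=` D -> mu.-integrable `[c, d] (EFin \o h).
Proof.
move=> [mh oD hD] cdD; apply/integrableP; split.
  apply/measurable_EFinP; apply: measurable_funS mh => //.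
  exact: open_measurable.
exact/hD/segment_compact.
Qed.

(** Dominated convergence along the bumps replaces smooth test functions by the indicator of an
    interval. *)
Lemma itv_integral_eq0 (D : set R) (h : R -> R) : locally_integrable D h ->
  (forall psi, Cc_smooth D psi -> \int[mu]_(x in D) (h x * psi x) = 0) ->
  forall c d, `[c, d] `<=` D -> \int[mu]_(x in `[c, d]) h x = 0.
Proof.
move=> lh h0 c d cdD.
have ih := locally_integrable_itv lh cdD.
have ih' : mu.-integrable `]c, d[ (EFin \o h).
  by apply: integrableS ih => //; exact: subset_itv_oo_cc.
have mh : measurable_fun `]c, d[ h by apply/measurable_EFinP; exact: measurable_int ih'.
have mb n : measurable_fun `]c, d[ (bump c d n).
  apply: measurable_funTS; apply: continuous_measurable_fun => x.
  apply: differentiable_continuous; apply/derivable1_diffP.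
  exact: (@bump_smooth _ c d n 0%N x).
suff <- : \int[mu]_(x in `]c, d[) h x = \int[mu]_(x in `[c, d]) h x.
  have E n : \int[mu]_(x in `]c, d[) (h x * bump c d n x) = 0.
    rewrite -[RHS](h0 _ (bump_Cc_smooth n cdD)).
    rewrite Rintegral_mkcond [RHS]Rintegral_mkcond; apply: eq_Rintegral => x _.
    rewrite !patchE; case: ifPn => [xcd|].
      rewrite ifT//; apply/mem_set/cdD/subset_itv_oo_cc; exact: set_mem xcd.
    rewrite notin_setE /= in_itv/= => /negP xcd.
    by rewrite bump_eq0// mulr0 if_same.
  have : \int[mu]_(x in `]c, d[) (h x * bump c d n x) @[n --> \oo] -->
      \int[mu]_(x in `]c, d[) h x; last first.
    under eq_fun do rewrite E.
    by move=> H; apply: (cvg_unique _ H (cvg_cst _)).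
  apply: (@Rdominated_cvg _ _ _ mu `]c, d[ (fun n x => h x * bump c d n x) h
    (fun x => `|h x|)) => //.
  - by move=> n; apply: measurable_funM => //; exact: mb.
  - move=> x; rewrite /= in_itv/= => xcd.
    rewrite -[X in _ --> X]mulr1; apply: cvgMr; exact: bump_cvg.
  - by have := integrable_abse ih'.
  - by move=> n x _; rewrite normrM ler_piMr// ger0_norm ?bump_ge0// bump_le1.
rewrite Rintegral_itv_bndo_bndc// Rintegral_itv_obnd_cbnd//.
by apply: integrableS ih => //; exact: subset_itv_oc_cc.
Qed.

(** Locally the primitive of h is constant, since h has integral 0 over every compact interval; by
    Lebesgue differentiation its derivative is h almost everywhere. *)
Lemma du_bois_reymond (D : set R) (h : R -> R) : locally_integrable D h ->
  (forall psi, Cc_smooth D psi -> \int[mu]_(x in D) (h x * psi x) = 0) ->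
  {ae mu, forall x, D x -> h x = 0}.
Proof.
move=> lh h0; apply: ae_locally => x Dx.
have [_ oD _] := lh.
have /nbhs_ballP[r /= r0 rD] : nbhs x D by exact: open_nbhs_nbhs.
set c := x - r / 2; set d := x + r / 2.
have cdD : `[c, d] `<=` D.
  move=> y; rewrite /= in_itv/= => /andP[cy yd]; apply: rD; rewrite /ball/=.
  rewrite ltr_distlC; apply/andP; split; move: cy yd; rewrite /c /d; lra.
exists (ball x (r / 2)); first by apply: nbhsx_ballx; rewrite divr_gt0.
have ih := locally_integrable_itv lh cdD.
(* Extension by zero, because Lebesgue differentiation is applied on the whole line. *)
pose f := h \_ `[c, d].
have if_ : mu.-integrable setT (EFin \o f).
  by rewrite /f -restrict_EFin; apply/integrable_restrict => //; rewrite setTI.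
have /lebesgue_differentiation : locally_integrable setT f.
  by apply: open_integrable_locally => //; exact: openT.
apply: aeS => y yf; rewrite /ball/= ltr_distlC => /andP[cy yd].
have iff : mu.-integrable [set` Interval (BLeft c) (BRight d)] (EFin \o f).
  by apply: integrableS if_.
have [_] := FTC1_lebesgue_pt yd iff cy yf.
rewrite {2}/f patchE mem_set; last by rewrite /= in_itv/= !ltW.
move=> <-; rewrite derive1E (@near_eq_derive _ _ _ _ (cst 0)) ?derive_cst//.
near=> z.
have zd : z <= d by near: z; exact: lt_le_nbhsl.
have sub : `[c, z] `<=` `[c, d] by apply: subset_itvl; rewrite bnd_simp.
rewrite -[RHS](itv_integral_eq0 lh h0 (subset_trans sub cdD)).
apply: eq_Rintegral => w /set_mem wz; rewrite /f patchE mem_set//; exact: sub.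
Unshelve. all: by end_near. Qed.

End lindelof.

(** * Integration against a measure with a density *)

Section density.
Local Open Scope ereal_scope.
Context d (T : measurableType d) (R : realType).
Variables (mu nu : {measure set T -> \bar R}) (w : T -> R).
Hypotheses (mw : measurable_fun setT w) (w0 : forall x, (0 <= w x)%R).
Hypothesis nuE : forall A, measurable A -> nu A = \int[mu]_(x in A) (w x)%:E.
Import HBNNSimple.

Lemma integral_density_nnsfun (h : {nnsfun T >-> R}) :
  \int[nu]_x (h x)%:E = \int[mu]_x ((h x)%:E * (w x)%:E).
Proof.
have mE k : measurable (h @^-1` [set k]) by exact: measurable_sfunP.
rewrite integralT_nnsfun sintegralE.
transitivity (\sum_(k \in range h) \int[mu]_x ((k * \1_(h @^-1` [set k]) x)%:E * (w x)%:E)).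
  apply: eq_fsbigr => k /set_mem[x _ <-]; rewrite nuE//.
  rewrite integral_mkcond -ge0_integralZl//; last 3 first.
  - by apply/(measurable_restrictT _ _).1 => //; apply/measurable_EFinP; exact: measurable_funTS.
  - by move=> y _; rewrite patchE; case: ifP; rewrite ?lee_fin.
  - by rewrite lee_fin.
  apply: eq_integral => y _; rewrite patchE indicE.
  by case: ifP => _; rewrite /= ?mulr1// ?mulr0 !mule0 ?mul0e.
rewrite -ge0_integral_fsum//; last 2 first.
- move=> k; apply: emeasurable_funM; last exact/measurable_EFinP.
  by apply/measurable_EFinP; exact: measurable_funM.
- by move=> k x _; apply: mule_ge0; [exact: nnfun_muleindic_ge0|rewrite lee_fin].
apply: eq_integral => x _.
rewrite -ge0_mule_fsuml; last by move=> k; exact: nnfun_muleindic_ge0.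
by rewrite fsumEFin// -fimfunE.
Qed.

Lemma ge0_integral_density (f : T -> \bar R) :
  measurable_fun setT f -> (forall x, 0 <= f x) ->
  \int[nu]_x f x = \int[mu]_x (f x * (w x)%:E).
Proof.
move=> mf f0; pose f_ := nnsfun_approx measurableT mf.
have fE x : f x = lim ((f_ n x)%:E @[n --> \oo]).
  by apply/esym/cvg_lim => //; exact: cvg_nnsfun_approx.
have ndf x m n : (m <= n)%N -> (f_ m x)%:E <= (f_ n x)%:E.
  by move=> mn; rewrite lee_fin; exact/lefP/nd_nnsfun_approx.
transitivity (limn (fun n => \int[nu]_x (f_ n x)%:E)).
  under eq_integral do rewrite fE.
  apply: monotone_convergence => //.
  - by move=> n; exact/measurable_EFinP.
  - by move=> n x _; rewrite lee_fin.
  - by move=> x _ m n; exact: ndf.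
under eq_fun do rewrite integral_density_nnsfun.
rewrite -monotone_convergence//; last 3 first.
- by move=> n; apply: emeasurable_funM; exact/measurable_EFinP.
- by move=> n x _; rewrite mule_ge0// lee_fin.
- by move=> x _ m n mn; apply: lee_wpmul2r; [rewrite lee_fin|exact: ndf].
apply: eq_integral => x _; apply/cvg_lim => //.
by apply: cvgeZr => //; exact: cvg_nnsfun_approx.
Qed.
End density.

(** * The substitution k = kappa(p) and its inverse *)

Section kappa.
Context {R : realType}.
Variable lambda : R.
Hypothesis lambda_gt0 : 0 < lambda.
Local Notation mu := (@lebesgue_measure R).
Implicit Types p k : R.

Definition kappa p : R := (Num.sqrt (p ^+ 2 - lambda ^+ 2))^-1.

(** For k > 0, p = varpi k is the zero of the argument of the kernel delta; it is also the point at
    which u is evaluated in the definition of W. *)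
Definition varpi k : R := Num.sqrt (1 + lambda ^+ 2 * k ^+ 2) / k.

Lemma subr_sqr_gt0 p : lambda < p -> 0 < p ^+ 2 - lambda ^+ 2.
Proof.
by move=> lp; rewrite subr_gt0 ltr_sqr// ?nnegrE ltW// (lt_trans lambda_gt0).
Qed.

Lemma sqrt_subr_sqr_gt0 p : lambda < p -> 0 < Num.sqrt (p ^+ 2 - lambda ^+ 2).
Proof. by move=> lp; rewrite sqrtr_gt0 subr_sqr_gt0. Qed.

Lemma kappa_gt0 p : lambda < p -> 0 < kappa p.
Proof. by move=> lp; rewrite invr_gt0 sqrt_subr_sqr_gt0. Qed.

Lemma sqrt_kappaE p : Num.sqrt (p ^+ 2 - lambda ^+ 2) = (kappa p)^-1.
Proof. by rewrite invrK. Qed.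

Lemma kappaX2 p : lambda < p -> (kappa p) ^- 2 = p ^+ 2 - lambda ^+ 2.
Proof. by move=> lp; rewrite -exprVn invrK sqr_sqrtr// ltW// subr_sqr_gt0. Qed.

Lemma varpi_gt0 k : 0 < k -> 0 < varpi k.
Proof.
move=> k0; rewrite divr_gt0// sqrtr_gt0.
by have := mulr_ge0 (sqr_ge0 lambda) (sqr_ge0 k); lra.
Qed.

Lemma varpiX2 k : 0 < k -> varpi k ^+ 2 = k ^- 2 + lambda ^+ 2.
Proof.
move=> k0; rewrite exprMn sqr_sqrtr; last by have := mulr_ge0 (sqr_ge0 lambda) (sqr_ge0 k); lra.
by rewrite exprVn mulrDl mul1r mulfK// expf_eq0/= gt_eqF.
Qed.

Lemma varpi_gt k : 0 < k -> lambda < varpi k.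
Proof.
move=> k0; rewrite -ltr_sqr ?nnegrE; [|exact: ltW|exact/ltW/varpi_gt0].
by rewrite varpiX2// ltrDr invr_gt0 exprn_gt0.
Qed.

Lemma varpiK k : 0 < k -> kappa (varpi k) = k.
Proof.
move=> k0; rewrite /kappa varpiX2// addrK -exprVn sqrtr_sqr ger0_norm ?invrK//.
by rewrite invr_ge0 ltW.
Qed.

Lemma kappaK p : lambda < p -> varpi (kappa p) = p.
Proof.
move=> lp; have p0 : 0 < p by exact: lt_trans lp.
apply/eqP; rewrite -(@eqrXn2 _ 2)//; last 2 first.
- exact/ltW/varpi_gt0/kappa_gt0.
- exact: ltW.
by rewrite varpiX2 ?kappa_gt0// kappaX2// subrK.
Qed.

Lemma kappa_lt p q : lambda < p -> lambda < q -> (kappa p < kappa q) = (q < p).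
Proof.
move=> lp lq; have p0 := lt_trans lambda_gt0 lp; have q0 := lt_trans lambda_gt0 lq.
rewrite /kappa ltf_pV2 ?posrE ?sqrt_subr_sqr_gt0// ltr_sqrt ?subr_sqr_gt0//.
by rewrite ltrD2r ltr_sqr// nnegrE ltW.
Qed.

Lemma is_derive_kappa p : lambda < p -> is_derive p 1 kappa (- (p * kappa p ^+ 3)).
Proof.
move=> lp.
have d1 : is_derive p 1 (fun q : R => q ^+ 2 - lambda ^+ 2) (2 * p).
  apply: (is_derive_eq (is_derive_add (is_derive_exprn 2 p) (is_derive_cst (- lambda ^+ 2) p 1))).
  by rewrite /= expr1 addr0.
have s0 := sqrt_subr_sqr_gt0 lp.
have d2 := @is_derive_comp _ _ (fun q => q ^+ 2 - lambda ^+ 2) p _ _ (is_derive1_sqrt (subr_sqr_gt0 lp)) d1.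
have sn0 : Num.sqrt (p ^+ 2 - lambda ^+ 2) != 0 by rewrite gt_eqF.
have d3 : is_derive p 1 kappa _ := @is_deriveV _ (fun q => Num.sqrt (q ^+ 2 - lambda ^+ 2)) p _ 1 sn0 d2.
apply: (is_derive_eq d3).
by rewrite /GRing.scale/= /kappa; field.
Qed.

Lemma continuous_kappa p : lambda < p -> {for p, continuous kappa}.
Proof.
by move=> /is_derive_kappa /is_derive_continuous.
Qed.

End kappa.

(** * Integration by substitution from (0, +oo) to (lambda, +oo) *)

Section change_of_variables.
Context {R : realType}.
Variable lambda : R.
Hypothesis lambda_gt0 : 0 < lambda.
Local Notation mu := (@lebesgue_measure R).
Local Notation kap := (kappa lambda).
Local Notation Om := (Omega lambda).

(** The Jacobian |kappa'| on [Om], extended by zero; the absolute values make it a nonnegative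
    density on the whole line. *)
Let wgt p : R := if lambda < p then `|p| * `|kap p| ^+ 3 else 0.

Let wgt_ge0 p : 0 <= wgt p.
Proof. by rewrite /wgt; case: ifP => // _; rewrite mulr_ge0// exprn_ge0. Qed.

Lemma mem_Omega p : Om p <-> lambda < p.
Proof. by rewrite /Omega/= in_itv/= andbT. Qed.

Lemma measurable_Omega : measurable Om. Proof. exact: measurable_itv. Qed.

Lemma open_Omega : open Om. Proof. exact: rray_open. Qed.

Lemma continuous_measurable_Omega (h : R -> R) :
  (forall p, lambda < p -> {for p, continuous h}) -> measurable_fun Om h.
Proof.
move=> ch; apply: open_continuous_measurable_fun; first exact: open_Omega.
by move=> p /set_mem/mem_Omega /ch.
Qed.

Let measurable_wgt : measurable_fun setT wgt.
Proof.
have -> : wgt = (fun p => `|p| * `|kap p| ^+ 3) \_ Om.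
  apply/funext => p; rewrite /wgt patchE; case: ifPn => lp.
    by rewrite mem_set//; exact/mem_Omega.
  by rewrite memNset// => /mem_Omega; exact/negP.
apply/(measurable_restrictT _ _).1; first exact: measurable_Omega.
apply: measurable_funM; first exact: measurable_funTS.
apply/measurable_funX/measurableT_comp => //.
by apply: continuous_measurable_Omega => p; exact: continuous_kappa.
Qed.

Let nu (A : set (measurableTypeR R)) : \bar R := (\int[mu]_(p in A) (wgt p)%:E)%E.

Let nu0 : nu set0 = 0%E. Proof. exact: integral_set0. Qed.
Let nu_ge0 A : (0 <= nu A)%E.
Proof. by apply: integral_ge0 => p _; rewrite lee_fin. Qed.
Let nu_sigma : semi_sigma_additive nu.
Proof.
apply: (@semi_sigma_additive_nng_induced _ _ _ mu (EFin \o wgt)).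
  exact/measurable_EFinP.
by move=> p; rewrite lee_fin.
Qed.
HB.instance Definition _ := isMeasure.Build _ _ _ nu nu0 nu_ge0 nu_sigma.

(** With the value 0 off [Om], the preimage of ]0, +oo[ is exactly [Om]. *)
Let kap0 : R -> measurableTypeR R := kap \_ Om.
Let mkap0 : measurable_fun setT kap0.
Proof.
apply/(measurable_restrictT _ _).1; first exact: measurable_Omega.
by apply: continuous_measurable_Omega => p; exact: continuous_kappa.
Qed.
HB.instance Definition _ := isMeasurableFun.Build _ _ _ _ kap0 mkap0.

Let nu_itv_cc c d : lambda < c -> c < d -> nu `[c, d] = (kap c - kap d)%:E.
Proof.
move=> lc cd.
have lx x : x \in `[c, d] -> lambda < x.
  by rewrite in_itv/= => /andP[cx _]; exact: lt_le_trans cx.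
have dk x : lambda < x -> is_derive x 1 (fun x => - kap x) (x * kap x ^+ 3).
  move=> h; have := is_deriveN (is_derive_kappa lambda_gt0 h); rewrite opprK; exact.
have ck x : lambda < x -> {for x, continuous (fun x => - kap x)}.
  by move=> /dk /is_derive_continuous.
transitivity (\int[mu]_(x in `[c, d]) (x * kap x ^+ 3)%:E)%E.
  apply: eq_integral => x /set_mem xcd; congr EFin; rewrite /wgt lx//.
  rewrite !ger0_norm//; first by apply/ltW/kappa_gt0 => //; exact: lx.
  by rewrite ltW// (lt_trans lambda_gt0)// lx.
rewrite (@continuous_FTC2 _ _ (fun x => - kap x))//.
- by rewrite -EFinB; congr EFin; ring.
- apply: continuous_in_subspaceT => x /set_mem /lx lx'.
  exact: (is_derive_continuous (is_derive_mul (is_derive_id x 1)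
    (is_derive_comp (is_derive_exprn 3 (kap x)) (is_derive_kappa lambda_gt0 lx')))).
- split.
  + by move=> x xcd; case: (dk x (lx x (subset_itv_oo_cc xcd))).
  + by apply: cvg_at_right_filter; apply: ck.
  + by apply: cvg_at_left_filter; apply: ck; exact: lt_trans cd.
- by move=> x xcd; rewrite derive1E; apply: derive_val; apply: dk; exact/lx/subset_itv_oo_cc.
Qed.


Let kappa_cvgy : kap p @[p --> +oo] --> (0 : R).
Proof.
apply/cvgrPdist_le => e e0; near=> p.
have lp : lambda < p by near: p; apply: nbhs_pinfty_gt; exact: num_real.
have vp : varpi lambda e < p by near: p; apply: nbhs_pinfty_gt; exact: num_real.
rewrite sub0r normrN ger0_norm; last exact/ltW/kappa_gt0.
by rewrite -(@varpiK _ lambda e e0) ltW// kappa_lt// varpi_gt.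
Unshelve. all: by end_near. Qed.

Let nu_itv_cy c : lambda < c -> nu `[c, +oo[ = (kap c)%:E.
Proof.
move=> lc.
have lx x : c <= x -> lambda < x by exact: lt_le_trans.
have dk x : lambda < x -> is_derive x 1 (fun x => - kap x) (x * kap x ^+ 3).
  move=> h; have := is_deriveN (is_derive_kappa lambda_gt0 h); rewrite opprK; exact.
transitivity (\int[mu]_(x in `[c, +oo[) (x * kap x ^+ 3)%:E)%E.
  apply: eq_integral => x /set_mem; rewrite /= in_itv/= andbT => /lx lx'.
  congr EFin; rewrite /wgt lx' !ger0_norm//; first exact/ltW/kappa_gt0.
  by rewrite ltW// (lt_trans lambda_gt0).
rewrite (@ge0_continuous_FTC2y _ _ (fun x => - kap x) _ 0)//.
- by rewrite -EFinB sub0r opprK.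
- move=> x /lx lx'; rewrite mulr_ge0// ?exprn_ge0// ltW// ?kappa_gt0//.
  exact: lt_trans lx'.
- apply: continuous_in_subspaceT => x /set_mem; rewrite /= in_itv/= andbT => /lx lx'.
  exact: (is_derive_continuous (is_derive_mul (is_derive_id x 1)
    (is_derive_comp (is_derive_exprn 3 (kap x)) (is_derive_kappa lambda_gt0 lx')))).
- by rewrite -oppr0; apply: cvgN; exact: kappa_cvgy.
- by move=> x /ltW/lx /dk[].
- apply: cvg_at_right_filter.
  by have /is_derive_continuous := dk _ lc.
- move=> x; rewrite in_itv/= andbT => /ltW/lx lx'.
  by rewrite derive1E; apply: derive_val; exact: dk.
Qed.

Let nu_itv_co c d : lambda < c -> c < d -> nu `[c, d[ = (kap c - kap d)%:E.
Proof.
move=> lc cd; rewrite -nu_itv_cc//; apply: integral_itv_bndo_bndc.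
by apply/measurable_EFinP; exact: measurable_funTS.
Qed.

Local Notation pnu := (pushforward nu kap0).

Let pnuM : {measure set (measurableTypeR R) -> \bar R} :=
  @measure_function_pushforward__canonical__measure_function_Measure _ _ _ _ _ nu kap0 mkap0.

Let m_neg : measurable (`]-oo, 0] : set (measurableTypeR R)).
Proof. exact: measurable_itv. Qed.

(** The right-hand side is the length of the part of ]c, d] in ]0, +oo[. As kappa decreases, the
    preimage agrees within [Om] with the empty set, [varpi d, +oo[ or [varpi d, varpi c[, according
    to the position of 0. *)
Let pnu_ocitv c d : c < d -> pnu `]c, d] = (Num.max d 0 - Num.max c 0)%:E.
Proof.
move=> cd; rewrite /pushforward.
have E (A B : set R) : (forall p, lambda < p -> (A p <-> B p)) -> nu A = nu B.
  move=> AB; rewrite /nu integral_mkcond [RHS]integral_mkcond.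
  apply: eq_integral => p _; rewrite !patchE /wgt.
  have [lp|lp] := boolP (lambda < p); last by do 2 case: ifP.
  suff -> : (p \in A) = (p \in B) by [].
  by apply/idP/idP => /set_mem /AB h; apply/mem_set; exact: h.
have k0E p : lambda < p -> kap0 p = kap p.
  by move=> lp; rewrite /kap0 patchE mem_set//; exact/mem_Omega.
have kle p e : 0 < e -> lambda < p -> (kap p <= e) = (varpi lambda e <= p).
  by move=> e0 lp; rewrite -{1}(@varpiK _ lambda e e0) leNgt kappa_lt ?varpi_gt// -leNgt.
have [d0|d0] := leP d 0.
  rewrite (E _ set0); last first.
    move=> p lp; split=> //=; rewrite in_itv/= k0E// => /andP[_].
    by move=> /le_trans/(_ d0); rewrite leNgt kappa_gt0.
  rewrite nu0; congr EFin.
  by rewrite max_r ?subrr// (le_trans (ltW cd)).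
have [c0|c0] := leP c 0.
  rewrite (E _ `[varpi lambda d, +oo[%classic); last first.
    move=> p lp; rewrite /= !in_itv/= k0E// andbT kle//.
    by rewrite (le_lt_trans c0) ?kappa_gt0.
  by rewrite nu_itv_cy ?varpi_gt// varpiK// subr0.
rewrite (E _ `[varpi lambda d, varpi lambda c[%classic); last first.
  by move=> p lp; rewrite /= !in_itv/= k0E// kle// ltNge kle// -ltNge andbC.
rewrite nu_itv_co ?varpi_gt//; first by rewrite !varpiK.
by rewrite -(@kappa_lt _ lambda)// ?varpi_gt// !varpiK.
Qed.

(** Uniqueness of Lebesgue measure concerns measures on the whole line, so the pushforward, which
    lives on the positive half, is completed by Lebesgue measure on the other half. *)
Let lebesgue_split (A : set R) : measurable A ->
  mu A = (measure_add pnuM (mrestr mu m_neg)) A.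
Proof.
move=> mA; apply: lebesgue_measure_unique => // _ [[c d]] _ <-/=.
have [dc|cd] := leP d c; first by rewrite set_itv_ge ?measure0// bnd_simp -leNgt.
rewrite /measure_add/msum 2!big_ord_recl big_ord0 adde0/=.
rewrite pnu_ocitv// /mrestr.
have -> : `]c, d] `&` `]-oo, 0] = [set` `]c, Num.min d 0]].
  apply/seteqP; split=> x /=; rewrite !in_itv/= le_min.
    by move=> [/andP[-> ->] ->].
  by move=> /andP[-> /andP[-> ->]].
rewrite !lebesgue_measure_itv/= !lte_fin cd.
have [d0|d0] := leP d 0.
  by rewrite cd max_r ?(le_trans (ltW cd))// subrr add0e.
have [c0|c0] := ltP c 0; rewrite -?EFinB -?EFinD; last by rewrite addr0.
by rewrite subr0 sub0r.
Qed.

Local Notation pos := ([set` `]0%R, +oo[%R] : set R).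

Lemma ge0_integral_kappa (G : R -> \bar R) : measurable_fun pos G ->
  (forall k, 0 < k -> (0 <= G k)%E) ->
  (\int[mu]_(k in pos) G k = \int[mu]_(p in Om) (G (kap p) * (p * kap p ^+ 3)%:E))%E.
Proof.
move=> mG G0.
have mpos : measurable (pos : set (measurableTypeR R)) by exact: measurable_itv.
have kap0E p : lambda < p -> kap0 p = kap p.
  by move=> lp; rewrite /kap0 patchE mem_set//; exact/mem_Omega.
have preim : kap0 @^-1` pos = Om.
  apply/seteqP; split=> p /=; rewrite in_itv/= andbT.
    rewrite /kap0 patchE; case: ifPn => [/set_mem//|_].
    by rewrite ltxx.
  by move=> /mem_Omega lp; rewrite kap0E// kappa_gt0.
transitivity (\int[pnuM]_(k in pos) G k)%E.
  apply: eq_measure_integral => A mA Apos.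
  have := lebesgue_split mA.
  rewrite /measure_add/msum 2!big_ord_recl big_ord0 adde0/= /mrestr.
  rewrite (_ : A `&` `]-oo, 0] = set0) ?measure0 ?adde0//.
  rewrite -subset0 => x [/Apos]; rewrite /= !in_itv/= andbT => x0.
  by rewrite leNgt x0.
rewrite ge0_integral_pushforward//; last first.
  by move=> k /set_mem; rewrite /= in_itv/= andbT => /G0.
rewrite preim.
have mGk : measurable_fun Om (G \o kap0).
  apply: (measurable_comp mpos) mG _; last exact: measurable_funTS mkap0.
  by move=> _ [p Omp <-]; rewrite -preim in Omp.
rewrite integral_mkcond (@ge0_integral_density _ _ _ mu nu wgt)//; last 2 first.
- by apply/(measurable_restrictT _ _).1 => //; exact: measurable_Omega.
- move=> p; rewrite patchE; case: ifPn => // /set_mem/mem_Omega lp /=.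
  by rewrite kap0E// G0// kappa_gt0.
rewrite [RHS]integral_mkcond; apply: eq_integral => p _; rewrite !patchE.
case: ifPn => [/set_mem/mem_Omega lp|_]; last by rewrite mul0e.
rewrite /= kap0E// /wgt lp !ger0_norm//; first exact/ltW/kappa_gt0.
by rewrite ltW// (lt_trans lambda_gt0).
Qed.

(** Positive and negative parts are transported separately, so the two sides agree even where the
    integral takes its default value. *)
Lemma integral_kappa (G : R -> R) : measurable_fun pos G ->
  \int[mu]_(k in pos) G k = \int[mu]_(p in Om) (G (kap p) * (p * kap p ^+ 3)).
Proof.
move=> mG; congr fine.
have wk0 p : lambda < p -> 0 <= p * kap p ^+ 3.
  move=> lp; have k0 := kappa_gt0 lambda_gt0 lp.
  by rewrite mulr_ge0 ?exprn_ge0 ?ltW// (lt_trans lambda_gt0).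
rewrite integralE [RHS]integralE !ge0_integral_kappa//.
- congr (_ - _)%E; apply: eq_integral => p /set_mem/mem_Omega lp.
  + rewrite !funeposE/= -[X in maxe _ X]/(0%:E) -[X in _ = maxe _ X]/(0%:E) -!EFin_max -EFinM.
    by rewrite maxr_pMl ?mul0r// wk0.
  + rewrite !funenegE/= -[X in maxe _ X]/(0%:E) -[X in _ = maxe _ X]/(0%:E).
    by rewrite -!EFin_max -EFinM maxr_pMl ?mul0r ?mulNr// wk0.
- by apply: measurable_funeneg; exact/measurable_EFinP.
- by apply: measurable_funepos; exact/measurable_EFinP.
Qed.

End change_of_variables.

(** * A cutoff function of class C^1 *)

Section cutoff.
Context {R : realType}.

Definition possq (x : R) : R := Num.max 0 x ^+ 2.

Lemma is_derive_possq (x : R) : is_derive x 1 possq (2 * Num.max 0 x).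
Proof.
have [x0|x0|->] := ltgtP x 0.
- rewrite mulr0; apply: (@near_eq_is_derive _ _ _ (cst 0)) => //.
  near=> y; rewrite /possq max_l ?expr0n//.
  by near: y; exact: lt_le_nbhsl.
- apply: (@near_eq_is_derive _ _ _ (fun y : R => y ^+ 2)) => //.
    near=> y; rewrite /possq max_r//.
    by near: y; exact: lt_le_nbhsr.
  by apply: (is_derive_eq (is_derive_exprn 2 x)); rewrite expr1.
- rewrite mulr0; apply: (@is_derive0_le_sqr _ _ 1) => y.
  rewrite mul1r /possq ger0_norm ?sqr_ge0//.
  by have [y0|y0] := leP 0 y; rewrite ?expr0n ?sqr_ge0.
Unshelve. all: by end_near. Qed.

Lemma continuous_maxr0 : continuous (fun x : R => Num.max 0 x).
Proof. by move=> x; apply: (@continuous_max _ _ (cst 0) id); [exact: cvg_cst|exact: cvg_id]. Qed.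

Variables (a b r : R).
Hypothesis r0 : 0 < r.

Let inner x : R := 1 - possq ((a - x) / r) - possq ((x - b) / r).

Let dinner x : R := 2 * Num.max 0 ((a - x) / r) / r - 2 * Num.max 0 ((x - b) / r) / r.

(** Built from squares of positive parts: C^1 is all the regularity that [calV] asks for, and the
    derivative is explicit. [inner] is 1 on [a, b] and nonpositive at distance r or more from it. *)
Definition cutoff x : R := possq (inner x).

Definition dcutoff x : R := 2 * Num.max 0 (inner x) * dinner x.

Let is_derive_aff (c d x : R) : is_derive x 1 (fun y : R => (c * y + d) / r) (c / r).
Proof.
apply: (is_derive_eq (is_derive_mul (is_derive_add (is_derive_mul
  (is_derive_cst c x 1) (is_derive_id x 1)) (is_derive_cst d x 1)) (is_derive_cst r^-1 x 1))).
by rewrite /=; ring.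
Qed.

Let is_derive_inner (x : R) : is_derive x 1 inner (dinner x).
Proof.
have -> : inner = fun x => (1 + -1 * possq ((-1 * x + a) / r)) + -1 * possq ((1 * x + - b) / r).
  by apply/funext => y; rewrite /inner !mul1r !mulN1r [- y + a]addrC.
have d1 := @is_derive_comp _ possq (fun y => (-1 * y + a) / r) x _ _
  (is_derive_possq _) (is_derive_aff (-1) a x).
have d2 := @is_derive_comp _ possq (fun y => (1 * y + - b) / r) x _ _
  (is_derive_possq _) (is_derive_aff 1 (- b) x).
have d3 := is_derive_add (is_derive_add (is_derive_const 1 x)
  (is_derive_mul (is_derive_const (-1) x) d1))
  (is_derive_mul (is_derive_const (-1) x) d2).
apply: (is_derive_eq d3).
by rewrite /= /dinner !mul1r !mulN1r [- x + a]addrC /cst; ring.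
Qed.

Lemma is_derive_cutoff (x : R) : is_derive x 1 cutoff (dcutoff x).
Proof. exact: (@is_derive_comp _ possq inner x _ _ (is_derive_possq _) (is_derive_inner x)). Qed.

Lemma continuous_dcutoff : continuous dcutoff.
Proof.
move=> x; rewrite /dcutoff.
have cm (f : R -> R) : continuous f -> continuous (fun y : R => Num.max 0 (f y)).
  by move=> cf y; apply: continuous_comp; [exact: cf|exact: continuous_maxr0].
have ca (c d : R) : continuous (fun y : R => (c * y + d) / r).
  by move=> y; exact: (is_derive_continuous (is_derive_aff c d y)).
have ci : continuous inner.
  by move=> y; exact: (is_derive_continuous (is_derive_inner y)).
apply: cvgM.
  by apply: cvgM; [exact: cvg_cst|exact: cm].
have E : dinner = fun x => 2 * Num.max 0 ((-1 * x + a) / r) / r - 2 * Num.max 0 ((1 * x + - b) / r) / r.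
  by apply/funext => y; rewrite /dinner !mul1r !mulN1r [- y + a]addrC.
rewrite E; apply: cvgB; (apply: cvgM; [apply: cvgM; [exact: cvg_cst|]|exact: cvg_cst]).
  exact: (cm _ (ca (-1) a) x).
exact: (cm _ (ca 1 (- b)) x).
Qed.

Lemma cutoff_eq1 x : a <= x <= b -> cutoff x = 1 /\ dcutoff x = 0.
Proof.
move=> /andP[ax xb].
have h1 : (a - x) / r <= 0 by rewrite pmulr_lle0 ?invr_gt0// subr_le0.
have h2 : (x - b) / r <= 0 by rewrite pmulr_lle0 ?invr_gt0// subr_le0.
rewrite /cutoff /dcutoff /inner /dinner /possq (max_l h1) (max_l h2) expr0n/= !subr0.
by rewrite !max_r ?ler01// expr1n; split => //; ring.
Qed.

Lemma cutoff_eq0 x : ~~ (a - r < x < b + r) -> cutoff x = 0 /\ dcutoff x = 0.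
Proof.
move=> xab; suff : inner x <= 0.
  by move=> h; rewrite /cutoff /dcutoff /possq (max_l h) expr0n/= mulr0 mul0r.
have ge1 y : 1 <= y -> 1 <= possq y.
  by move=> y1; rewrite /possq max_r ?(le_trans ler01)// exprn_ege1.
have ge0 y : 0 <= possq y by exact: sqr_ge0.
rewrite /inner; move: xab; rewrite negb_and -!leNgt => /orP[xa|xb].
  suff : 1 <= possq ((a - x) / r) by move=> h; have := ge0 ((x - b) / r); lra.
  by apply: ge1; rewrite ler_pdivlMr// mul1r; lra.
suff : 1 <= possq ((x - b) / r) by move=> h; have := ge0 ((a - x) / r); lra.
by apply: ge1; rewrite ler_pdivlMr// mul1r; lra.
Qed.

End cutoff.

(** * Supports, products and limits of integrable functions *)

Section square_integrable.
Context d (T : measurableType d) (R : realType).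
Variable m : {measure set T -> \bar R}.
Implicit Types (D K : set T) (f g h : T -> R).

Lemma Rintegral_support D K f : K `<=` D ->
  {ae m, forall x, D x -> ~ K x -> f x = 0} ->
  \int[m]_(x in D) f x = \int[m]_(x in K) f x.
Proof.
move=> KD f0; rewrite -[in RHS](setIidr KD) Rintegral_mkcondr.
apply: ae_Rintegral; apply: aeS f0 => x f0 Dx; rewrite patchE.
by case: ifPn => // /negP xK; apply: f0 => // Kx; apply: xK; exact: mem_set.
Qed.

Lemma integrable_support D K f : measurable D -> measurable K -> K `<=` D ->
  measurable_fun D f -> {ae m, forall x, D x -> ~ K x -> f x = 0} ->
  m.-integrable K (EFin \o f) -> m.-integrable D (EFin \o f).
Proof.
move=> mD mK KD mf f0 /integrableP[_ fK]; apply/integrableP; split.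
  exact/measurable_EFinP.
apply: le_lt_trans fK; rewrite -[in leRHS](setIidr KD) integral_mkcondr.
rewrite le_eqVlt; apply/orP; left; apply/eqP; apply: ae_integral.
apply: aeS f0 => x f0 Dx; rewrite patchE /=; case: ifPn => // /negP xK.
by rewrite f0 ?normr0// => Kx; apply: xK; exact: mem_set.
Qed.

Lemma integrable_addR D f g : measurable D ->
  m.-integrable D (EFin \o f) -> m.-integrable D (EFin \o g) ->
  m.-integrable D (EFin \o (fun x => f x + g x)).
Proof. by move=> mD fi gi; exact: (integrableD mD fi gi). Qed.

Lemma integrable_subR D f g : measurable D ->
  m.-integrable D (EFin \o f) -> m.-integrable D (EFin \o g) ->
  m.-integrable D (EFin \o (fun x => f x - g x)).
Proof. by move=> mD fi gi; exact: (integrableB mD fi gi). Qed.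

Lemma integrable_mul_sqr D f g : measurable D ->
  measurable_fun D f -> measurable_fun D g ->
  m.-integrable D (EFin \o (fun x => f x ^+ 2)) ->
  m.-integrable D (EFin \o (fun x => g x ^+ 2)) ->
  m.-integrable D (EFin \o (fun x => f x * g x)).
Proof.
move=> mD mf mg f2 g2.
apply: (le_integrable mD _ _ (integrableD mD f2 g2)).
  by apply/measurable_EFinP; exact: measurable_funM.
move=> x Dx /=; rewrite lee_fin normrM (@ger0_norm _ (_ + _)) ?addr_ge0 ?sqr_ge0//.
rewrite -(real_normK (num_real (f x))) -(real_normK (num_real (g x))).
by have := sqr_ge0 (`|f x| - `|g x|); nra.
Qed.

Lemma integrable_mul_bounded D (c f : T -> R) M : measurable D ->
  measurable_fun D c -> (forall x, D x -> `|c x| <= M) ->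
  m.-integrable D (EFin \o f) -> m.-integrable D (EFin \o (fun x => c x * f x)).
Proof.
move=> mD mc cM fi.
have mf : measurable_fun D f by apply/measurable_EFinP; exact: measurable_int fi.
apply: (le_integrable mD _ _ (integrableZl mD M fi)).
  by apply/measurable_EFinP; exact: measurable_funM.
move=> x Dx /=; rewrite lee_fin !normrM ler_wpM2r//.
by rewrite (le_trans (cM x Dx))// ler_norm.
Qed.

Lemma integrable_cstR D (r : R) : measurable D -> (m D < +oo)%E ->
  m.-integrable D (EFin \o (fun=> r)).
Proof.
move=> mD Dy; apply: measurable_bounded_integrable => //.
by exists `|r|; split; [exact: num_real|move=> x rx y _; exact: ltW].
Qed.

Lemma cvg_Rintegral_mul_sqr D (h_ : nat -> T -> R) g : measurable D ->
  (forall n, measurable_fun D (h_ n)) -> measurable_fun D g ->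
  m.-integrable D (EFin \o (fun x => g x ^+ 2)) ->
  (\int[m]_(x in D) (h_ n x ^+ 2)%:E @[n --> \oo] --> 0)%E ->
  \int[m]_(x in D) (h_ n x * g x) @[n --> \oo] --> (0 : R).
Proof.
move=> mD mh mg g2 h0.
pose G := \int[m]_(x in D) (g x ^+ 2).
have G0 : 0 <= G by apply: Rintegral_ge0 => x _; exact: sqr_ge0.
move/fine_cvgP : (h0) => [fin hfin].
apply/cvgrPdist_le => e e0.
(* The weight of the inequality between means: once the integral of h_n^2 is at most s e, the first
   half contributes e / 2, and s G <= e bounds the second by e / 2. G may be 0, hence G + 1. *)
pose s := e / (G + 1).
have G1 : 0 < G + 1 by rewrite ltr_wpDl.
have s0 : 0 < s by rewrite divr_gt0.
have /cvgrPdist_le/(_ (s * e)) := hfin.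
rewrite mulr_gt0// => /(_ isT) hse.
near=> n.
have fn : (\int[m]_(x in D) (h_ n x ^+ 2)%:E)%E \is a fin_num by near: n.
have h2 : m.-integrable D (EFin \o (fun x => h_ n x ^+ 2)).
  apply/integrableP; split; first by apply/measurable_EFinP; exact: measurable_funX.
  under eq_integral do rewrite /= ger0_norm ?sqr_ge0//.
  by rewrite ltey_eq fn.
have Hn : \int[m]_(x in D) (h_ n x ^+ 2) <= s * e.
  have : `|0 - fine (\int[m]_(x in D) (h_ n x ^+ 2)%:E)%E| <= s * e by near: n.
  by rewrite sub0r normrN ger0_norm// fine_ge0// integral_ge0// => x _; rewrite lee_fin sqr_ge0.
rewrite sub0r normrN.
have ihg := integrable_mul_sqr mD (mh n) mg h2 g2.
apply: (le_trans (le_normr_Rintegral mD ihg)).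
(* AM-GM: [|h g| <= h^2 / (2 s) + s g^2 / 2] *)
pose k x := (2 * s)^-1 * h_ n x ^+ 2 + s / 2 * g x ^+ 2.
have ik1 := integrableZl mD (2 * s)^-1 h2.
have ik2 := integrableZl mD (s / 2) g2.
have ik : m.-integrable D (EFin \o k) by exact: (integrableD mD ik1 ik2).
have : \int[m]_(x in D) `|h_ n x * g x| <= \int[m]_(x in D) k x.
  apply: le_Rintegral => //; first exact: (integrable_abse ihg).
  move=> x _; rewrite normrM /k.
  rewrite -(real_normK (num_real (h_ n x))) -(real_normK (num_real (g x))).
  set a := `|h_ n x|; set b := `|g x|.
  rewrite -subr_ge0.
  have -> : (2 * s)^-1 * a ^+ 2 + s / 2 * b ^+ 2 - a * b = (2 * s)^-1 * (a - s * b) ^+ 2.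
    by field; rewrite gt_eqF.
  by rewrite mulr_ge0 ?sqr_ge0// invr_ge0 mulr_ge0 ?ltW.
move=> /le_trans; apply.
rewrite /k RintegralD// RintegralZl// RintegralZl// -/G.
apply: (@le_trans _ _ ((2 * s)^-1 * (s * e) + s / 2 * G)).
  by rewrite lerD2r ler_pM2l// invr_gt0 mulr_gt0.
have -> : (2 * s)^-1 * (s * e) = e / 2 by field; rewrite gt_eqF.
have : s * G <= e.
  by rewrite /s mulrAC ler_pdivrMr// ler_pM2l// lerDl.
lra.
Unshelve. all: by end_near. Qed.

End square_integrable.

Section smooth_lemmas.
Context {R : realType}.

Lemma smooth_is_derive (h : R -> R) (x : R) : smooth h -> is_derive x 1 h (derive1 h x).
Proof. by move=> /(_ 0%N x) /= dh; split => //; rewrite derive1E. Qed.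

Lemma smooth_continuous (h : R -> R) : smooth h -> continuous h.
Proof. by move=> sh x; exact: (is_derive_continuous (smooth_is_derive x sh)). Qed.

Lemma smooth_derive1 (h : R -> R) : smooth h -> smooth (derive1 h).
Proof. by move=> sh n x; have := sh n.+1 x; rewrite derive1Sn. Qed.

Lemma derive1_eq0_closure (h : R -> R) (x : R) :
  ~ closure [set y | h y != 0] x -> derive1 h x = 0.
Proof.
move=> nx; rewrite derive1E (@near_eq_derive _ _ _ _ (cst 0)) ?derive_cst//.
have : nbhs x (~` closure [set y | h y != 0]).
  by apply: open_nbhs_nbhs; split => //; exact/closed_openC/closed_closure.
apply: filterS => y /=; apply: contra_notP => /eqP hy.
exact: subset_closure.
Qed.

End smooth_lemmas.

(** * Integration by parts in W_0^{1,2} *)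

Section sobolev.
Context {R : realType}.
Variable lambda : R.
Local Notation mu := (@lebesgue_measure R).
Local Notation Om := (Omega lambda).

Lemma itv_Omega a b : lambda < a -> `[a, b] `<=` Om.
Proof.
move=> la x; rewrite /= in_itv/= => /andP[ax _]; apply/mem_Omega.
exact: lt_le_trans ax.
Qed.

Lemma itv_integrable (f : R -> R) a b :
  (forall p, a <= p -> p <= b -> {for p, continuous f}) ->
  mu.-integrable `[a, b] (EFin \o f).
Proof.
move=> cf; apply: continuous_compact_integrable; first exact: segment_compact.
apply: continuous_in_subspaceT => x /set_mem; rewrite /= in_itv/= => /andP[].
exact: cf.
Qed.

Lemma itv_measurable (f : R -> R) a b :
  (forall p, a <= p -> p <= b -> {for p, continuous f}) ->
  measurable_fun `[a, b] f.
Proof.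
by move=> cf; apply/measurable_EFinP; exact: (measurable_int mu (itv_integrable cf)).
Qed.

Variables (v dv : R -> R).
Hypothesis vW : W012 Om v dv.

Lemma W012_measurable : measurable_fun Om v /\ measurable_fun Om dv.
Proof. by have [[[? _ _] [? _ _] _] _ _] := vW. Qed.

Lemma W012_sqr : mu.-integrable Om (EFin \o (fun x => v x ^+ 2)) /\
  mu.-integrable Om (EFin \o (fun x => dv x ^+ 2)).
Proof.
have [mv mdv] := W012_measurable; have [_ fin _] := vW.
have iD : mu.-integrable Om (EFin \o (fun x => v x ^+ 2 + dv x ^+ 2)).
  apply/integrableP; split.
    by apply/measurable_EFinP; apply: measurable_funD; exact: measurable_funX.
  by under eq_integral do rewrite /= ger0_norm ?addr_ge0 ?sqr_ge0//.
split; apply: le_integrable iD; try exact: measurable_Omega.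
- by apply/measurable_EFinP; exact: measurable_funX.
- move=> x _ /=; rewrite lee_fin !ger0_norm ?addr_ge0 ?sqr_ge0//.
  by rewrite lerDl sqr_ge0.
- by apply/measurable_EFinP; exact: measurable_funX.
- move=> x _ /=; rewrite lee_fin !ger0_norm ?addr_ge0 ?sqr_ge0//.
  by rewrite lerDr sqr_ge0.
Qed.

(** Each of the two integrals is squeezed below the squared norm over all of [Om]. *)
Lemma W012_approx a b : lambda < a -> exists phi : nat -> R -> R,
  [/\ forall n, smooth (phi n),
     (\int[mu]_(x in `[a, b]) ((phi n x - v x) ^+ 2)%:E @[n --> \oo] --> 0)%E &
     (\int[mu]_(x in `[a, b]) ((derive1 (phi n) x - dv x) ^+ 2)%:E @[n --> \oo] --> 0)%E].
Proof.
move=> la; have [_ _ [phi [Cphi cphi]]] := vW.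
have [mv mdv] := W012_measurable.
have mphi n : measurable_fun Om (phi n).
  apply: measurable_funTS; apply: continuous_measurable_fun.
  by have [sp _ _] := Cphi n; exact: smooth_continuous.
have mdphi n : measurable_fun Om (derive1 (phi n)).
  apply: measurable_funTS; apply: continuous_measurable_fun.
  by have [sp _ _] := Cphi n; exact/smooth_continuous/smooth_derive1.
have mOm := @measurable_Omega _ lambda.
have m1 n : measurable_fun Om (fun x => (phi n x - v x) ^+ 2).
  by apply: measurable_funX; exact: measurable_funB.
have m2 n : measurable_fun Om (fun x => (derive1 (phi n) x - dv x) ^+ 2).
  by apply: measurable_funX; exact: measurable_funB.
exists phi; split; first by move=> n; have [] := Cphi n.
- apply: (@squeeze_cvge _ _ _ _ (cst 0%E) _ (fun n =>
    W12_sqnorm Om (phi n \- v) (derive1 (phi n) \- dv))) => //; last exact: cvg_cst.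
  apply: nearW => n; apply/andP; split.
    by apply: integral_ge0 => x _; rewrite lee_fin sqr_ge0.
  apply: (@le_trans _ _ (\int[mu]_(x in Om) ((phi n x - v x) ^+ 2)%:E)%E).
    apply: ge0_subset_integral => //; last exact: itv_Omega.
      by apply/measurable_EFinP; exact: m1.
    by move=> x _; rewrite lee_fin sqr_ge0.
  apply: ge0_le_integral => //.
  + by move=> x _; rewrite lee_fin sqr_ge0.
  + by apply/measurable_EFinP; exact: m1.
  + by apply/measurable_EFinP; apply: measurable_funD; [exact: m1|exact: m2].
  + by move=> x _; rewrite lee_fin lerDl sqr_ge0.
- apply: (@squeeze_cvge _ _ _ _ (cst 0%E) _ (fun n =>
    W12_sqnorm Om (phi n \- v) (derive1 (phi n) \- dv))) => //; last exact: cvg_cst.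
  apply: nearW => n; apply/andP; split.
    by apply: integral_ge0 => x _; rewrite lee_fin sqr_ge0.
  apply: (@le_trans _ _ (\int[mu]_(x in Om) ((derive1 (phi n) x - dv x) ^+ 2)%:E)%E).
    apply: ge0_subset_integral => //; last exact: itv_Omega.
      by apply/measurable_EFinP; exact: m2.
    by move=> x _; rewrite lee_fin sqr_ge0.
  apply: ge0_le_integral => //.
  + by move=> x _; rewrite lee_fin sqr_ge0.
  + by apply/measurable_EFinP; exact: m2.
  + by apply/measurable_EFinP; apply: measurable_funD; [exact: m1|exact: m2].
  + by move=> x _; rewrite lee_fin lerDr sqr_ge0.
Qed.

Lemma cvg_sqr_mul a b (h_ : nat -> R -> R) (h g : R -> R) : lambda < a ->
  (forall n, measurable_fun `[a, b] (h_ n)) ->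
  (forall n, mu.-integrable `[a, b] (EFin \o (fun x => h_ n x * g x))) ->
  mu.-integrable `[a, b] (EFin \o (fun x => h x * g x)) ->
  measurable_fun `[a, b] h -> measurable_fun `[a, b] g ->
  mu.-integrable `[a, b] (EFin \o (fun x => g x ^+ 2)) ->
  (\int[mu]_(x in `[a, b]) ((h_ n x - h x) ^+ 2)%:E @[n --> \oo] --> 0)%E ->
  \int[mu]_(x in `[a, b]) (h_ n x * g x) @[n --> \oo] -->
  \int[mu]_(x in `[a, b]) (h x * g x).
Proof.
move=> la mh_ ih_ ih mh mg g2 h0.
have mh_B n : measurable_fun `[a, b] (fun x => h_ n x - h x) by exact: measurable_funB.
have mJ : measurable (`[a, b] : set (measurableTypeR R)) by exact: measurable_itv.
have := cvg_Rintegral_mul_sqr mJ mh_B mg g2 h0.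
have E n : \int[mu]_(x in `[a, b]) ((h_ n x - h x) * g x) =
    \int[mu]_(x in `[a, b]) (h_ n x * g x) - \int[mu]_(x in `[a, b]) (h x * g x).
  by rewrite -RintegralB//; apply: eq_Rintegral => x _; rewrite mulrBl.
under eq_fun do rewrite E.
move=> H; apply/subr_cvg0; exact: H.
Qed.

(** psi is only C^1, so it is no admissible test function for the weak derivative. The classical
    formula holds for the smooth approximants of v, and both sides converge because psi and its
    derivative are square integrable on [a, b]. *)
Lemma W012_by_parts_compact (psi dpsi : R -> R) a b : lambda < a -> a < b ->
  (forall p, lambda < p -> is_derive p 1 psi (dpsi p)) ->
  (forall p, lambda < p -> {for p, continuous dpsi}) ->
  psi a = 0 -> psi b = 0 ->
  \int[mu]_(x in `[a, b]) (v x * dpsi x) = - \int[mu]_(x in `[a, b]) (dv x * psi x).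
Proof.
move=> la ab dpsiE cdpsi psia psib.
have [phi [sphi phi1 phi2]] := W012_approx b la.
have lJ p : a <= p -> lambda < p by exact: lt_le_trans.
have cpsi p : lambda < p -> {for p, continuous psi}.
  by move=> /dpsiE /is_derive_continuous.
have mJ : measurable (`[a, b] : set (measurableTypeR R)) by exact: measurable_itv.
have [mv mdv] : measurable_fun `[a, b] v /\ measurable_fun `[a, b] dv.
  have [mv mdv] := W012_measurable.
  by split; [apply: measurable_funS mv|apply: measurable_funS mdv];
    rewrite ?[Om]/Om; try exact: measurable_Omega; exact: itv_Omega.
have [v2 dv2] : mu.-integrable `[a, b] (EFin \o (fun x => v x ^+ 2)) /\
    mu.-integrable `[a, b] (EFin \o (fun x => dv x ^+ 2)).
  have [v2 dv2] := W012_sqr.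
  by split; [apply: integrableS v2|apply: integrableS dv2];
    try exact: measurable_Omega; try exact: itv_Omega.
have ci (f : R -> R) : (forall p, lambda < p -> {for p, continuous f}) ->
    measurable_fun `[a, b] f /\ mu.-integrable `[a, b] (EFin \o (fun x => f x ^+ 2)).
  move=> cf; split; first by apply: itv_measurable => p /lJ /cf.
  by apply: itv_integrable => p /lJ lp _; apply: continuousM; exact: cf.
have [mpsi psi2] := ci _ cpsi; have [mdpsi dpsi2] := ci _ cdpsi.
have cphi n p : lambda < p -> {for p, continuous (phi n)}.
  by move=> _; exact: smooth_continuous.
have cdphi n p : lambda < p -> {for p, continuous (derive1 (phi n))}.
  by move=> _; exact/smooth_continuous/smooth_derive1.
have := cvg_sqr_mul la (fun n => (ci _ (cphi n)).1)
  (fun n => integrable_mul_sqr mJ (ci _ (cphi n)).1 mdpsi (ci _ (cphi n)).2 dpsi2)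
  (integrable_mul_sqr mJ mv mdpsi v2 dpsi2) mv mdpsi dpsi2 phi1.
have E n : \int[mu]_(x in `[a, b]) (phi n x * dpsi x) =
    - \int[mu]_(x in `[a, b]) (derive1 (phi n) x * psi x).
  rewrite (@Rintegration_by_parts _ (phi n) psi (derive1 (phi n)) dpsi a b) //.
  - by rewrite psia psib !mulr0 subrr add0r.
  - by apply: continuous_subspaceT; exact/smooth_continuous/smooth_derive1.
  - split; first by move=> x _; case: (smooth_is_derive x (sphi n)).
    + by apply: cvg_at_right_filter; exact: smooth_continuous.
    + by apply: cvg_at_left_filter; exact: smooth_continuous.
  - apply: continuous_in_subspaceT => x /set_mem; rewrite /= in_itv/= => /andP[/lJ lx _].
    exact: cdpsi.
  - split.
    + by move=> x; rewrite in_itv/= => /andP[/ltW/lJ lx _]; case: (dpsiE x lx).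
    + by apply: cvg_at_right_filter; exact: cpsi.
    + by apply: cvg_at_left_filter; apply: cpsi; exact: lt_trans ab.
  - move=> x; rewrite in_itv/= => /andP[/ltW/lJ lx _].
    by rewrite derive1E; apply: derive_val; exact: dpsiE.
under eq_fun do rewrite E.
have := cvg_sqr_mul la (fun n => (ci _ (cdphi n)).1)
  (fun n => integrable_mul_sqr mJ (ci _ (cdphi n)).1 mpsi (ci _ (cdphi n)).2 psi2)
  (integrable_mul_sqr mJ mdv mpsi dv2 psi2) mdv mpsi psi2 phi2.
move=> /cvgN H1 H2.
exact: (cvg_unique _ H2 H1).
Qed.

End sobolev.

Lemma compact_le_normr (R : realType) (X : topologicalType) (K : set X) (f : X -> R) :
  compact K -> {within K, continuous f} -> exists M, forall x, K x -> `|f x| <= M.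
Proof.
move=> cK cf; have /compact_bounded[M [_ MP]] := continuous_compact cf cK.
exists (`|M| + 1) => x Kx; apply: (MP (`|M| + 1)); last by exists x.
by rewrite (le_lt_trans (ler_norm _))// ltrDl.
Qed.

(** * Uniqueness of weak derivatives *)

Section weak_derivative.
Context {R : realType}.
Local Notation mu := (@lebesgue_measure R).

Lemma Rintegral_eq0 (D : set R) (f : R -> R) :
  {ae mu, forall x, D x -> f x = 0} -> \int[mu]_(x in D) f x = 0.
Proof.
move=> f0; rewrite (@Rintegral_support _ _ _ mu _ set0)// ?Rintegral_set0//.
by apply: aeS f0 => x f0 /f0.
Qed.

Lemma locally_integrable_mul_Cc (D : set R) (h psi : R -> R) :
  locally_integrable D h -> Cc_smooth D psi ->
  mu.-integrable D (EFin \o (fun x => h x * psi x)).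
Proof.
move=> [mh oD hD] [spsi cC CD]; set C := closure _ in cC CD.
have mD : measurable (D : set (measurableTypeR R)) by exact: open_measurable.
have mC : measurable (C : set (measurableTypeR R)) by exact: compact_measurable.
have cpsi := smooth_continuous spsi.
have mpsi (E : set R) : measurable_fun E psi.
  by apply: measurable_funTS; exact: continuous_measurable_fun.
apply: (integrable_support mD mC CD).
- by apply: measurable_funM => //; exact: mpsi.
- apply: aeW => x Dx Cx; have [->|psix] := eqVneq (psi x) 0; first by rewrite mulr0.
  by exfalso; apply: Cx; exact: subset_closure.
have [M psiM] := compact_le_normr cC (continuous_subspaceT cpsi).
have hC : mu.-integrable C (EFin \o h).
  apply/integrableP; split; last exact: hD.
  by apply/measurable_EFinP; apply: measurable_funS mh.
have := integrable_mul_bounded mC (mpsi C) psiM hC.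
by apply: eq_integrable => // x _ /=; rewrite mulrC.
Qed.

Lemma weak_deriv_unique (D : set R) (h g1 g2 : R -> R) :
  is_weak_deriv D h g1 -> is_weak_deriv D h g2 ->
  {ae mu, forall x, D x -> g1 x = g2 x}.
Proof.
move=> [_ lg1 w1] [_ lg2 w2].
have mD : measurable (D : set (measurableTypeR R)).
  by have [_ oD _] := lg1; exact: open_measurable.
have := @du_bois_reymond _ D _ (locally_integrableB lg1 lg2).
move=> H; apply: aeS (H _) => [x g12 /g12/eqP|psi Cpsi].
  by rewrite subr_eq0 => /eqP.
transitivity (\int[mu]_(x in D) (g1 x * psi x - g2 x * psi x)).
  by apply: eq_Rintegral => x _; rewrite mulrBl.
rewrite RintegralB//; try exact: locally_integrable_mul_Cc.
by apply/eqP; rewrite subr_eq0; apply/eqP/oppr_inj; rewrite -w1// -w2.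
Qed.

(** The existence of g ensures that [xget] returns a weak derivative rather than its default
    value. *)
Lemma weak_deriv_ae (D : set R) (h g : R -> R) : is_weak_deriv D h g ->
  {ae mu, forall x, D x -> weak_deriv D h x = g x}.
Proof.
move=> hg; apply: (weak_deriv_unique _ hg).
exact: (@xgetPex _ (fun=> 0) [set g | is_weak_deriv D h g] (ex_intro _ g hg)).
Qed.

End weak_derivative.

(** * Sobolev functions vanishing off [A, B] *)

Section sobolev_support.
Context {R : realType}.
Variables (lambda A B : R).
Hypotheses (lA : lambda < A) (AB : A < B).
Local Notation mu := (@lebesgue_measure R).
Local Notation Om := (Omega lambda).
Local Notation K := [set` `[A, B]].
Variables (v dv : R -> R).
Hypothesis vW : W012 Om v dv.
Hypothesis v0 : {ae mu, forall x, Om x -> ~ K x -> v x = 0}.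

Let mK : measurable (`[A, B] : set (measurableTypeR R)).
Proof. exact: measurable_itv. Qed.
Let mOm : measurable (Om : set (measurableTypeR R)).
Proof. exact: measurable_Omega. Qed.
Let KOm : K `<=` Om. Proof. exact: itv_Omega. Qed.
Let KP p : K p -> lambda < p. Proof. by move/KOm/mem_Omega. Qed.

(** Against a test function supported in the open set [Om] minus [K], the defining identity of dv
    has left-hand side 0; the fundamental lemma on that set concludes. *)
Lemma W012_deriv_support : {ae mu, forall x, Om x -> ~ K x -> dv x = 0}.
Proof.
have [[lv [mdv oOm hdv] wk] _ _] := vW.
pose D := Om `&` ~` K.
have oD : open D.
  by apply: openI; [exact: open_Omega|exact/closed_openC/interval_closed].
have mD : measurable (D : set (measurableTypeR R)) by exact: open_measurable.
have DOm : D `<=` Om by move=> x [].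
have ldvD : locally_integrable D dv.
  split => //; first exact: measurable_funS mdv.
  by move=> C CD; apply: hdv; exact: subset_trans CD DOm.
apply: aeS (du_bois_reymond ldvD _) => [x dv0 Omx nKx|psi Cpsi]; first exact: dv0.
have [sp cp pD] := Cpsi.
have COm : Cc_smooth Om psi by split => //; exact: subset_trans pD DOm.
have psi0 x : K x -> psi x = 0 /\ derive1 psi x = 0.
  move=> Kx; have nx : ~ closure [set y | psi y != 0] x by move=> /pD[].
  split; last exact: derive1_eq0_closure.
  have [//|psix] := eqVneq (psi x) 0.
  by exfalso; apply: nx; exact: subset_closure.
have <- : \int[mu]_(x in Om) (dv x * psi x) = \int[mu]_(x in D) (dv x * psi x).
  apply: Rintegral_support => //; apply: aeW => x Omx nDx.
  have [/psi0[-> _]|Kx] := pselect (K x); first by rewrite mulr0.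
  by exfalso; apply: nDx.
apply: oppr_inj; rewrite -wk// oppr0; apply: Rintegral_eq0.
apply: aeS v0 => x v0x Omx; have [/psi0[_ ->]|nKx] := pselect (K x).
  by rewrite mulr0.
by rewrite v0x// mul0r.
Qed.

(** No boundary values of psi enter: psi is multiplied by a cutoff equal to 1 on [K], which changes
    nothing where v and dv live. *)
Lemma W012_by_parts (psi dpsi : R -> R) :
  (forall p, lambda < p -> is_derive p 1 psi (dpsi p)) ->
  (forall p, lambda < p -> {for p, continuous dpsi}) ->
  \int[mu]_(x in K) (v x * dpsi x) = - \int[mu]_(x in K) (dv x * psi x).
Proof.
move=> dpsiE cdpsi.
(* Half the distance to lambda keeps the enlarged interval inside [Om]. *)
pose r := (A - lambda) / 2.
have r0 : 0 < r by rewrite divr_gt0// subr_gt0.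
have la : lambda < A - r by move: lA; rewrite /r; lra.
have ab : A - r < B + r by move: lA AB r0; lra.
pose chi := cutoff A B r; pose dchi := dcutoff A B r.
have chi1 x : K x -> chi x = 1 /\ dchi x = 0.
  by rewrite /= in_itv/= => /(cutoff_eq1 r0).
have KJ : K `<=` `[A - r, B + r].
  by move=> x; rewrite /= !in_itv/= => /andP[Ax xB]; apply/andP; split; move: Ax xB r0; lra.
have JOm : `[A - r, B + r] `<=` Om by exact: itv_Omega.
have := @W012_by_parts_compact _ _ _ _ vW (fun x => chi x * psi x)
  (fun x => chi x * dpsi x + psi x * dchi x) _ _ la ab.
have -> : \int[mu]_(x in K) (v x * dpsi x) =
    \int[mu]_(x in `[A - r, B + r]) (v x * (chi x * dpsi x + psi x * dchi x)).
  rewrite (@Rintegral_support _ _ _ mu `[A - r, B + r] K)//; last first.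
    by apply: aeS v0 => x v0x /JOm/v0x => h /h ->; rewrite mul0r.
  by apply: eq_Rintegral => x /set_mem/chi1[-> ->]; rewrite mul1r mulr0 addr0.
have -> : \int[mu]_(x in K) (dv x * psi x) =
    \int[mu]_(x in `[A - r, B + r]) (dv x * (chi x * psi x)).
  rewrite (@Rintegral_support _ _ _ mu `[A - r, B + r] K)//; last first.
    by apply: aeS W012_deriv_support => x v0x /JOm/v0x => h /h ->; rewrite mul0r.
  by apply: eq_Rintegral => x /set_mem/chi1[-> _]; rewrite mul1r.
apply.
- by move=> p lp; apply: is_derive_mul; [exact: is_derive_cutoff|exact: dpsiE].
- move=> p lp; apply: cvgD; apply: cvgM.
  + exact: (is_derive_continuous (is_derive_cutoff A B r p)).
  + exact: cdpsi.
  + exact: (is_derive_continuous (dpsiE p lp)).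
  + exact: continuous_dcutoff.
- by rewrite /chi (cutoff_eq0 r0 _).1 ?mul0r// ltxx.
- by rewrite /chi (cutoff_eq0 r0 _).1 ?mul0r// ltxx andbF.
Qed.

Let cK (f : R -> R) : (forall p, lambda < p -> {for p, continuous f}) ->
  measurable_fun K f /\ exists M, forall x, K x -> `|f x| <= M.
Proof.
move=> cf; have cf' p : A <= p -> p <= B -> {for p, continuous f}.
  by move=> Ap _; apply: cf; exact: lt_le_trans Ap.
split; first exact: itv_measurable.
apply: compact_le_normr; first exact: segment_compact.
by apply: continuous_in_subspaceT => x /set_mem /KP; exact: cf.
Qed.

Lemma W012K : [/\ measurable_fun K v, measurable_fun K dv,
  mu.-integrable K (EFin \o (fun x => v x ^+ 2)) &
  mu.-integrable K (EFin \o (fun x => dv x ^+ 2))].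
Proof.
have [mv mdv] := W012_measurable vW; have [v2 dv2] := W012_sqr vW.
by split; [exact: measurable_funS mv|exact: measurable_funS mdv|
  exact: integrableS v2|exact: integrableS dv2].
Qed.

Let bK (c f : R -> R) : (forall p, lambda < p -> {for p, continuous c}) ->
  measurable_fun K f -> mu.-integrable K (EFin \o (fun x => f x ^+ 2)) ->
  measurable_fun K (fun x => f x * c x) /\
  mu.-integrable K (EFin \o (fun x => (f x * c x) ^+ 2)).
Proof.
move=> cc mf f2; have [mc [M cM]] := cK cc.
split; first exact: measurable_funM.
have := @integrable_mul_bounded _ _ _ mu _ (fun x => c x ^+ 2) _ (M ^+ 2) mK.
move=> /(_ _ (measurable_funX 2 mc) _ f2) H.
apply: eq_integrable (H _) => // [x _|x /cM cMx] /=; first by rewrite exprMn mulrC.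
by rewrite normrX lerXn2r// nnegrE// (le_trans _ cMx).
Qed.

(** Only one of the two factors v is approximated, by phi_n. Then phi_n psi is C^1, integration by
    parts of v against it is available, and the three integrals involved are linear in phi_n or its
    derivative, so they pass to the limit. *)
Lemma W012_sqr_weak_deriv :
  is_weak_deriv Om (fun x => v x ^+ 2) (fun x => 2 * (v x * dv x)).
Proof.
have [mv mdv] := W012_measurable vW; have [v2 dv2] := W012_sqr vW.
have [mvK mdvK v2K dv2K] := W012K.
have ivdv := integrable_mul_sqr mOm mv mdv v2 dv2.
split.
- by apply: open_integrable_locally => //; exact: open_Omega.
- apply: open_integrable_locally; first exact: open_Omega.
  exact: (integrableZl mOm 2 ivdv).
move=> psi Cpsi; have [spsi _ _] := Cpsi.
have cpsi p : lambda < p -> {for p, continuous psi}.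
  by move=> _; exact: smooth_continuous.
have cdpsi p : lambda < p -> {for p, continuous (derive1 psi)}.
  by move=> _; exact/smooth_continuous/smooth_derive1.
rewrite (@Rintegral_support _ _ _ mu Om K)//; last first.
  by apply: aeS v0 => x v0x Ox Kx; rewrite v0x// expr0n mul0r.
rewrite [in RHS](@Rintegral_support _ _ _ mu Om K)//; last first.
  by apply: aeS v0 => x v0x Ox Kx; rewrite v0x// mul0r mulr0 mul0r.
have [phi [sphi phi1 phi2]] := W012_approx vW B lA.
have [mvdp vdp2] := bK cdpsi mvK v2K.
have [mvp vp2] := bK cpsi mvK v2K.
have [mdvp dvp2] := bK cpsi mdvK dv2K.
have cphi n p : lambda < p -> {for p, continuous (phi n)}.
  by move=> _; exact: smooth_continuous.
have cdphi n p : lambda < p -> {for p, continuous (derive1 (phi n))}.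
  by move=> _; exact/smooth_continuous/smooth_derive1.
have sq (f : R -> R) : (forall p, lambda < p -> {for p, continuous f}) ->
    mu.-integrable K (EFin \o (fun x => f x ^+ 2)).
  move=> cf; apply: itv_integrable => p Ap _; have lp := lt_le_trans lA Ap.
  by apply: continuousM; exact: cf.
have lim1 := cvg_sqr_mul lA (fun n => (cK (cphi n)).1)
  (fun n => integrable_mul_sqr mK (cK (cphi n)).1 mvdp (sq _ (cphi n)) vdp2)
  (integrable_mul_sqr mK mvK mvdp v2K vdp2) mvK mvdp vdp2 phi1.
have lim2 := cvg_sqr_mul lA (fun n => (cK (cdphi n)).1)
  (fun n => integrable_mul_sqr mK (cK (cdphi n)).1 mvp (sq _ (cdphi n)) vp2)
  (integrable_mul_sqr mK mdvK mvp dv2K vp2) mdvK mvp vp2 phi2.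
have lim3 := cvg_sqr_mul lA (fun n => (cK (cphi n)).1)
  (fun n => integrable_mul_sqr mK (cK (cphi n)).1 mdvp (sq _ (cphi n)) dvp2)
  (integrable_mul_sqr mK mvK mdvp v2K dvp2) mvK mdvp dvp2 phi1.
have E n : \int[mu]_(x in K) (phi n x * (v x * derive1 psi x)) +
    \int[mu]_(x in K) (derive1 (phi n) x * (v x * psi x)) =
    - \int[mu]_(x in K) (phi n x * (dv x * psi x)).
  rewrite -RintegralD//; last 2 first.
  - exact: (integrable_mul_sqr mK (cK (cphi n)).1 mvdp (sq _ (cphi n)) vdp2).
  - exact: (integrable_mul_sqr mK (cK (cdphi n)).1 mvp (sq _ (cdphi n)) vp2).
  transitivity (\int[mu]_(x in K) (v x * (phi n x * derive1 psi x + psi x * derive1 (phi n) x))).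
    by apply: eq_Rintegral => x _; ring.
  have H1 p : lambda < p -> is_derive p 1 (fun x => phi n x * psi x)
      (phi n p * derive1 psi p + psi p * derive1 (phi n) p).
    by move=> _; apply: is_derive_mul; exact: smooth_is_derive.
  rewrite (W012_by_parts H1).
    by congr (- _); apply: eq_Rintegral => x _; ring.
  move=> p lp; apply: cvgD; apply: cvgM;
      [exact: cphi|exact: cdpsi|exact: cpsi|exact: cdphi].
(* In the limit the term v v' psi occurs once on each side with opposite signs, which produces the
   factor 2. *)
have lim : \int[mu]_(x in K) (v x * (v x * derive1 psi x)) +
    \int[mu]_(x in K) (dv x * (v x * psi x)) =
    - \int[mu]_(x in K) (v x * (dv x * psi x)).
  apply: (@cvg_unique _ (@Rhausdorff R)
    ((fun n => - \int[mu]_(x in K) (phi n x * (dv x * psi x))) @ \oo)).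
    rewrite -(funext E); exact: cvgD.
  exact: cvgN.
have iv : mu.-integrable K (EFin \o (fun x => v x * (dv x * psi x))).
  exact: (integrable_mul_sqr mK mvK mdvp v2K dvp2).
transitivity (\int[mu]_(x in K) (v x * (v x * derive1 psi x))).
  by apply: eq_Rintegral => x _; ring.
have -> : \int[mu]_(x in K) (2 * (v x * dv x) * psi x) =
    2 * \int[mu]_(x in K) (v x * (dv x * psi x)).
  by rewrite -RintegralZl//; apply: eq_Rintegral => x _; ring.
have E2 : \int[mu]_(x in K) (dv x * (v x * psi x)) = \int[mu]_(x in K) (v x * (dv x * psi x)).
  by apply: eq_Rintegral => x _; ring.
by move: lim; rewrite E2; lra.
Qed.

End sobolev_support.

(** * Functions of class C^1 on (lambda, +oo) *)

Definition C1on {R : realType} (lambda : R) (c dc : R -> R) :=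
  (forall p : R, lambda < p -> is_derive p 1 c (dc p)) /\
  (forall p : R, lambda < p -> {for p, continuous dc}).

Lemma C1on_continuous {R : realType} (lambda : R) (c dc : R -> R) (p : R) :
  C1on lambda c dc -> lambda < p -> {for p, continuous c}.
Proof. by move=> [dcE _] /dcE /is_derive_continuous. Qed.

Lemma C1onM {R : realType} (lambda : R) (c dc e de : R -> R) :
  C1on lambda c dc -> C1on lambda e de ->
  C1on lambda (fun x => c x * e x) (fun x => c x * de x + e x * dc x).
Proof.
move=> cC eC; split=> p lp.
  by apply: is_derive_mul; [exact: cC.1|exact: eC.1].
apply: cvgD; apply: cvgM;
  [exact: C1on_continuous cC lp|exact: eC.2|exact: C1on_continuous eC lp|exact: cC.2].
Qed.

(** * The kernel pairings at a fixed time *)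

Section slices.
Context {R : realType}.
Variables (lambda A B : R).
Hypotheses (lambda_gt0 : 0 < lambda) (lA : lambda < A) (AB : A < B).
Local Notation mu := (@lebesgue_measure R).
Local Notation Om := (Omega lambda).
Local Notation K := [set` `[A, B]].
Variables (v dv : R -> R).
Hypothesis vW : W012 Om v dv.
Hypothesis v0 : {ae mu, forall x, Om x -> ~ K x -> v x = 0}.

Let dv0 : {ae mu, forall x, Om x -> ~ K x -> dv x = 0}.
Proof. exact: (W012_deriv_support vW v0). Qed.

Let mK : measurable (K : set (measurableTypeR R)).
Proof. exact: measurable_itv. Qed.
Let mOm : measurable (Om : set (measurableTypeR R)).
Proof. exact: measurable_Omega. Qed.
Let KOm : K `<=` Om. Proof. exact: itv_Omega. Qed.
Let KP p : K p -> lambda < p. Proof. by move/KOm/mem_Omega. Qed.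

Let Phi_domE p : Phi_dom lambda p <-> p < - lambda \/ lambda < p.
Proof. by rewrite /Phi_dom /= !in_itv/= andbT. Qed.
Let open_Phi_dom : open (Phi_dom lambda).
Proof. by apply: openU; [exact: lray_open|exact: rray_open]. Qed.
Let mPhi : measurable (Phi_dom lambda : set (measurableTypeR R)).
Proof. exact: open_measurable. Qed.
Let KPhi : K `<=` Phi_dom lambda.
Proof. by move=> p /KP lp; apply/Phi_domE; right. Qed.

Let cK (f : R -> R) : (forall p, lambda < p -> {for p, continuous f}) ->
  measurable_fun K f /\ exists M, forall x, K x -> `|f x| <= M.
Proof.
move=> cf; have cf' p : A <= p -> p <= B -> {for p, continuous f}.
  by move=> Ap _; apply: cf; exact: lt_le_trans Ap.
split; first exact: itv_measurable.
apply: compact_le_normr; first exact: segment_compact.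
by apply: continuous_in_subspaceT => x /set_mem /KP; exact: cf.
Qed.

Lemma integrable_continuous_mul (c q : R -> R) :
  (forall p, lambda < p -> {for p, continuous c}) ->
  mu.-integrable K (EFin \o q) -> mu.-integrable K (EFin \o (fun x => c x * q x)).
Proof.
by move=> /cK[mc [M cM]] iq; exact: (integrable_mul_bounded mK mc cM iq).
Qed.

Lemma W012K_integrable : mu.-integrable K (EFin \o v) /\ mu.-integrable K (EFin \o dv).
Proof.
have [mvK mdvK v2K dv2K] := W012K B lA vW.
have i1 : mu.-integrable K (EFin \o (fun=> (1 : R) ^+ 2)).
  by apply: integrable_cstR => //; exact: compact_finite_measure (@segment_compact _ _ _).
have m1 : measurable_fun (K : set (measurableTypeR R)) (fun=> 1 : R) by exact: measurable_cst.
split.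
- have := integrable_mul_sqr mK mvK m1 v2K i1.
  by apply: eq_integrable => // x _ /=; rewrite mulr1.
- have := integrable_mul_sqr mK mdvK m1 dv2K i1.
  by apply: eq_integrable => // x _ /=; rewrite mulr1.
Qed.

Section slice.
Variables (c dc S : R -> R).
Hypothesis cC : C1on lambda c dc.
Hypothesis SE : forall p, lambda < p -> S p = c p * v p.
Hypothesis S0 : forall p, p < - lambda -> S p = 0.

Let integrable_Phi (q g : R -> R) : measurable_fun Om q ->
  (forall p, lambda < p -> g p = q p) -> (forall p, p < - lambda -> g p = 0) ->
  {ae mu, forall x, Om x -> ~ K x -> q x = 0} ->
  mu.-integrable K (EFin \o q) -> mu.-integrable (Phi_dom lambda) (EFin \o g).
Proof.
move=> mq gq g0 q0 iq.
have gqK : {in K, (EFin \o g) =1 (EFin \o q)}.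
  by move=> p /set_mem/KP lp /=; rewrite gq.
apply: (integrable_support mPhi mK KPhi).
- apply/measurable_funU.
  + exact: measurable_itv.
  + exact: measurable_itv.
  split.
    apply: (eq_measurable_fun (fun=> 0 : R)); last exact: measurable_cst.
    by move=> p /set_mem; rewrite /= in_itv/= => /g0.
  apply: (eq_measurable_fun q) => //.
  by move=> p /set_mem; rewrite /= in_itv/= andbT => /gq.
- apply: aeS q0 => p q0p /Phi_domE[/g0//|lp] nK.
  by rewrite gq// q0p//; exact/mem_Omega.
- by move: iq; apply: eq_integrable => // x /gqK ->.
Qed.

(** The product rule for c v, obtained by integrating v by parts against c psi. Since S and G vanish
    on the left half-line, S is weakly differentiable on the whole disconnected domain. *)
Lemma slice_is_weak_deriv (G : R -> R) :
  (forall p, lambda < p -> G p = dc p * v p + c p * dv p) ->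
  (forall p, p < - lambda -> G p = 0) ->
  is_weak_deriv (Phi_dom lambda) S G.
Proof.
move=> GE G0.
have [mv mdv] := W012_measurable vW.
have [iv idv] := W012K_integrable.
have mc : measurable_fun Om c.
  by apply: continuous_measurable_Omega => p; exact: C1on_continuous cC.
have mdc : measurable_fun Om dc by apply: continuous_measurable_Omega; exact: cC.2.
have icv := integrable_continuous_mul (fun p => C1on_continuous cC) iv.
have icdv := integrable_continuous_mul (fun p => C1on_continuous cC) idv.
have idcv := integrable_continuous_mul cC.2 iv.
split.
- apply: open_integrable_locally => //.
  apply: (@integrable_Phi (fun x => c x * v x)) => //.
    exact: measurable_funM.
  by apply: aeS v0 => x v0x Ox Kx; rewrite v0x// mulr0.
- apply: open_integrable_locally => //.
  apply: (@integrable_Phi (fun x => dc x * v x + c x * dv x)) => //.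
  + by apply: measurable_funD; exact: measurable_funM.
  + apply: aeS (aeI v0 dv0) => x [v0x dv0x] Ox Kx.
    by rewrite v0x// dv0x// !mulr0 addr0.
  + exact: (integrableD mK idcv icdv).
move=> psi [spsi _ _].
have psiC : C1on lambda psi (derive1 psi).
  split=> p _; first exact: smooth_is_derive.
  exact/smooth_continuous/smooth_derive1.
rewrite (@Rintegral_support _ _ _ mu _ K)//; last first.
  apply: aeS v0 => p v0p /Phi_domE[/S0->|lp] nK; first by rewrite mul0r.
  by rewrite SE// v0p// ?mulr0 ?mul0r//; exact/mem_Omega.
rewrite [in RHS](@Rintegral_support _ _ _ mu _ K)//; last first.
  apply: aeS (aeI v0 dv0) => p [v0p dv0p] /Phi_domE[/G0->|lp] nK; first by rewrite mul0r.
  have Op : Om p by exact/mem_Omega.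
  by rewrite GE// v0p// dv0p// !mulr0 addr0 mul0r.
have cpsiC := C1onM cC psiC.
have := W012_by_parts lA AB vW v0 cpsiC.1 cpsiC.2.
have -> : \int[mu]_(x in K) (S x * derive1 psi x) =
    \int[mu]_(x in K) ((c x * derive1 psi x) * v x).
  by apply: eq_Rintegral => x /set_mem/KP lx; rewrite SE//; ring.
have -> : \int[mu]_(x in K) (G x * psi x) =
    \int[mu]_(x in K) ((psi x * dc x) * v x) + \int[mu]_(x in K) (dv x * (c x * psi x)).
  rewrite -RintegralD//.
  - by apply: eq_Rintegral => x /set_mem/KP lx; rewrite GE//; ring.
  - apply: integrable_continuous_mul => // p lp; apply: cvgM.
      exact: smooth_continuous.
    exact: cC.2.
  - have : mu.-integrable K (EFin \o (fun x => (c x * psi x) * dv x)).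
      by apply: integrable_continuous_mul => // p lp; exact: C1on_continuous cpsiC lp.
    by apply: eq_integrable => // x _ /=; rewrite mulrC.
have -> : \int[mu]_(x in K) (v x * (c x * derive1 psi x + psi x * dc x)) =
    \int[mu]_(x in K) ((c x * derive1 psi x) * v x) + \int[mu]_(x in K) ((psi x * dc x) * v x).
  rewrite -RintegralD//.
  - by apply: eq_Rintegral => x _; ring.
  - apply: integrable_continuous_mul => // p lp; apply: cvgM.
      exact: C1on_continuous cC lp.
    exact: psiC.2.
  - apply: integrable_continuous_mul => // p lp; apply: cvgM.
      exact: smooth_continuous.
    exact: cC.2.
by lra.
Qed.

(** y is arbitrary: the chosen weak derivative is replaced by the explicit one through almost
    everywhere equality only. *)
Lemma pair_weak_deriv_slice (y : R -> R) :
  \int[mu]_(p in Phi_dom lambda) (y p * weak_deriv (Phi_dom lambda) S p) =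
  \int[mu]_(p in K) (y p * (dc p * v p + c p * dv p)).
Proof.
pose G p := if lambda < p then dc p * v p + c p * dv p else 0.
have GE p : lambda < p -> G p = dc p * v p + c p * dv p by rewrite /G => ->.
have G0 p : p < - lambda -> G p = 0.
  by move=> pl; rewrite /G ltNge ltW// (lt_trans pl)// (lt_trans _ lambda_gt0)// oppr_lt0.
have GS := weak_deriv_ae (slice_is_weak_deriv GE G0).
transitivity (\int[mu]_(p in Phi_dom lambda) (y p * G p)).
  by apply: ae_Rintegral; apply: aeS GS => p GSp /GSp ->.
rewrite (@Rintegral_support _ _ _ mu _ K)//.
  by apply: eq_Rintegral => x /set_mem/KP lx; rewrite GE.
apply: aeS (aeI v0 dv0) => p [v0p dv0p] /Phi_domE[/G0->|lp] nK; first by rewrite mulr0.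
have Op : Om p by exact/mem_Omega.
by rewrite GE// v0p// dv0p// !mulr0 addr0 mulr0.
Qed.

Lemma pair_slice (y : R -> R) :
  \int[mu]_(p in Phi_dom lambda) (y p * S p) = \int[mu]_(p in K) (y p * (c p * v p)).
Proof.
rewrite (@Rintegral_support _ _ _ mu _ K)//.
  by apply: eq_Rintegral => x /set_mem/KP lx; rewrite SE.
apply: aeS v0 => p v0p /Phi_domE[/S0->|lp] nK; first by rewrite mulr0.
by rewrite SE// v0p// ?mulr0//; exact/mem_Omega.
Qed.

End slice.

(** The left integrand is (F + v') (ga m n v)'. It exceeds the right one by the derivative of F ga m
    n v, whose integral is 0 because v vanishes off [A, B]. *)
Lemma slice_energy (F dF ga dga m dm n dn : R -> R) :
  C1on lambda F dF -> C1on lambda ga dga -> C1on lambda m dm -> C1on lambda n dn ->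
  \int[mu]_(p in K) ((F p + dv p) * n p * ((ga p * dm p + m p * dga p) * v p + ga p * m p * dv p)
     + (F p + dv p) * dn p * (ga p * m p * v p)) =
  \int[mu]_(p in K) (ga p * (m p * dn p + n p * dm p) * (v p * dv p)
     + ga p * (m p * n p) * dv p ^+ 2 + dga p * (m p * n p) * (v p * dv p)
     - dF p * ga p * (m p * n p) * v p).
Proof.
move=> FC gaC mC nC.
have mnC := C1onM mC nC; have gmnC := C1onM gaC mnC; have psiC := C1onM FC gmnC.
have [mvK mdvK v2K dv2K] := W012K B lA vW.
have [iv idv] := W012K_integrable.
have ivdv := integrable_mul_sqr mK mvK mdvK v2K dv2K.
have c0 := @C1on_continuous R lambda.
have cM (f g : R -> R) : (forall p, lambda < p -> {for p, continuous f}) ->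
    (forall p, lambda < p -> {for p, continuous g}) ->
    forall p, lambda < p -> {for p, continuous (fun x => f x * g x)}.
  by move=> cf cg p lp; apply: cvgM; [exact: cf|exact: cg].
have iJ : mu.-integrable K (EFin \o (fun p => ga p * (m p * dn p + n p * dm p) * (v p * dv p)
     + ga p * (m p * n p) * dv p ^+ 2 + dga p * (m p * n p) * (v p * dv p)
     - dF p * ga p * (m p * n p) * v p)).
  apply: (integrable_subR mK); last first.
    apply: integrable_continuous_mul iv; apply: (cM); last by move=> p; exact: c0 mnC.
    by apply: (cM); [exact: FC.2|move=> p; exact: c0 gaC].
  apply: (integrable_addR mK); last first.
    apply: integrable_continuous_mul ivdv.
    by apply: (cM); [exact: gaC.2|move=> p; exact: c0 mnC].
  apply: (integrable_addR mK).
    apply: integrable_continuous_mul ivdv.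
    by apply: (cM); [move=> p; exact: c0 gaC|exact: mnC.2].
  apply: integrable_continuous_mul dv2K.
  by move=> p; exact: c0 gmnC.
have i1 : mu.-integrable K (EFin \o (fun p => v p * (F p * (ga p * (m p * dn p + n p * dm p)
    + m p * n p * dga p) + ga p * (m p * n p) * dF p))).
  have := integrable_continuous_mul psiC.2 iv.
  by apply: eq_integrable => // x _ /=; rewrite mulrC.
have i2 : mu.-integrable K (EFin \o (fun p => dv p * (F p * (ga p * (m p * n p))))).
  have := integrable_continuous_mul (fun p => c0 _ _ p psiC) idv.
  by apply: eq_integrable => // x _ /=; rewrite mulrC.
have := W012_by_parts lA AB vW v0 psiC.1 psiC.2.
move=> /eqP; rewrite -addr_eq0 -RintegralD// => /eqP E.
rewrite -[RHS]addr0 -E -RintegralD//; last exact: (integrableD mK i1 i2).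
by apply: eq_Rintegral => x _; ring.
Qed.

End slices.

(** * Transfer of the support from W to u *)

Section support.
Context {R : realType}.
Variables (lambda : R).
Hypothesis lambda_gt0 : 0 < lambda.
Local Notation mu := (@lebesgue_measure R).
Local Notation kap := (kappa lambda).

(** Substituting in the integral of the indicator of a null set N gives 0; the Jacobian is positive,
    so kappa(p) lies outside N for almost every p. *)
Lemma ae_kappa (P : R -> Prop) : {ae mu, forall k, 0 < k -> P k} ->
  {ae mu, forall p, lambda < p -> P (kap p)}.
Proof.
move=> [N [mN N0 sN]].
have mG : measurable_fun setT (EFin \o (\1_N : R -> R)).
  by apply/measurable_EFinP; exact: measurable_indic.
have nn (k : R) : 0 < k -> (0 <= (EFin \o (\1_N : R -> R)) k)%E.
  by move=> _; rewrite /= lee_fin indicE.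
have E := @ge0_integral_kappa _ lambda lambda_gt0 _ (measurable_funTS mG) nn.
rewrite (@ae_integral _ _ _ mu _ _ (cst 0%E)) ?integral0 in E; last first.
  exists N; split => // x /= /not_implyP[_]; apply: contra_notP => nNx.
  by rewrite indicE memNset.
have mOm : measurable (Omega lambda : set (measurableTypeR R)) by exact: measurable_Omega.
have mk : measurable_fun (Omega lambda) kap.
  by apply: continuous_measurable_Omega => p; exact: continuous_kappa.
have mf : measurable_fun (Omega lambda) (fun p => (\1_N (kap p))%:E * (p * kap p ^+ 3)%:E)%E.
  apply: emeasurable_funM; last first.
    apply/measurable_EFinP; apply: measurable_funM => //; exact: measurable_funX.
  apply/measurable_EFinP.
  by apply: measurableT_comp mk; exact: measurable_indic.
have : (\int[mu]_(p in Omega lambda) `|(\1_N (kap p))%:E * (p * kap p ^+ 3)%:E| = 0)%E.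
  rewrite [RHS]E; apply: eq_integral => p /set_mem/mem_Omega lp.
  rewrite gee0_abs// mule_ge0// lee_fin ?indicE// mulr_ge0 ?exprn_ge0 ?ltW ?kappa_gt0//.
  exact: lt_trans lp.
move=> /(ae_eq_integral_abs mu mOm mf).
apply: aeS => p h lp; apply: contrapT => nP.
have : N (kap p).
  by apply: sN => /= /(_ (kappa_gt0 lambda_gt0 lp)).
move=> Np; have := h ((mem_Omega lambda p).2 lp).
rewrite indicE mem_set// mul1e => /eqP; rewrite eqe mulf_eq0 expf_eq0/=.
by rewrite !gt_eqF ?kappa_gt0// (lt_trans lambda_gt0).
Qed.

Lemma WsolE (u : R * R -> R) p t : lambda < p ->
  Wsol lambda u (kap p, t) = kap p ^- 3 * u (p, t).
Proof.
move=> lp; rewrite /Wsol kappa_gt0// div1r; congr (_ * u (_, _)).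
exact: (kappaK lambda_gt0 lp).
Qed.

(** Each point off the support has a neighbourhood where h vanishes almost everywhere, and countably
    many of them suffice. *)
Lemma ess_support_ae (h : R -> R) (E : set R) : ess_support h `<=` E ->
  {ae mu, forall x, ~ E x -> h x = 0}.
Proof.
move=> hE; apply: (@ae_locally _ (~` E)) => x nEx.
apply: contrapT => nU; apply: nEx; apply: hE => U Ux aeU; apply: nU.
by exists U.
Qed.

Lemma Wsol_support (eps : R) : 0 < eps -> exists A B : R,
  [/\ lambda < A, A < B & forall (u : R * R -> R) t,
    ess_support (fun k => Wsol lambda u (k, t)) `<=` `]eps, 1 / eps[ ->
    {ae mu, forall p, Omega lambda p -> ~ [set` `[A, B]] p -> u (p, t) = 0}].
Proof.
move=> e0; have e1 : 0 < 1 / eps by rewrite divr_gt0.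
(* The substitution reverses the order of the endpoints. When eps >= 1 the interval ]eps, 1/eps[ is
   empty; the maximum and the added 1 keep A < B in that case too. *)
pose A := varpi lambda (1 / eps); pose B := Num.max A (varpi lambda eps) + 1.
exists A, B; split.
- exact: varpi_gt.
- by rewrite /B ltr_pwDr// le_max lexx.
move=> u t /ess_support_ae h.
have H : {ae mu, forall k, 0 < k -> ~ [set` `]eps, 1 / eps[] k -> Wsol lambda u (k, t) = 0}.
  by apply: aeS h => k hk _; exact: hk.
apply: aeS (ae_kappa H) => p hp /mem_Omega lp; apply: contra_notP => up.
have {}hp := hp lp.
have : [set` `]eps, 1 / eps[] (kap p).
  apply: contrapT => /hp; rewrite WsolE// => /eqP; rewrite mulf_eq0 => /orP[|/eqP//].
  by rewrite invr_eq0 expf_eq0/= gt_eqF// kappa_gt0.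
rewrite /= !in_itv/= => /andP[ek ke]; apply/andP; split.
  by rewrite ltW// -(@kappa_lt _ lambda)// ?varpi_gt// varpiK.
have : p < varpi lambda eps by rewrite -(@kappa_lt _ lambda)// ?varpi_gt// varpiK.
have : varpi lambda eps <= Num.max A (varpi lambda eps) by rewrite le_max lexx orbT.
by rewrite /B; lra.
Qed.

End support.

(** * Null sets and Fubini on rectangles *)

Section product.
Context {R : realType}.
Local Notation mu := (@lebesgue_measure R).
Local Notation mu2 := (mu \x mu)%E.

(** The sigma-algebra of the product is generated by rectangles, so an open set is written as a
    countable union of rational ones. *)
Lemma open_measurable_prod (U : set (R * R)) : open U -> measurable U.
Proof.
move=> oU.
pose rect (q : (rat * rat) * (rat * rat)) : set (R * R) :=
  [set` `](ratr q.1.1 : R), ratr q.1.2[] `*` [set` `](ratr q.2.1 : R), ratr q.2.2[].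
pose F n : set (R * R) := if unpickle n is Some q then
  (if `[< rect q `<=` U >] then rect q else set0) else set0.
suff -> : U = \bigcup_n F n.
  apply: bigcupT_measurable => n; rewrite /F; case: unpickle => [q|//].
  by case: ifP => // _; apply: measurableX; exact: measurable_itv.
apply/seteqP; split=> [[x y] Uxy|z [n _]]; last first.
  by rewrite /F; case: unpickle => [q|//]; case: ifPn => // /asboolP; exact.
have /nbhs_ballP[r /= r0 rU] : nbhs (x, y) U by exact: open_nbhs_nbhs.
have lt1 (z : R) : z - r < z by rewrite ltrBlDr ltrDl.
have lt2 (z : R) : z < z + r by rewrite ltrDl.
have [a1 a1P] := rat_in_itvoo (lt1 x); have [a2 a2P] := rat_in_itvoo (lt2 x).
have [b1 b1P] := rat_in_itvoo (lt1 y); have [b2 b2P] := rat_in_itvoo (lt2 y).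
move: a1P a2P b1P b2P; rewrite !in_itv/= => /andP[a1x a1'] /andP[a2' a2x].
move=> /andP[b1y b1'] /andP[b2' b2y].
exists (pickle ((a1, a2), (b1, b2))); first exact: Logic.I.
rewrite /F pickleK; have -> : `[< rect ((a1, a2), (b1, b2)) `<=` U >] = true.
  apply/asboolP => -[p t]; rewrite /rect /= !in_itv/= => -[/andP[p1 p2] /andP[t1 t2]].
  apply: rU; split; rewrite /ball/= ltr_distlC.
    by rewrite (lt_trans a1x p1) (lt_trans p2 a2x).
  by rewrite (lt_trans b1y t1) (lt_trans t2 b2y).
by rewrite /rect; split; rewrite /= in_itv/= ?a1' ?b1'.
Qed.

Lemma continuous_measurable_prod (D : set (R * R)) (h : R * R -> R) :
  open D -> (forall z, D z -> {for z, continuous h}) -> measurable_fun D h.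
Proof.
move=> oD ch mD; apply: (measurability _ (RGenOInfty.measurableE R)) => //.
move=> /= _ [_ [x ->] <-]; apply: open_measurable_prod.
rewrite openE => z [Dz hz]; apply: filterI; first exact: open_nbhs_nbhs.
by apply: (ch z Dz); apply: open_nbhs_nbhs; split => //; exact: rray_open.
Qed.

Lemma ae_section (N : set (R * R)) : measurable N ->
  {ae mu, forall t, mu (ysection N t) = 0%E} -> mu2 N = 0%E.
Proof.
move=> mN N0.
have m1 : measurable_fun setT (EFin \o (\1_N : R * R -> R)).
  by apply/measurable_EFinP; exact: measurable_indic.
have nn z : (0 <= (EFin \o (\1_N : R * R -> R)) z)%E by rewrite /= lee_fin indicE.
have := @fubini_tonelli2 _ _ _ _ _ mu mu _ m1 nn.
rewrite integral_indic// setIT indic_fubini_tonelli_GE// => E.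
apply: (etrans E).
by rewrite (@ae_integral _ _ _ mu _ _ (cst 0%E)) ?integral0//; apply: aeS N0.
Qed.

(** The exceptional set must be measurable: only then do null sections make it null, by Tonelli. *)
Lemma ae_rect (A B : set R) (P : R * R -> Prop) :
  measurable ((A `*` B) `&` [set z | ~ P z]) ->
  {ae mu, forall t, B t -> {ae mu, forall p, A p -> P (p, t)}} ->
  {ae mu2, forall z, (A `*` B) z -> P z}.
Proof.
move=> mN aeP; exists ((A `*` B) `&` [set z | ~ P z]); split => //.
  apply: ae_section => //; apply: aeS aeP => t aePt.
  have [Bt|nBt] := pselect (B t).
    apply/negligibleP; first exact: measurable_ysection.
    by apply: negligibleS (aePt Bt) => p; rewrite /ysection/= inE/= => -[[Ap _] nP] /(_ Ap).
  rewrite (_ : ysection _ t = set0) ?measure0//.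
  by rewrite -subset0 => p; rewrite /ysection/= inE/= => -[[_ /nBt]].
by move=> z /= /not_implyP.
Qed.

Section rect.
Variables (A B : set R) (h : R * R -> R).
Hypotheses (mA : measurable (A : set (measurableTypeR R)))
           (mB : measurable (B : set (measurableTypeR R))).
Hypothesis ih : mu2.-integrable (A `*` B) (EFin \o h).

Let mAB : measurable (A `*` B). Proof. exact: measurableX. Qed.

(** Fubini on the full product is applied to this extension by zero. *)
Let g : R * R -> \bar R := (EFin \o h) \_ (A `*` B).

Let ig : mu2.-integrable setT g.
Proof. by apply/integrable_restrict => //; rewrite setTI. Qed.

Let gE t : (\int[mu]_p g (p, t) = if t \in B then \int[mu]_(p in A) (h (p, t))%:E else 0)%E.
Proof.
case: ifPn => Bt.
  rewrite [RHS]integral_mkcond; apply: eq_integral => p _.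
  by rewrite /g !patchE in_setX Bt andbT.
rewrite -[RHS](@integral0 _ _ _ mu setT); apply: eq_integral => p _.
by rewrite /g patchE in_setX (negbTE Bt) andbF.
Qed.

Let gE' p : (\int[mu]_t g (p, t) = if p \in A then \int[mu]_(t in B) (h (p, t))%:E else 0)%E.
Proof.
case: ifPn => Ap.
  rewrite [RHS]integral_mkcond; apply: eq_integral => t _.
  by rewrite /g !patchE in_setX Ap.
rewrite -[RHS](@integral0 _ _ _ mu setT); apply: eq_integral => t _.
by rewrite /g patchE in_setX (negbTE Ap).
Qed.

Let iG : mu.-integrable setT (fubini_G mu g).
Proof.
have mg : measurable_fun setT g by exact: measurable_int ig.
have mG := @measurable_fubini_G _ _ _ _ _ mu mu g ig.
apply/integrableP; split => //.
have := (@integrable21ltyP _ _ _ _ _ mu mu g mg).1 ig.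
apply: le_lt_trans; apply: ge0_le_integral => //.
- exact: measurableT_comp.
- have mag : measurable_fun setT (abse \o g) by exact: measurableT_comp.
  exact: (@measurable_fun_fubini_tonelli_G _ _ _ _ _ mu (abse \o g) mag (fun=> abse_ge0 _)).
- move=> t _; apply: le_abse_integral => //.
  exact: (@measurable_fun_pair1 _ _ _ _ _ _ g t mg).
Qed.

Lemma Fubini_rect_integrable :
  mu.-integrable B (EFin \o (fun t => \int[mu]_(p in A) h (p, t))).
Proof.
have iGB : mu.-integrable B (fubini_G mu g) by exact: integrableS iG.
have mG : measurable_fun B (fubini_G mu g) by exact: measurable_int iGB.
apply: (eq_integrable mB (EFin \o (fine \o fubini_G mu g))).
  by move=> t Bt; rewrite /= /fubini_G gE Bt.
apply: (le_integrable mB _ _ iGB).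
  by apply/measurable_EFinP; apply: measurableT_comp mG; exact: fine_measurable.
by move=> t _ /=; case: (fubini_G mu g t) => [r||] //=; rewrite ?leey.
Qed.

Lemma Fubini_rect'_integrable :
  mu.-integrable A (EFin \o (fun p => \int[mu]_(t in B) h (p, t))).
Proof.
have iF := @integrable_fubini_F _ _ _ _ _ mu mu g ig.
have iFA : mu.-integrable A (fubini_F mu g) by exact: integrableS iF.
have mF : measurable_fun A (fubini_F mu g) by exact: measurable_int iFA.
apply: (eq_integrable mA (EFin \o (fine \o fubini_F mu g))).
  by move=> p Ap; rewrite /= /fubini_F gE' Ap.
apply: (le_integrable mA _ _ iFA).
  by apply/measurable_EFinP; apply: measurableT_comp mF; exact: fine_measurable.
by move=> p _ /=; case: (fubini_F mu g p) => [r||] //=; rewrite ?leey.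
Qed.

Lemma Fubini_rect : \int[mu2]_(z in A `*` B) h z =
  \int[mu]_(t in B) \int[mu]_(p in A) h (p, t).
Proof.
congr fine; rewrite integral_mkcond -/g.
rewrite -(@integral21_prod_meas1 _ _ _ _ _ mu mu g ig).
rewrite [RHS]integral_mkcond; apply: ae_integral.
(* For almost every t the inner integral is finite, so taking its real part loses nothing. *)
have := integrable_ae measurableT iG.
apply: aeS => t /(_ Logic.I) fint _; rewrite patchE; move: fint; rewrite /fubini_G gE.
by case: ifPn => // _ fint; rewrite /= fineK.
Qed.

Lemma Fubini_rect' : \int[mu2]_(z in A `*` B) h z =
  \int[mu]_(p in A) \int[mu]_(t in B) h (p, t).
Proof.
congr fine; rewrite integral_mkcond -/g.
rewrite -(@integral12_prod_meas1 _ _ _ _ _ mu mu g ig).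
rewrite [RHS]integral_mkcond; apply: ae_integral.
have := integrable_ae measurableT (@integrable_fubini_F _ _ _ _ _ mu mu g ig).
apply: aeS => p /(_ Logic.I) fint _; rewrite patchE; move: fint; rewrite /fubini_F gE'.
by case: ifPn => // _ fint; rewrite /= fineK.
Qed.

End rect.

End product.

Lemma Rintegral_support_ae d (T : measurableType d) (R : realType)
    (m : {measure set T -> \bar R}) (D K : set T) (f g : T -> R) : K `<=` D ->
  {ae m, forall x, D x -> (~ K x -> f x = 0) /\ (K x -> f x = g x)} ->
  \int[m]_(x in D) f x = \int[m]_(x in K) g x.
Proof.
move=> KD fg; rewrite (@Rintegral_support _ _ _ m _ K)//; last first.
  by apply: aeS fg => x h Dx; exact: (h Dx).1.
by apply: ae_Rintegral; apply: aeS fg => x h Kx; exact: (h (KD x Kx)).2.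
Qed.

(** * Bounded factors and square-integrable factors *)

Section bounded_square_integrable.
Context d (T : measurableType d) (R : realType).
Variables (m : {measure set T -> \bar R}) (D : set T).
Hypotheses (mD : measurable D) (finD : (m D < +oo)%E).

Definition bounded_mfun (c : T -> R) :=
  measurable_fun D c /\ exists M, forall x, D x -> `|c x| <= M.

Definition L2fun (f : T -> R) :=
  measurable_fun D f /\ m.-integrable D (EFin \o (fun x => f x ^+ 2)).

Lemma bounded_mfunM c e : bounded_mfun c -> bounded_mfun e ->
  bounded_mfun (fun x => c x * e x).
Proof.
move=> [mc [M cM]] [me [N eN]]; split; first exact: measurable_funM.
by exists (M * N) => x Dx; rewrite normrM ler_pM ?cM ?eN.
Qed.

Lemma bounded_mfunD c e : bounded_mfun c -> bounded_mfun e ->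
  bounded_mfun (fun x => c x + e x).
Proof.
move=> [mc [M cM]] [me [N eN]]; split; first exact: measurable_funD.
by exists (M + N) => x Dx; rewrite (le_trans (ler_normD _ _))// lerD ?cM ?eN.
Qed.

Lemma L2fun_bounded c : bounded_mfun c -> L2fun c.
Proof.
move=> [mc [M cM]]; split => //.
apply: measurable_bounded_integrable => //; first exact: measurable_funX.
exists (M ^+ 2); split; first exact: num_real.
move=> x Mx y Dy; rewrite /= normrX (le_trans _ (ltW Mx))// lerXn2r// ?nnegrE ?cM//.
by rewrite (le_trans _ (cM y Dy)).
Qed.

Lemma L2fun_mul f g : L2fun f -> L2fun g -> m.-integrable D (EFin \o (fun x => f x * g x)).
Proof. by move=> [mf f2] [mg g2]; exact: (integrable_mul_sqr mD mf mg f2 g2). Qed.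

Lemma integrable_bounded_mfun c q : bounded_mfun c -> m.-integrable D (EFin \o q) ->
  m.-integrable D (EFin \o (fun x => c x * q x)).
Proof. by move=> [mc [M cM]] iq; exact: (integrable_mul_bounded mD mc cM iq). Qed.

Lemma L2fun_bounded_mul c f : bounded_mfun c -> L2fun f -> L2fun (fun x => c x * f x).
Proof.
move=> bc [mf f2]; split; first by apply: measurable_funM => //; case: bc.
have := integrable_bounded_mfun (bounded_mfunM bc bc) f2.
by apply: eq_integrable => // x _ /=; rewrite exprMn expr2.
Qed.

Lemma L2funD f g : L2fun f -> L2fun g -> L2fun (fun x => f x + g x).
Proof.
move=> fL gL; have [mf f2] := fL; have [mg g2] := gL.
split; first exact: measurable_funD.
have := integrable_addR mD f2 (integrable_addR mD g2 (integrable_addR mD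
  (L2fun_mul fL gL) (L2fun_mul fL gL))).
by apply: eq_integrable => // x _ /=; congr EFin; ring.
Qed.

Lemma L2fun_integrable f : L2fun f -> m.-integrable D (EFin \o f).
Proof.
move=> fL; have L1 : L2fun (fun=> 1).
  by apply: L2fun_bounded; split; [exact: measurable_cst|exists 1 => x _; rewrite normr1].
by have := L2fun_mul fL L1; apply: eq_integrable => // x _ /=; rewrite mulr1.
Qed.

End bounded_square_integrable.

Lemma within_continuous_comp (X Y Z : topologicalType) (A' : set X) (A : set Y)
    (phi : X -> Y) (g : Y -> Z) :
  (forall x, A' x -> A (phi x)) -> (forall x, A' x -> {for x, continuous phi}) ->
  {within A, continuous g} -> {within A', continuous (fun x => g (phi x))}.
Proof.
move=> A'A cphi /subspace_continuousP cg; apply/subspace_continuousP => x A'x U Ug.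
have H1 : nbhs (phi x) [set y | A y -> U (g y)] := cg (phi x) (A'A x A'x) U Ug.
have H2 : nbhs x [set y | A (phi y) -> U (g (phi y))] := cphi x A'x _ H1.
change (nbhs x [set y | A' y -> U (g (phi y))]).
by apply: filterS H2 => y h A'y; apply: h; exact: A'A.
Qed.

Lemma open_setX (X Y : topologicalType) (S : set X) (I : set Y) :
  open S -> open I -> open (S `*` I).
Proof.
move=> oS oI; rewrite openE => -[p t] [Sp It]; exists (S, I); last by move=> [].
by split; exact: open_nbhs_nbhs.
Qed.

Lemma continuous_pair_r (X Y : topologicalType) (p : X) : continuous (fun t : Y => (p, t)).
Proof.
move=> t U [[P Q] /= [Pp Qt] PQ]; change (nbhs t [set s | U (p, s)]).
by apply: filterS Qt => s Qs; apply: PQ; split => //=; exact: nbhs_singleton.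
Qed.

Lemma continuous_pair_l (X Y : topologicalType) (t : Y) : continuous (fun p : X => (p, t)).
Proof.
move=> p U [[P Q] /= [Pp Qt] PQ]; change (nbhs p [set s | U (s, t)]).
by apply: filterS Pp => s Ps; apply: PQ; split => //=; exact: nbhs_singleton.
Qed.

(** * Functions of class C^1 up to the ends of the time interval *)

Section cylinder.
Context {R : realType}.
Variables (lambda T : R).
Hypothesis T0 : 0 < T.
Local Notation mu := (@lebesgue_measure R).
Local Notation mu2 := (mu \x mu)%E.
Local Notation bmf2 := (@bounded_mfun _ (measurableTypeR R * measurableTypeR R)%type R).
Local Notation Om := (Omega lambda).
Local Notation cyl := (Om `*` [set` `[0, T]]).
Local Notation I := [set` `]0, T[].

Lemma within_continuous_interior (S : set R) (g : R * R -> R) z : open S ->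
  {within S `*` [set` `[0, T]], continuous g} -> (S `*` I) z -> {for z, continuous g}.
Proof.
move=> oS cg; have oSI : open (S `*` I).
  by apply: open_setX => //; exact: interval_open.
have : {within S `*` I, continuous g}.
  apply: continuous_subspaceW cg => -[p t] [Sp]; rewrite /= !in_itv/= => /andP[t0 tT].
  by split => //=; rewrite ?in_itv/= !ltW.
rewrite continuous_open_subspace// => /(_ z) H Sz; apply: H; exact: mem_set.
Qed.

Lemma slice_continuous_t (S : set R) (g : R * R -> R) p :
  {within S `*` [set` `[0, T]], continuous g} -> S p ->
  {within [set` `[0, T]], continuous (fun t => g (p, t))}.
Proof.
move=> cg Sp; apply: (within_continuous_comp _ _ cg) => [t It|t It]; first by split.
exact: continuous_pair_r.
Qed.

Lemma slice_continuous_p (S : set R) (g : R * R -> R) p t : open S ->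
  {within S `*` [set` `[0, T]], continuous g} -> S p -> 0 < t < T ->
  {for p, continuous (fun x => g (x, t))}.
Proof.
move=> oS cg Sp tT.
have Sz : (S `*` I) (p, t) by split => //=; rewrite ?in_itv.
apply: (@continuous_comp _ _ _ (fun x => (x, t)) g).
  exact: continuous_pair_l.
exact: within_continuous_interior cg Sz.
Qed.

(** Continuity up to t = 0 and t = T gives the bound, by compactness of [a, b] x [0, T];
    measurability comes from the open cylinder. *)
Lemma bounded_mfun_cyl (S : set R) (g : R * R -> R) a b : open S -> `[a, b] `<=` S ->
  {within S `*` [set` `[0, T]], continuous g} -> bmf2 ([set` `[a, b]] `*` I) g.
Proof.
move=> oS JS cg.
have oSI : open (S `*` I) by apply: open_setX => //; exact: interval_open.
split.
  apply: (@measurable_funS _ _ _ _ (S `*` I)).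
  - exact: open_measurable_prod.
  - by move=> [p t] [/JS Sp It].
  - by apply: continuous_measurable_prod => // z; exact: within_continuous_interior.
have cJ : compact ([set` `[a, b]] `*` [set` `[0, T]]).
  by apply: compact_setX; exact: segment_compact.
have cw : {within [set` `[a, b]] `*` [set` `[0, T]], continuous g}.
  by apply: continuous_subspaceW cg => -[p t] [/JS Sp It].
have [M gM] := compact_le_normr cJ cw.
exists M => -[p t] [/= Jp]; rewrite in_itv/= => /andP[t0 tT]; apply: gM; split => //=.
by rewrite ?in_itv/= !ltW.
Qed.

(** As in [Cn_cyl], differentiability is asked inside the cylinder only, while the derivatives
    extend continuously to t = 0 and t = T. *)
Definition C1cyl (h hp ht : R * R -> R) :=
  [/\ {within cyl, continuous h}, {within cyl, continuous hp},
      {within cyl, continuous ht} &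
      forall p t, lambda < p -> 0 < t < T ->
        is_derive p 1 (fun x => h (x, t)) (hp (p, t)) /\
        is_derive t 1 (fun s => h (p, s)) (ht (p, t))].

Lemma C1cylM h hp ht e ep et : C1cyl h hp ht -> C1cyl e ep et ->
  C1cyl (fun z => h z * e z) (fun z => h z * ep z + e z * hp z)
    (fun z => h z * et z + e z * ht z).
Proof.
move=> [ch chp cht dh] [ce cep cet de].
split.
- by move=> z; apply: cvgM; [exact: ch|exact: ce].
- by move=> z; apply: cvgD; apply: cvgM; [exact: ch|exact: cep|exact: ce|exact: chp].
- by move=> z; apply: cvgD; apply: cvgM; [exact: ch|exact: cet|exact: ce|exact: cht].
move=> p t lp tT; have [dh1 dh2] := dh p t lp tT; have [de1 de2] := de p t lp tT.
by split; exact: is_derive_mul.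
Qed.

Lemma within_cyl_fst (c : R -> R) : (forall p, lambda < p -> {for p, continuous c}) ->
  {within cyl, continuous (fun z => c z.1)}.
Proof.
move=> cc; apply/subspace_continuousP => -[p t] [/mem_Omega lp _].
apply: cvg_within_filter.
by apply: (@continuous_comp _ _ _ fst c); [exact: cvg_fst|exact: cc].
Qed.

Lemma C1cyl_fst c dc : C1on lambda c dc ->
  C1cyl (fun z => c z.1) (fun z => dc z.1) (fun=> 0).
Proof.
move=> cC; split.
- by apply: within_cyl_fst => p; exact: C1on_continuous cC.
- by apply: within_cyl_fst; exact: cC.2.
- by move=> z; exact: cvg_cst.
- move=> p t lp _; split; first exact: cC.1.
  exact: (is_derive_const (c p) t).
Qed.

Lemma C1cyl_Cn h hp ht : C1cyl h hp ht -> Cn_cyl 1 Om T h.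
Proof.
move=> [ch chp cht dh].
(* Only total orders 0 and 1 are constrained; the other entries are filled with 0. *)
exists (fun i j => match i, j with 0%N, 0%N => h | S 0, 0%N => hp | 0%N, S 0 => ht
  | _, _ => fun=> 0 end); split => //.
- by move=> [|[|i]] [|[|j]] //= _.
- by move=> [|i] [|j] // _ p t /mem_Omega lp tT; exact: dh.
Qed.

Lemma C1cyl_dp h hp ht p t : C1cyl h hp ht -> lambda < p -> 0 < t < T ->
  dp h (p, t) = hp (p, t).
Proof.
by move=> [_ _ _ dh] lp tT; rewrite /dp derive1E; apply: derive_val; exact: (dh _ _ lp tT).1.
Qed.

Lemma C1cyl_dt h hp ht p t : C1cyl h hp ht -> lambda < p -> 0 < t < T ->
  dt h (p, t) = ht (p, t).
Proof.
by move=> [_ _ _ dh] lp tT; rewrite /dt derive1E; apply: derive_val; exact: (dh _ _ lp tT).2.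
Qed.

Lemma measurable_rect (a b : R) :
  measurable ([set` `[a, b]] `*` I : set (measurableTypeR R * measurableTypeR R)%type).
Proof. by apply: measurableX; exact: measurable_itv. Qed.

Lemma fin_rect (a b : R) : (mu2 ([set` `[a, b]] `*` I) < +oo)%E.
Proof.
have := @product_measure1E _ _ _ _ _ mu mu [set` `[a, b]] I.
move=> /(_ (measurable_itv _) (measurable_itv _)) E.
apply: le_lt_trans (_ : (mu [set` `[a, b]] * mu I < +oo)%E); first by rewrite -E.
by rewrite !lebesgue_measure_itv/=; do 2 case: ifP => _; rewrite ?mule0 ?mul0e// -?EFinB -?EFinM ltry.
Qed.

(* integrate d/dt (c h) over (0, T), then over [a, b] *)
Lemma integral_initial_value (S : set R) (c : R -> R) (h ht : R * R -> R) a b :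
  open S -> `[a, b] `<=` S -> bmf2 ([set` `[a, b]] `*` I) (fun z => c z.1) ->
  {within S `*` [set` `[0, T]], continuous h} ->
  {within S `*` [set` `[0, T]], continuous ht} ->
  (forall p t, S p -> 0 < t < T -> is_derive t 1 (fun s => h (p, s)) (ht (p, t))) ->
  (forall p, S p -> h (p, T) = 0) ->
  \int[mu]_(p in [set` `[a, b]]) (c p * h (p, 0)) =
  - \int[mu2]_(z in [set` `[a, b]] `*` I) (c z.1 * ht z).
Proof.
move=> oS JS bc ch cht dh hT.
have bht := bounded_mfun_cyl oS JS cht.
have ic : mu2.-integrable ([set` `[a, b]] `*` I) (EFin \o (fun z => c z.1 * ht z)).
  apply: L2fun_integrable; [exact: measurable_rect|exact: fin_rect|].
  by apply: L2fun_bounded; [exact: measurable_rect|exact: fin_rect|exact: bounded_mfunM].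
rewrite Fubini_rect'//; try exact: measurable_itv.
have FT p : S p -> \int[mu]_(t in I) ht (p, t) = - h (p, 0).
  move=> Sp.
  have cs := slice_continuous_t cht Sp; have chs := slice_continuous_t ch Sp.
  have its : mu.-integrable [set` `[0, T]] (EFin \o (fun t => ht (p, t))).
    by apply: continuous_compact_integrable => //; exact: segment_compact.
  have itso : mu.-integrable I (EFin \o (fun t => ht (p, t))).
    by apply: integrableS its => //; exact: subset_itv_oo_cc.
  rewrite Rintegral_itv_bndo_bndc// Rintegral_itv_obnd_cbnd//; last first.
    by apply: integrableS its => //; exact: subset_itv_oc_cc.
  rewrite /Rintegral (@continuous_FTC2 _ (fun t => ht (p, t)) (fun t => h (p, t)))//.
  - by rewrite hT// -EFinB sub0r.
  - have [_ c0 cT] := (continuous_within_itvP _ T0).1 chs.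
    by split => // t; rewrite in_itv/= => tT; case: (dh p t Sp tT).
  - move=> t; rewrite in_itv/= => tT.
    by rewrite derive1E; apply: derive_val; exact: dh.
have ik := Fubini_rect'_integrable (measurable_itv _) (measurable_itv _) ic.
have mJ : measurable ([set` `[a, b]] : set (measurableTypeR R)) by exact: measurable_itv.
rewrite -mulN1r -(RintegralZl (-1) mJ ik).
apply: eq_Rintegral => p /set_mem /JS Sp /=.
rewrite RintegralZl; last 2 first.
- exact: measurable_itv.
- apply: (@integrableS _ _ _ mu [set` `[0, T]]); [exact: measurable_itv|
    exact: measurable_itv|exact: subset_itv_oo_cc|].
  apply: continuous_compact_integrable; first exact: segment_compact.
  exact: slice_continuous_t cht Sp.
by rewrite FT//; ring.
Qed.

End cylinder.

(** * Regularity of kappa, phi0 and gamma *)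

Section coefficients.
Context {R : realType}.
Variable lambda : R.
Hypothesis lambda_gt0 : 0 < lambda.
Local Notation kap := (kappa lambda).
Local Notation C1 := (C1on lambda).

Lemma near_Omega (p : R) : lambda < p -> \forall q \near p, lambda < q.
Proof. exact: lt_nbhsr. Qed.

Lemma C1on_eq (c dc e de : R -> R) : C1 c dc ->
  (forall p, lambda < p -> c p = e p) -> (forall p, lambda < p -> dc p = de p) -> C1 e de.
Proof.
move=> cC ce dce; split=> p lp.
  apply: (@near_eq_is_derive _ _ _ c); first by apply: filterS (near_Omega lp) => q; exact: ce.
  by rewrite -dce//; exact: cC.1.
have := cC.2 p lp; rewrite /prop_for /continuous_at dce// => H.
apply: cvg_trans H; apply: near_eq_cvg.
by apply: filterS (near_Omega lp) => q lq; rewrite dce.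
Qed.

Lemma C1on_derive1 (c dc : R -> R) : C1 c dc ->
  (forall p, lambda < p -> derive1 c p = dc p) /\ C1 c (derive1 c).
Proof.
move=> cC; have E p : lambda < p -> derive1 c p = dc p.
  by move=> lp; rewrite derive1E; apply: derive_val; exact: cC.1.
by split => //; apply: C1on_eq cC _ _ => // p lp; rewrite E.
Qed.

Lemma C1onD (c dc e de : R -> R) : C1 c dc -> C1 e de ->
  C1 (fun x => c x + e x) (fun x => dc x + de x).
Proof.
move=> cC eC; split=> p lp; first by apply: is_derive_add; [exact: cC.1|exact: eC.1].
by apply: cvgD; [exact: cC.2|exact: eC.2].
Qed.

Lemma C1on_cst (a : R) : C1 (fun=> a) (fun=> 0).
Proof. by split=> p _; [exact: is_derive_const|exact: cvg_cst]. Qed.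

Lemma C1on_id : C1 id (fun=> 1).
Proof. by split=> p _; [exact: is_derive_idfun|exact: cvg_cst]. Qed.

Lemma C1on_smooth (W : R -> R) : smooth W -> C1 W (derive1 W).
Proof.
move=> sW; split=> p _; first exact: smooth_is_derive.
exact/smooth_continuous/smooth_derive1.
Qed.

Lemma C1on_kappa : C1 kap (fun p => - (p * kap p ^+ 3)).
Proof.
split=> p lp; first exact: is_derive_kappa.
apply: cvgN; apply: (is_derive_continuous (is_derive_mul (is_derive_idfun p)
  (is_derive_comp (is_derive_exprn 3 (kap p)) (is_derive_kappa lambda_gt0 lp)))).
Qed.

Lemma C1on_comp_kappa (W : R -> R) : smooth W ->
  C1 (fun p => W (kap p)) (fun p => derive1 W (kap p) * - (p * kap p ^+ 3)).
Proof.
move=> sW; split=> p lp.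
  by apply: is_derive_comp; [exact: smooth_is_derive|exact: is_derive_kappa].
apply: cvgM; last exact: C1on_kappa.2.
apply: (@continuous_comp _ _ _ kap (derive1 W)); first exact: continuous_kappa.
exact/smooth_continuous/smooth_derive1.
Qed.

(** Two derivatives are tracked because F = f0 - phi0' has to be C^1. *)
Definition C2on (c : R -> R) := exists dc ddc, C1 c dc /\ C1 dc ddc.

Lemma C2onM c e : C2on c -> C2on e -> C2on (fun x => c x * e x).
Proof.
move=> [c1 [c2 [cC c1C]]] [e1 [e2 [eC e1C]]].
eexists; eexists; split; first exact: C1onM cC eC.
by apply: C1onD; [exact: C1onM cC e1C|exact: C1onM eC c1C].
Qed.

Lemma C1on_dkappa : exists d, C1 (fun p => - (p * kap p ^+ 3)) d.
Proof.
have H := C1onM (C1on_cst (-1)) (C1onM C1on_id (C1onM C1on_kappa (C1onM C1on_kappa C1on_kappa))).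
eexists; apply: C1on_eq H _ (fun _ _ => erefl) => p _.
by rewrite /=; ring.
Qed.

Lemma C2on_kappa : C2on kap.
Proof.
have [d dC] := C1on_dkappa.
by exists (fun p => - (p * kap p ^+ 3)), d; split => //; exact: C1on_kappa.
Qed.

Lemma C2on_comp_kappa (W : R -> R) : smooth W -> C2on (fun p => W (kap p)).
Proof.
move=> sW; have [d dC] := C1on_dkappa.
eexists; eexists; split; first exact: C1on_comp_kappa.
exact: (C1onM (C1on_comp_kappa (smooth_derive1 sW)) dC).
Qed.

(** phi0 comes from W0 exactly as u(., t) comes from W(., t). *)
Lemma phi0E (W0 : R -> R) p : lambda < p -> phi0 lambda W0 p = kap p ^+ 3 * W0 (kap p).
Proof.
move=> lp; rewrite /phi0 div1r; congr (_ * _); have x0 := subr_sqr_gt0 lambda_gt0 lp.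
rewrite /kappa exprVn powRN; congr (_^-1).
have -> : 3 / 2 = 2^-1 * 3%:R :> R by rewrite mulrC.
by rewrite powRrM powR12_sqrt ?ltW// powR_mulrn// sqrtr_ge0.
Qed.

Lemma phi0_C2 (W0 : R -> R) : smooth W0 -> exists P1 P2,
  C1 (phi0 lambda W0) P1 /\ C1 P1 P2.
Proof.
move=> sW.
have [P1 [P2 [C C']]] := C2onM C2on_kappa (C2onM C2on_kappa (C2onM C2on_kappa (C2on_comp_kappa sW))).
exists P1, P2; split => //; apply: C1on_eq C _ (fun _ _ => erefl) => p lp.
by rewrite phi0E//=; ring.
Qed.

Lemma C1on_phi0 (W0 : R -> R) : smooth W0 ->
  C1 (phi0 lambda W0) (derive1 (phi0 lambda W0)).
Proof. by move=> /phi0_C2[P1 [P2 [C _]]]; exact: (C1on_derive1 C).2. Qed.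

Lemma C1on_background (f0 W0 : R -> R) : smooth f0 -> smooth W0 ->
  C1 (fun q => f0 q - derive1 (phi0 lambda W0) q)
     (derive1 (fun q => f0 q - derive1 (phi0 lambda W0) q)).
Proof.
move=> sf /phi0_C2[P1 [P2 [C C']]].
have H := C1onD (C1on_smooth sf) (C1onM (C1on_cst (-1)) C').
apply: (@C1on_derive1 _ _ _).2; apply: C1on_eq H _ (fun _ _ => erefl) => p lp /=.
by rewrite (C1on_derive1 C).1// mulN1r.
Qed.

Lemma C1on_gamma : C1 (gamma lambda) (derive1 (gamma lambda)).
Proof.
have sC : C1 (fun p => Num.sqrt (p ^+ 2 - lambda ^+ 2)) (fun p => p * kap p).
  split=> p lp.
    have s0 := sqrt_subr_sqr_gt0 lambda_gt0 lp.
    have d1 : is_derive p 1 (fun q : R => q ^+ 2 - lambda ^+ 2) (2 * p).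
      apply: (is_derive_eq (is_derive_add (is_derive_exprn 2 p) (is_derive_const (- lambda ^+ 2) p))).
      by rewrite /= expr1 addr0.
    have d2 := @is_derive_comp _ _ (fun q => q ^+ 2 - lambda ^+ 2) p _ _
      (is_derive1_sqrt (subr_sqr_gt0 lambda_gt0 lp)) d1.
    apply: (is_derive_eq d2); rewrite /kappa.
    by field; rewrite gt_eqF.
  by apply: cvgM; [exact: cvg_id|exact: continuous_kappa].
exact: (C1on_derive1 (C1onM C1on_id sC)).2.
Qed.

End coefficients.

(** * The weak formulation on the rectangle *)

Section solution.
Context {R : realType}.
Variables (lambda T : R) (f0 W0 : R -> R) (u du du2 : R * R -> R) (A B : R).
Local Notation mu := (@lebesgue_measure R).
Local Notation mu2 := (mu \x mu)%E.
Local Notation Om := (Omega lambda).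
Local Notation I := [set` `]0, T[].
Local Notation K := [set` `[A, B]].
Local Notation Q := (K `*` I).
Local Notation bmf2 := (@bounded_mfun _ (measurableTypeR R * measurableTypeR R)%type R).
Local Notation Phi0 := (phi0 lambda W0).
Local Notation F := (fun q => f0 q - derive1 Phi0 q).
Hypotheses (lambda_gt0 : 0 < lambda) (T0 : 0 < T) (sf0 : smooth f0) (sW0 : smooth W0).
Hypothesis hu : L2_W012 lambda T u du.
Hypothesis hdu2 : is_weak_dp lambda T (fun z => u z ^+ 2) du2.
Hypothesis hweak : forall eta, calV lambda T eta -> weak_form lambda T f0 W0 u du du2 eta.
Hypotheses (lA : lambda < A) (AB : A < B).
Hypothesis hsup : forall t, 0 < t < T ->
  {ae mu, forall p, Om p -> ~ K p -> u (p, t) = 0}.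

Let KOm : K `<=` Om. Proof. exact: itv_Omega. Qed.
Let KP p : K p -> lambda < p. Proof. by move/KOm/mem_Omega. Qed.
Let QQT : Q `<=` QT lambda T. Proof. by move=> [p t] [/KOm]. Qed.
Let IP t : I t <-> 0 < t < T. Proof. by rewrite /= in_itv. Qed.
Let mQ : measurable (Q : set (measurableTypeR R * measurableTypeR R)%type).
Proof. exact: measurable_rect. Qed.
Let mQT : measurable (QT lambda T : set (measurableTypeR R * measurableTypeR R)%type).
Proof. by apply: measurableX; exact: measurable_itv. Qed.
Let finQ : (mu2 Q < +oo)%E. Proof. exact: fin_rect. Qed.

Lemma ae_slices : {ae mu, forall t, I t ->
  W012 Om (fun p => u (p, t)) (fun p => du (p, t)) /\
  is_weak_deriv Om (fun p => u (p, t) ^+ 2) (fun p => du2 (p, t))}.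
Proof.
have [_ h1 _ _] := hu; have [_ h2] := hdu2.
by apply: aeS (aeI h1 h2) => t [h3 h4] /IP tT; split; [exact: h3|exact: h4].
Qed.

Let measurable_neq0 (g : R * R -> R) : measurable_fun (QT lambda T) g ->
  measurable (QT lambda T `&` [set z | g z <> 0]).
Proof.
move=> mg; have := mg mQT (~` [set 0]) (measurableC (measurable_set1 0)).
by [].
Qed.

Lemma ae_support : {ae mu2, forall z, QT lambda T z -> ~ Q z -> u z = 0 /\ du z = 0}.
Proof.
have [[mu_ mdu] _ _ _] := hu.
apply: (@ae_rect _ Om I (fun z => ~ Q z -> u z = 0 /\ du z = 0)).
  (* This form of the exceptional set shows its measurability, which [ae_rect] requires. *)
  have -> : (Om `*` I) `&` [set z | ~ (~ Q z -> u z = 0 /\ du z = 0)] =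
      ((QT lambda T `&` [set z | u z <> 0]) `|` (QT lambda T `&` [set z | du z <> 0])) `\` Q.
    apply/seteqP; split=> z /=.
      move=> [Qz /not_implyP[nQ /not_andP[h|h]]]; split => //; [left|right]; by split.
    by move=> [[[Qz h]|[Qz h]] nQ]; split => //; apply/not_implyP; split => //; apply/not_andP; [left|right].
  by apply: measurableD; [apply: measurableU; exact: measurable_neq0|exact: mQ].
apply: aeS ae_slices => t h It; have [hW _] := h It.
have v0 := hsup ((IP t).1 It).
apply: aeS (aeI v0 (W012_deriv_support hW v0)) => p [h1 h2] Op nQ.
have nK : ~ K p by move=> Kp; apply: nQ; split.
by split; [exact: h1|exact: h2].
Qed.

(** For almost every t both sides are weak derivatives of the square of u(., t), so uniqueness
    identifies them. *)
Lemma ae_du2 : {ae mu2, forall z, QT lambda T z -> du2 z = 2 * (u z * du z)}.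
Proof.
have [[mu_ mdu] _ _ _] := hu; have [mdu2 _] := hdu2.
apply: (@ae_rect _ Om I (fun z => du2 z = 2 * (u z * du z))).
  have mg : measurable_fun (QT lambda T) (fun z => du2 z - 2 * (u z * du z)).
    apply: measurable_funB => //; apply: measurable_funM; first exact: measurable_cst.
    exact: measurable_funM.
  have := measurable_neq0 mg; congr (measurable _); apply/seteqP; split=> z /= [Qz h]; split => //.
    by move=> E; apply: h; rewrite E subrr.
  by move=> /eqP; rewrite subr_eq0 => /eqP.
apply: aeS ae_slices => t h It; have [hW h2] := h It.
have v0 := hsup ((IP t).1 It).
by have := weak_deriv_unique h2 (W012_sqr_weak_deriv lA AB hW v0).
Qed.

(** The finite Bochner norm is an iterated integral, which Tonelli turns into square integrability
    on the cylinder. *)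
Lemma L2_u : L2fun mu2 Q u /\ L2fun mu2 Q du.
Proof.
have [[mu_ mdu] _ _ fin] := hu.
have mg : measurable_fun (QT lambda T) (EFin \o (fun z => u z ^+ 2 + du z ^+ 2)).
  by apply/measurable_EFinP; apply: measurable_funD; exact: measurable_funX.
have ig : mu2.-integrable (QT lambda T) (EFin \o (fun z => u z ^+ 2 + du z ^+ 2)).
  have mgr : measurable_fun setT ((EFin \o (fun z => u z ^+ 2 + du z ^+ 2)) \_ (QT lambda T)).
    exact: ((measurable_restrictT _ mQT).1 mg).
  have := (@integrable21ltyP _ _ _ _ _ mu mu _ mgr).2.
  move=> H; have {}H : mu2.-integrable setT ((EFin \o (fun z => u z ^+ 2 + du z ^+ 2)) \_ (QT lambda T)).
    apply: H; apply: le_lt_trans fin; rewrite [leRHS]integral_mkcond.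
    rewrite le_eqVlt; apply/orP; left; apply/eqP; apply: eq_integral => t _.
    rewrite patchE; case: ifPn => It.
      rewrite /W12_sqnorm [RHS]integral_mkcond; apply: eq_integral => p _.
      rewrite !patchE in_setX It andbT; case: ifP => _ /=; last by rewrite normr0.
      by rewrite ger0_norm// addr_ge0// sqr_ge0.
    rewrite -[RHS](@integral0 _ _ _ mu setT); apply: eq_integral => p _.
    by rewrite patchE in_setX (negbTE It) andbF /= normr0.
  have : mu2.-integrable (QT lambda T) ((EFin \o (fun z => u z ^+ 2 + du z ^+ 2)) \_ (QT lambda T)).
    by apply: (integrableS _ _ _ H); [exact: measurableT|exact: mQT|].
  by apply: (eq_integrable mQT) => z Qz; rewrite patchE Qz.
have igQ : mu2.-integrable Q (EFin \o (fun z => u z ^+ 2 + du z ^+ 2)).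
  by apply: (integrableS _ _ _ ig); [exact: mQT|exact: mQ|exact: QQT].
have muQ : measurable_fun Q u by exact: (measurable_funS mQT QQT mu_).
have mduQ : measurable_fun Q du by exact: (measurable_funS mQT QQT mdu).
split; split => //; apply: (le_integrable mQ _ _ igQ).
- by apply/measurable_EFinP; exact: measurable_funX.
- move=> x _ /=; rewrite lee_fin !ger0_norm ?addr_ge0 ?sqr_ge0//.
  by rewrite lerDl sqr_ge0.
- by apply/measurable_EFinP; exact: measurable_funX.
- move=> x _ /=; rewrite lee_fin !ger0_norm ?addr_ge0 ?sqr_ge0//.
  by rewrite lerDr sqr_ge0.
Qed.

(* the test function (T - t) psi(p), with psi supported away from [A, B], only sees phi0 *)
Lemma phi0_support p : lambda < p -> ~ K p -> Phi0 p = 0.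
Proof.
move=> lp nKp.
pose D := Om `&` ~` K.
have oD : open D.
  by apply: openI; [exact: open_Omega|exact/closed_openC/interval_closed].
have mD : measurable (D : set (measurableTypeR R)) by exact: open_measurable.
have cphi q : lambda < q -> {for q, continuous Phi0}.
  exact: C1on_continuous (C1on_phi0 lambda_gt0 sW0).
(* The factor T is the value of T - t at the initial time. *)
have lD : locally_integrable D (fun q => Phi0 q * T).
  have cphiT q : D q -> {for q, continuous (fun q => Phi0 q * T)}.
    by move=> [/mem_Omega lq _]; apply: cvgM; [exact: cphi|exact: cvg_cst].
  split => //.
    by apply: open_continuous_measurable_fun => // q /set_mem; exact: cphiT.
  move=> C CD cC; have : mu.-integrable C (EFin \o (fun q => Phi0 q * T)).
    apply: continuous_compact_integrable => //.
    by apply: continuous_in_subspaceT => q /set_mem /CD; exact: cphiT.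
  by case/integrableP.
have := @du_bois_reymond _ D _ lD.
move=> /(_ _)H.
have : {ae mu, forall q, D q -> Phi0 q * T = 0}.
  apply: H => psi [spsi cpsi psiD].
  have psi0 x : K x -> psi x = 0 /\ derive1 psi x = 0.
    move=> Kx; have nx : ~ closure [set y | psi y != 0] x by move=> /psiD[].
    split; last exact: derive1_eq0_closure.
    have [//|psix] := eqVneq (psi x) 0.
    by exfalso; apply: nx; exact: subset_closure.
  pose eta z := psi z.1 * (T - z.2).
  have etaC : C1cyl lambda T eta (fun z => psi z.1 * 0 + (T - z.2) * derive1 psi z.1)
      (fun z => psi z.1 * -1 + (T - z.2) * 0).
    apply: C1cylM; first exact: (C1cyl_fst _ (C1on_smooth _ spsi)).
    split.
    - apply: continuous_subspaceT => z; apply: cvgB; [exact: cvg_cst|exact: cvg_snd].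
    - by move=> z; exact: cvg_cst.
    - by move=> z; exact: cvg_cst.
    - move=> q t _ _; split; first exact: (is_derive_const (T - t) q).
      have := is_derive_add (is_derive_const T t) (is_derive_mul (is_derive_const (-1) t) (is_derive_idfun t)).
      rewrite /= => d; apply: (@near_eq_is_derive _ _ _ _ _ _ _ _ _ (is_derive_eq d _)).
        by near=> s; rewrite mulN1r.
      by rewrite mulr1 mulr0 addr0 add0r.
  have [M psiM] := compact_le_normr cpsi (continuous_subspaceT (smooth_continuous spsi)).
  have etaV : calV lambda T eta.
    split; first exact: C1cyl_Cn etaC.
      exists (`|M| * T); apply: aeW => -[q t] [_ /IP/andP[t0 tT]]; rewrite /eta/= normrM.
      have [->|psiq] := eqVneq (psi q) 0; first by rewrite normr0 mul0r mulr_ge0// ltW.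
      rewrite ler_pM//; first by rewrite (le_trans _ (ler_norm _))// psiM//; exact: subset_closure.
      have -> : `|T - t| = T - t by rewrite ger0_norm// subr_ge0 ltW.
      by rewrite lerBlDr lerDl ltW.
    by move=> q _; rewrite /eta/= subrr mulr0.
  have van (g w : R * R -> R) :
      {ae mu2, forall z, QT lambda T z -> ~ Q z -> g z = 0} ->
      (forall z, Q z -> w z = 0) -> {ae mu2, forall z, QT lambda T z -> g z * w z = 0}.
    move=> g0 w0; apply: aeS g0 => z g0 Qz; have [/w0->|/g0->//] := pselect (Q z).
      by rewrite mulr0.
    by rewrite mul0r.
  have R0 (g : R * R -> R) : {ae mu2, forall z, QT lambda T z -> g z = 0} ->
      \int[mu2]_(z in QT lambda T) g z = 0.
    move=> g0; rewrite (@Rintegral_support _ _ _ mu2 _ set0)// ?Rintegral_set0//.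
    by apply: aeS g0 => z g0 /g0.
  have eta0 z : Q z -> eta z = 0.
    by move=> [/psi0[p0 _] _]; rewrite /eta p0 mul0r.
  have deta0 z : Q z -> dp eta z = 0.
    case: z => q t [/= Kq /IP tT]; rewrite (C1cyl_dp etaC (KP Kq) tT)/=.
    by have [-> ->] := psi0 q Kq; rewrite !(mulr0, addr0).
  have teta0 z : Q z -> dt eta z = 0.
    case: z => q t [/= Kq /IP tT]; rewrite (C1cyl_dt etaC (KP Kq) tT)/=.
    by have [-> _] := psi0 q Kq; rewrite mul0r mulr0 addr0.
  have u0 : {ae mu2, forall z, QT lambda T z -> ~ Q z -> u z = 0}.
    by apply: aeS ae_support => z h Qz /(h Qz)[].
  have du0 : {ae mu2, forall z, QT lambda T z -> ~ Q z -> du z = 0}.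
    by apply: aeS ae_support => z h Qz /(h Qz)[].
  have du20 : {ae mu2, forall z, QT lambda T z -> ~ Q z -> du2 z = 0}.
    by apply: aeS (aeI u0 ae_du2) => z [h1 h2] Qz nQ; rewrite h2// h1// mul0r mulr0.
  have := hweak etaV; rewrite /weak_form !R0.
  - rewrite oppr0 !add0r => /esym E.
    rewrite -[RHS]E (@Rintegral_support _ _ _ mu Om D).
    + by apply: eq_Rintegral => q _; rewrite /eta/= subr0; ring.
    + by move=> q [].
    + apply: aeW => q Oq nD; have Kq : K q by apply: contrapT => nK; apply: nD.
      by rewrite /eta/= (psi0 q Kq).1 mul0r mulr0.
  - apply: van eta0; apply: aeS u0 => z h Qz nQ; by rewrite h// mulr0.
  - apply: van eta0; apply: aeS du20 => z h Qz nQ; by rewrite h// mulr0 oppr0.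
  - apply: van eta0; apply: aeS du0 => z h Qz nQ; by rewrite h// expr0n/= mulr0 oppr0.
  - apply: van deta0; apply: aeS du20 => z h Qz nQ; by rewrite h// mulr0.
  - exact: van u0 teta0.
move=> [N [mN N0 sN]]; apply: contrapT => /eqP phip.
have Dp : D p by split => //; exact/mem_Omega.
(* From almost everywhere to everywhere: by continuity phi0 would be nonzero on a ball, which has
   positive measure. *)
have : nbhs p (D `&` [set q | Phi0 q != 0]).
  apply: filterI; first exact: open_nbhs_nbhs.
  have H3 : nbhs (Phi0 p) [set y | y != 0].
    apply/nbhs_ballP; exists `|Phi0 p|; first by rewrite /= normr_gt0.
    by move=> y; rewrite /ball/=; apply: contraTneq => ->; rewrite subr0 ltxx.
  exact: (cphi p lp _ H3).
move=> /nbhs_ballP[r /= r0 rD].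
have : ball p r `<=` N.
  move=> q /rD[Dq phiq]; apply: sN => /= /(_ Dq) /eqP.
  by rewrite mulf_eq0 (negbTE phiq) gt_eqF.
move=> /(@le_measure _ _ _ mu) => /(_ _ _)H2.
have : (mu (ball p r) <= mu N)%E by apply: H2; rewrite inE//; exact: measurable_ball.
by rewrite N0 (lebesgue_measure_ball _ (ltW r0)) lee_fin leNgt mulrn_wgt0.
Unshelve. all: by end_near. Qed.

Let cylT (c : R -> R) : (forall p, lambda < p -> {for p, continuous c}) ->
  bmf2 Q (fun z => c z.1).
Proof.
move=> cc; apply: (bounded_mfun_cyl (@open_Omega _ lambda) KOm).
exact: within_cyl_fst.
Qed.

Let bcyl (g : R * R -> R) : {within Om `*` [set` `[0, T]], continuous g} -> bmf2 Q g.
Proof. exact: (bounded_mfun_cyl (@open_Omega _ lambda) KOm). Qed.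

Let gaC : C1on lambda (gamma lambda) (derive1 (gamma lambda)).
Proof. exact: C1on_gamma. Qed.
Let FC : C1on lambda F (derive1 F). Proof. exact: C1on_background. Qed.
Let phiC : C1on lambda Phi0 (derive1 Phi0). Proof. exact: C1on_phi0. Qed.

Let bga : bmf2 Q (fun z => gamma lambda z.1).
Proof. by apply: cylT => p; exact: C1on_continuous gaC. Qed.
Let bdga : bmf2 Q (fun z => derive1 (gamma lambda) z.1).
Proof. by apply: cylT; exact: gaC.2. Qed.
Let bF : bmf2 Q (fun z => F z.1).
Proof. by apply: (cylT (c := F)) => p; exact: C1on_continuous FC. Qed.
Let bdF : bmf2 Q (fun z => derive1 F z.1).
Proof. by apply: cylT; exact: FC.2. Qed.
Let bphi : bmf2 Q (fun z => Phi0 z.1).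
Proof. by apply: cylT => p; exact: C1on_continuous phiC. Qed.

Lemma integrable_diff_mul ht : bmf2 Q ht ->
  mu2.-integrable Q (EFin \o (fun z => u z * ht z)) /\
  mu2.-integrable Q (EFin \o (fun z => Phi0 z.1 * ht z)).
Proof.
move=> bht; have [Lu _] := L2_u; split.
  exact: (L2fun_mul mQ Lu (L2fun_bounded mQ finQ bht)).
exact: (L2fun_mul mQ (L2fun_bounded mQ finQ bphi) (L2fun_bounded mQ finQ bht)).
Qed.

(** h may be unbounded near lambda or at infinity, so the weak formulation is tested with chi h,
    which agrees with h on [Q]. The integrability is part of the conclusion because the integral is
    later split by Fubini. *)
Lemma weak_form_C1 h hp ht : C1cyl lambda T h hp ht ->
  (forall p, lambda < p -> h (p, T) = 0) ->
  mu2.-integrable Q (EFin \o (fun z => gamma lambda z.1 * hp z * (u z * du z)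
     + gamma lambda z.1 * h z * du z ^+ 2
     + derive1 (gamma lambda) z.1 * h z * (u z * du z)
     - derive1 F z.1 * gamma lambda z.1 * h z * u z)) /\
  \int[mu2]_(z in Q) (gamma lambda z.1 * hp z * (u z * du z)
     + gamma lambda z.1 * h z * du z ^+ 2
     + derive1 (gamma lambda) z.1 * h z * (u z * du z)
     - derive1 F z.1 * gamma lambda z.1 * h z * u z) =
  \int[mu2]_(z in Q) ((u z - Phi0 z.1) * ht z).
Proof.
move=> hC hT; have [ch chp cht dh] := hC.
pose r := (A - lambda) / 2.
have r0 : 0 < r by rewrite divr_gt0// subr_gt0.
have la : lambda < A - r by move: lA; rewrite /r; lra.
pose chi := cutoff A B r; pose dchi := dcutoff A B r.
have chi1 x : K x -> chi x = 1 /\ dchi x = 0.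
  by rewrite /= in_itv/= => /(cutoff_eq1 r0).
have chiC : C1on lambda chi dchi.
  by split=> p _; [exact: is_derive_cutoff|exact: continuous_dcutoff].
pose eta z := chi z.1 * h z.
have etaC := C1cylM (C1cyl_fst T chiC) hC; rewrite -/eta in etaC.
have JOm : [set` `[A - r, B + r]] `<=` Om by exact: itv_Omega.
have etaV : calV lambda T eta.
  split; first exact: C1cyl_Cn etaC.
    have [ce _ _ _] := etaC.
    have [_ [M eM]] := bounded_mfun_cyl (@open_Omega _ lambda) JOm ce.
    exists `|M|; apply: aeW => -[p t] [Op It].
    have [Jp|nJp] := pselect ([set` `[A - r, B + r]] p).
      by rewrite (le_trans (eM (p, t) _))// ?ler_norm//; split.
    rewrite /eta /chi /= (cutoff_eq0 r0 _).1 ?mul0r ?normr0//.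
    by apply/negP => /andP[h1 h2]; apply: nJp; rewrite /= in_itv/= !ltW.
  by move=> p /mem_Omega lp; rewrite /eta/= hT// mulr0.
have etaE z : Q z -> eta z = h z.
  by move=> [/chi1[c1 _] _]; rewrite /eta c1 mul1r.
have dpE z : Q z -> dp eta z = hp z.
  case: z => p t [/= Kp /IP tT]; rewrite (C1cyl_dp etaC (KP Kp) tT)/=.
  by have [-> ->] := chi1 p Kp; rewrite mulr0 addr0 mul1r.
have dtE z : Q z -> dt eta z = ht z.
  case: z => p t [/= Kp /IP tT]; rewrite (C1cyl_dt etaC (KP Kp) tT)/=.
  by have [-> _] := chi1 p Kp; rewrite mulr0 addr0 mul1r.
(* Each term of the weak formulation is moved to [Q], where du2 becomes 2 u du and the cutoff
   disappears. *)
have conv (g g' w w' : R * R -> R) :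
    {ae mu2, forall z, QT lambda T z -> (~ Q z -> g z = 0) /\ g z = g' z} ->
    (forall z, Q z -> w z = w' z) ->
    \int[mu2]_(z in QT lambda T) (g z * w z) = \int[mu2]_(z in Q) (g' z * w' z).
  move=> g0 ww'.
  apply: (@Rintegral_support_ae _ _ _ mu2 _ Q (fun z => g z * w z) (fun z => g' z * w' z) QQT).
  apply: aeS g0 => z h1 Qz; split=> [nQ|Qz']; first by rewrite (h1 Qz).1// mul0r.
  by rewrite ww'// (h1 Qz).2.
have sup := aeI ae_support ae_du2.
have := hweak etaV; rewrite /weak_form.
rewrite (@conv u u (dt eta) ht)//; last first.
  by apply: aeS sup => z [h1 _] Qz; split => // nQ; exact: (h1 Qz nQ).1.
rewrite (@conv (fun z => gamma lambda z.1 / 2 * du2 z) (fun z => gamma lambda z.1 * (u z * du z)) (dp eta) hp)//; last first.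
  apply: aeS sup => z [h1 h2] Qz; rewrite h2//; split; last by field.
  by move=> nQ; rewrite (h1 Qz nQ).1 mul0r !mulr0.
rewrite (@conv (fun z => - (gamma lambda z.1 * du z ^+ 2))
  (fun z => -1 * (gamma lambda z.1 * du z ^+ 2)) eta h)//; last first.
  apply: aeS sup => z [h1 h2] Qz; split; last by ring.
  by move=> nQ; rewrite (h1 Qz nQ).2 expr0n/= mulr0 oppr0.
rewrite (@conv (fun z => - (derive1 (gamma lambda) z.1 / 2 * du2 z))
  (fun z => -1 * (derive1 (gamma lambda) z.1 * (u z * du z))) eta h)//; last first.
  apply: aeS sup => z [h1 h2] Qz; rewrite h2//; split; last by field.
  by move=> nQ; rewrite (h1 Qz nQ).1 mul0r !mulr0 oppr0.
rewrite (@conv (fun z => g0 lambda f0 W0 z.1 * u z)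
  (fun z => derive1 F z.1 * gamma lambda z.1 * u z) eta h)//; last first.
  apply: aeS sup => z [h1 h2] Qz; rewrite /g0 /gamma; split; last by ring.
  by move=> nQ; rewrite (h1 Qz nQ).1 mulr0.
(* phi0 does not depend on time, so the initial term is a space-time integral against the time
   derivative; this is how u - phi0 arises. *)
have E6 : \int[mu]_(p in Om) (Phi0 p * eta (p, 0)) = - \int[mu2]_(z in Q) (Phi0 z.1 * ht z).
  rewrite (@Rintegral_support _ _ _ mu Om K _ KOm); last first.
    by apply: aeW => p /mem_Omega lp nK; rewrite phi0_support// mul0r.
  transitivity (\int[mu]_(p in K) (Phi0 p * h (p, 0))).
    by apply: eq_Rintegral => p /set_mem/chi1[c1 _]; rewrite /eta/= c1 mul1r.
  apply: (@integral_initial_value _ T T0 Om Phi0 h ht A B (@open_Omega _ lambda) KOm bphi ch cht).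
  - by move=> p t /mem_Omega lp tT; exact: (dh p t lp tT).2.
  - by move=> p /mem_Omega; exact: hT.
rewrite E6.
have [bh bhp bht] : [/\ bmf2 Q h, bmf2 Q hp & bmf2 Q ht].
  by split; exact: bcyl.
have [Lu Ldu] := L2_u.
have iudu := L2fun_mul mQ Lu Ldu.
have iu := L2fun_integrable mQ finQ Lu.
have i1 := integrable_bounded_mfun mQ (bounded_mfunM bga bhp) iudu.
have i2 := integrable_bounded_mfun mQ (bounded_mfunM bga bh) Ldu.2.
have i3 := integrable_bounded_mfun mQ (bounded_mfunM bdga bh) iudu.
have i4 := integrable_bounded_mfun mQ (bounded_mfunM (bounded_mfunM bdF bga) bh) iu.
have [i5 i6] := integrable_diff_mul bht.
have i12 := integrable_addR mQ i1 i2; have i123 := integrable_addR mQ i12 i3.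
move=> E; split; first exact: (integrable_subR mQ i123 i4).
rewrite (RintegralB mQ i123 i4) (RintegralD mQ i12 i3) (RintegralD mQ i1 i2).
have -> : \int[mu2]_(z in Q) ((u z - Phi0 z.1) * ht z) =
    \int[mu2]_(z in Q) (u z * ht z) - \int[mu2]_(z in Q) (Phi0 z.1 * ht z).
  by rewrite -(RintegralB mQ i5 i6); apply: eq_Rintegral => z _; rewrite mulrBl.
move: E.
have -> : \int[mu2]_(z in Q) (gamma lambda z.1 * (u z * du z) * hp z) =
    \int[mu2]_(z in Q) (gamma lambda z.1 * hp z * (u z * du z)).
  by apply: eq_Rintegral => z _; ring.
have -> : \int[mu2]_(z in Q) (-1 * (gamma lambda z.1 * du z ^+ 2) * h z) =
    - \int[mu2]_(z in Q) (gamma lambda z.1 * h z * du z ^+ 2).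
  by rewrite -[RHS]mulN1r -(RintegralZl (-1) mQ i2); apply: eq_Rintegral => z _; ring.
have -> : \int[mu2]_(z in Q) (-1 * (derive1 (gamma lambda) z.1 * (u z * du z)) * h z) =
    - \int[mu2]_(z in Q) (derive1 (gamma lambda) z.1 * h z * (u z * du z)).
  by rewrite -[RHS]mulN1r -(RintegralZl (-1) mQ i3); apply: eq_Rintegral => z _; ring.
have -> : \int[mu2]_(z in Q) (derive1 F z.1 * gamma lambda z.1 * u z * h z) =
    \int[mu2]_(z in Q) (derive1 F z.1 * gamma lambda z.1 * h z * u z).
  by apply: eq_Rintegral => z _; ring.
by lra.
Qed.

(** * The right-hand sides *)

Lemma C1cyl_slice h hp ht t : C1cyl lambda T h hp ht -> 0 < t < T ->
  C1on lambda (fun p => h (p, t)) (fun p => hp (p, t)).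
Proof.
move=> [ch chp _ dh] tT; split=> p lp; first exact: (dh p t lp tT).1.
by apply: (slice_continuous_p (@open_Omega _ lambda) chp) => //; exact/mem_Omega.
Qed.

(** Both identities are instances: m = 1 and n = d_p zeta for the first, m = xi(kappa(p), t) and n =
    p for the second. m is the factor that sits inside the kernel, n the one outside. *)
Lemma pairing m mp mt n np nt (S y1 y2 : R -> R -> R) :
  C1cyl lambda T m mp mt -> C1cyl lambda T n np nt ->
  (forall p, lambda < p -> m (p, T) * n (p, T) = 0) ->
  (forall t p, 0 < t < T -> lambda < p -> S t p = gamma lambda p * m (p, t) * u (p, t)) ->
  (forall t p, 0 < t < T -> p < - lambda -> S t p = 0) ->
  (forall t p, 0 < t < T -> lambda < p -> y1 t p = (F p + du (p, t)) * n (p, t)) ->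
  (forall t p, 0 < t < T -> lambda < p -> y2 t p = (F p + du (p, t)) * np (p, t)) ->
  \int[mu]_(t in I) \int[mu]_(p in Phi_dom lambda)
    (y1 t p * weak_deriv (Phi_dom lambda) (S t) p) +
  \int[mu]_(t in I) \int[mu]_(p in Phi_dom lambda) (y2 t p * S t p) =
  \int[mu2]_(z in Q) ((u z - Phi0 z.1) * (m z * nt z + n z * mt z)).
Proof.
move=> mC nC mnT SE S0 y1E y2E.
have hC := C1cylM mC nC.
have [iJ <-] := weak_form_C1 hC mnT.
have [[cm cmp cmt _] [cn cnp cnt _]] := (mC, nC).
have [bm bmp bn bnp] : [/\ bmf2 Q m, bmf2 Q mp,
    bmf2 Q n & bmf2 Q np] by split; exact: bcyl.
have [Lu Ldu] := L2_u.
pose i1 z := (F z.1 + du z) * n z * ((gamma lambda z.1 * mp z + m z * derive1 (gamma lambda) z.1) * u z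
  + gamma lambda z.1 * m z * du z).
pose i2 z := (F z.1 + du z) * np z * (gamma lambda z.1 * m z * u z).
have LX : L2fun mu2 Q (fun z => F z.1 + du z).
  by apply: (L2funD mQ) => //; exact: (L2fun_bounded mQ finQ bF).
have bgm := bounded_mfunM bga bm.
have LY : L2fun mu2 Q (fun z => (gamma lambda z.1 * mp z + m z * derive1 (gamma lambda) z.1) * u z
  + gamma lambda z.1 * m z * du z).
  apply: (L2funD mQ); apply: (L2fun_bounded_mul mQ) => //.
  exact: (bounded_mfunD (bounded_mfunM bga bmp) (bounded_mfunM bm bdga)).
have ii1 : mu2.-integrable Q (EFin \o i1).
  have := integrable_bounded_mfun mQ bn (L2fun_mul mQ LX LY).
  by apply: (eq_integrable mQ) => z _ /=; rewrite /i1; congr EFin; ring.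
have ii2 : mu2.-integrable Q (EFin \o i2).
  have := integrable_bounded_mfun mQ bnp (L2fun_mul mQ LX (L2fun_bounded_mul mQ bgm Lu)).
  by apply: (eq_integrable mQ) => z _ /=; rewrite /i2; congr EFin; ring.
have mK : measurable (K : set (measurableTypeR R)) by exact: measurable_itv.
have mI : measurable (I : set (measurableTypeR R)) by exact: measurable_itv.
have E1 : \int[mu]_(t in I) \int[mu]_(p in Phi_dom lambda)
    (y1 t p * weak_deriv (Phi_dom lambda) (S t) p) = \int[mu2]_(z in Q) i1 z.
  rewrite (Fubini_rect mK mI ii1); apply: ae_Rintegral.
  apply: aeS ae_slices => t h It; have [hW _] := h It; have tT := (IP t).1 It.
  have cC := C1onM gaC (C1cyl_slice mC tT).
  rewrite (pair_weak_deriv_slice lambda_gt0 lA AB hW (hsup tT) cC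
    (fun p lp => SE t p tT lp) (fun p lp => S0 t p tT lp)).
  by apply: eq_Rintegral => p /set_mem/KP lp; rewrite y1E.
have E2 : \int[mu]_(t in I) \int[mu]_(p in Phi_dom lambda) (y2 t p * S t p) =
    \int[mu2]_(z in Q) i2 z.
  rewrite (Fubini_rect mK mI ii2); apply: ae_Rintegral.
  apply: aeS ae_slices => t h It; have [hW _] := h It; have tT := (IP t).1 It.
  rewrite (pair_slice lA (hsup tT) (fun p lp => SE t p tT lp) (fun p lp => S0 t p tT lp)).
  by apply: eq_Rintegral => p /set_mem/KP lp; rewrite y2E.
rewrite E1 E2 -(RintegralD mQ ii1 ii2) (Fubini_rect mK mI (integrable_addR mQ ii1 ii2)).
rewrite (Fubini_rect mK mI iJ); apply: ae_Rintegral.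
apply: aeS ae_slices => t h It; have [hW _] := h It; have tT := (IP t).1 It.
exact: (slice_energy lA AB hW (hsup tT) FC gaC (C1cyl_slice mC tT) (C1cyl_slice nC tT)).
Qed.

Lemma derive_phi0_support p : lambda < p -> ~ K p -> derive1 Phi0 p = 0.
Proof.
move=> lp nK; rewrite derive1E (@near_eq_derive _ _ _ _ (cst 0)) ?derive_cst//.
have : nbhs p (Om `&` ~` K).
  apply: open_nbhs_nbhs; split; last by split => //; exact/mem_Omega.
  by apply: openI; [exact: open_Omega|exact/closed_openC/interval_closed].
by apply: filterS => q [/mem_Omega lq nKq]; exact: phi0_support.
Qed.

(** * The left-hand sides *)

Hypotheses (phiA : Phi0 A = 0) (phiB : Phi0 B = 0).

(** u is handled by the Sobolev formula, phi0 by the classical one, whose boundary terms vanish by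
    [phiA] and [phiB]. *)
Lemma slice_by_parts (psi dpsi : R -> R) t : C1on lambda psi dpsi ->
  W012 Om (fun p => u (p, t)) (fun p => du (p, t)) -> 0 < t < T ->
  mu.-integrable K (EFin \o (fun p => psi p * (du (p, t) - derive1 Phi0 p))) /\
  \int[mu]_(p in K) (psi p * (du (p, t) - derive1 Phi0 p)) =
  -1 * \int[mu]_(p in K) ((u (p, t) - Phi0 p) * dpsi p).
Proof.
move=> psiC hW tT.
have mK : measurable (K : set (measurableTypeR R)) by exact: measurable_itv.
have [iu idu] := W012K_integrable B lA hW.
have cpsi p : lambda < p -> {for p, continuous psi} by exact: C1on_continuous psiC.
have cphi p : lambda < p -> {for p, continuous Phi0} by exact: C1on_continuous phiC.
have iK (f : R -> R) : (forall p, lambda < p -> {for p, continuous f}) ->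
    mu.-integrable K (EFin \o f).
  by move=> cf; apply: itv_integrable => p Ap _; apply: cf; exact: lt_le_trans Ap.
have i1 := integrable_continuous_mul lA cpsi (integrable_subR mK idu (iK _ phiC.2)).
split => //.
have j1 := integrable_continuous_mul lA psiC.2 iu.
have j2 := integrable_continuous_mul lA psiC.2 (iK _ cphi).
have k1 := integrable_continuous_mul lA cpsi idu.
have k2 := integrable_continuous_mul lA cpsi (iK _ phiC.2).
have -> : \int[mu]_(p in K) (psi p * (du (p, t) - derive1 Phi0 p)) =
    \int[mu]_(p in K) (psi p * du (p, t)) - \int[mu]_(p in K) (psi p * derive1 Phi0 p).
  by rewrite -(RintegralB mK k1 k2); apply: eq_Rintegral => p _; ring.
have -> : \int[mu]_(p in K) ((u (p, t) - Phi0 p) * dpsi p) =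
    \int[mu]_(p in K) (dpsi p * u (p, t)) - \int[mu]_(p in K) (dpsi p * Phi0 p).
  by rewrite -(RintegralB mK j1 j2); apply: eq_Rintegral => p _; ring.
have := W012_by_parts lA AB hW (hsup tT) psiC.1 psiC.2.
have -> : \int[mu]_(p in K) (u (p, t) * dpsi p) = \int[mu]_(p in K) (dpsi p * u (p, t)).
  by apply: eq_Rintegral => p _; rewrite mulrC.
have -> : \int[mu]_(p in K) (du (p, t) * psi p) = \int[mu]_(p in K) (psi p * du (p, t)).
  by apply: eq_Rintegral => p _; rewrite mulrC.
have lr (c dc : R -> R) : C1on lambda c dc -> [/\ {within [set` `[A, B]], continuous dc},
    derivable_oo_LRcontinuous c A B & {in `]A, B[, derive1 c =1 dc}].
  move=> cC; split.
  - by apply: continuous_in_subspaceT => x /set_mem /KP; exact: cC.2.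
  - split.
    + move=> x xAB; have Kx : K x by exact: subset_itv_oo_cc.
      by case: (cC.1 x (KP Kx)).
    + by apply: cvg_at_right_filter; exact: C1on_continuous cC _.
    + by apply: cvg_at_left_filter; apply: C1on_continuous cC _; exact: lt_trans AB.
  - move=> x xAB; have Kx : K x by exact: subset_itv_oo_cc.
    by rewrite derive1E; apply: derive_val; exact: (cC.1 x (KP Kx)).
have [c1 c2 c3] := lr _ _ phiC; have [d1 d2 d3] := lr _ _ psiC.
have := @Rintegration_by_parts _ psi Phi0 dpsi (derive1 Phi0) A B AB d1 d2 d3 c1 c2 c3.
rewrite phiA phiB !mulr0 subrr add0r.
by lra.
Qed.

(** At t = T, e10 is only a continuous extension of the p-derivative, so differentiating the
    terminal condition is not allowed. Instead, the difference quotients of e00(., t) tend to 0 as t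
    tends to T, while a nonzero e10(p, T) would keep them away from 0 by the mean value theorem. *)
Lemma eta_terminal (e00 e10 : R * R -> R) :
  {within setT `*` [set` `[0, T]], continuous e00} ->
  {within setT `*` [set` `[0, T]], continuous e10} ->
  (forall p t : R, 0 < t < T -> is_derive p 1 (fun x => e00 (x, t)) (e10 (p, t))) ->
  (forall p, e00 (p, T) = 0) -> forall p, e10 (p, T) = 0.
Proof.
move=> c00 c10 de eT p; apply/eqP; apply: contraT => cn0.
have c0 : 0 < `|e10 (p, T)| by rewrite normr_gt0.
have AT : (setT `*` [set` `[0, T]]) (p, T) by split => //=; rewrite in_itv/= lexx ltW.
move/subspace_continuousP: (c10) => /(_ (p, T) AT) /cvgrPdist_lt /(_ (`|e10 (p, T)| / 2)).
rewrite divr_gt0// => /(_ isT) H.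
have {}H : nbhs (p, T) [set z | (setT `*` [set` `[0, T]]) z ->
  `|e10 (p, T) - e10 z| < `|e10 (p, T)| / 2] := H.
move/nbhs_ballP: H => [r /= r0 rH].
(* Near (p, T) the increment over [p, q] exceeds |e10(p, T)| / 2 times r / 2, which is exactly 2
   ep. *)
pose q := p + r / 2; pose ep := `|e10 (p, T)| * r / 8.
have ep0 : 0 < ep by rewrite /ep divr_gt0// mulr_gt0.
have lim x : \forall t \near T^'-, `|e00 (x, t)| < ep.
  have [_ _ cT] := (continuous_within_itvP _ T0).1 (slice_continuous_t c00 (Logic.I : setT x)).
  move/cvgrPdist_lt: cT => /(_ _ ep0); apply: filterS => t.
  by rewrite eT sub0r normrN.
have [t [[h1 h2] [h3 h4]]] : exists t, (`|e00 (p, t)| < ep /\ `|e00 (q, t)| < ep) /\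
    (Num.max 0 (T - r) < t /\ t < T).
  apply: (@filter_ex _ (T^'-)); apply: filterI; first by apply: filterI; exact: lim.
  apply: filterI; last exact: nbhs_left_lt.
  by apply: nbhs_left_gt; rewrite gt_max T0 gtrBl.
move: h3; rewrite gt_max => /andP[t0 tr].
have tT : 0 < t < T by rewrite t0.
have pq : p < q by rewrite /q ltrDl divr_gt0.
have cp : {within [set` `[p, q]], continuous (fun x => e00 (x, t))}.
  by apply: continuous_subspaceT => x; exact: (is_derive_continuous (de x t tT)).
have [x] := MVT pq (fun y _ => de y t tT) cp.
rewrite in_itv/= => /andP[px xq] E.
have Ax : (setT `*` [set` `[0, T]]) (x, t) by split => //=; rewrite in_itv/= !ltW.
have := rH (x, t); have bx : ball (p, T) r (x, t).
  split; rewrite /ball/= ltr_distlC; apply/andP; split; move: px xq tr h4 r0; rewrite /q; lra.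
move=> /(_ bx Ax) /= close.
have big : `|e10 (p, T)| / 2 < `|e10 (x, t)|.
  by have := lerB_dist (e10 (p, T)) (e10 (p, T) - e10 (x, t)); rewrite subKr; lra.
have : `|e00 (q, t) - e00 (p, t)| < ep + ep.
  by rewrite (le_lt_trans (ler_normB _ _))// addrC ltrD.
rewrite E normrM (_ : q - p = r / 2); last by rewrite /q; ring.
rewrite (ger0_norm (ltW (divr_gt0 r0 _)))// /ep.
have : `|e10 (p, T)| / 2 * (r / 2) < `|e10 (x, t)| * (r / 2).
  by rewrite ltr_pM2r// divr_gt0.
by lra.
Qed.

Local Notation f := (fsol lambda f0 W0 du).

(** f0 does not depend on time, so its contribution cancels the initial term; the rest of f is the
    p-derivative of u - phi0 and is integrated by parts against d_t zeta. The uniform bound M on the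
    support confines the f0 part to a bounded rectangle. *)
Lemma first_lhs (zeta e00 e01 e11 : R * R -> R) (M : R) :
  (forall p t, 0 <= t <= T -> zeta (p, t) = e00 (p, t)) ->
  {within setT `*` [set` `[0, T]], continuous e00} ->
  {within setT `*` [set` `[0, T]], continuous e01} ->
  {within setT `*` [set` `[0, T]], continuous e11} ->
  (forall p t : R, 0 < t < T -> is_derive t 1 (fun s => e00 (p, s)) (e01 (p, t))) ->
  (forall p t : R, 0 < t < T -> is_derive p 1 (fun x => e01 (x, t)) (e11 (p, t))) ->
  (forall p t, 0 <= t <= T -> M < `|p| -> zeta (p, t) = 0) ->
  (forall p, zeta (p, T) = 0) ->
  - (\int[mu]_(t in I) \int[mu]_p (f (p, t) * dt zeta (p, t)))
  - (\int[mu]_p (f0 p * zeta (p, 0))) =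
  \int[mu2]_(z in Q) ((u z - Phi0 z.1) * e11 z).
Proof.
move=> zE c00 c01 c11 d01 d11 zM zT.
have tI t : 0 < t < T -> 0 <= t <= T by move=> /andP[t0 tT]; rewrite !ltW.
have nearz p t : 0 < t < T -> \forall s \near t, zeta (p, s) = e00 (p, s).
  move=> /andP[t0 tT]; near=> s; apply: zE; apply/andP; split; apply: ltW.
    by near: s; exact: lt_nbhsr.
  by near: s; exact: lt_nbhsl.
have dtE p t : 0 < t < T -> dt zeta (p, t) = e01 (p, t).
  move=> tT; rewrite /dt derive1E/= (near_eq_derive _ (nearz p t tT))//.
  by apply: derive_val; exact: d01.
have dt0 p t : 0 < t < T -> M < `|p| -> dt zeta (p, t) = 0.
  move=> tT Mp; rewrite /dt derive1E/= (@near_eq_derive _ _ _ _ (cst 0)) ?derive_cst//.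
  move/andP: tT => [t0 tT]; near=> s; apply: zM => //; apply/andP; split; apply: ltW.
    by near: s; exact: lt_nbhsr.
  by near: s; exact: lt_nbhsl.
(* Large enough for [-N, N] to contain both the support of zeta and [A, B]. *)
pose N := `|M| + B + 1.
have A0 : 0 < A by exact: lt_trans lA.
have MN : M <= N by rewrite /N; have := ler_norm M; move: A0 AB; lra.
have NN : - N < A by rewrite /N; have := normr_ge0 M; move: A0 AB; lra.
have BN : B < N by rewrite /N; have := normr_ge0 M; lra.
pose L := [set` `[- N, N]] : set R.
have KL : K `<=` L.
  by move=> x; rewrite /L /= !in_itv/= => /andP[Ax xB]; apply/andP; split; move: Ax xB NN BN; lra.
have outL p : ~ L p -> M < `|p|.
  move=> nL; rewrite ltNge; apply/negP => pM; apply: nL; rewrite /L/= in_itv/=.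
  by rewrite -ler_norml (le_trans pM).
have mK : measurable (K : set (measurableTypeR R)) by exact: measurable_itv.
have mL : measurable (L : set (measurableTypeR R)) by exact: measurable_itv.
have mI : measurable (I : set (measurableTypeR R)) by exact: measurable_itv.
have LT : L `<=` setT by [].
have cf0 := smooth_continuous sf0.
have b01 := bounded_mfun_cyl openT LT c01.
have bf0 : @bounded_mfun _ (measurableTypeR R * measurableTypeR R)%type R (L `*` I) (fun z => f0 z.1).
  apply: (bounded_mfun_cyl openT LT); apply: continuous_subspaceT => z.
  by apply: (@continuous_comp _ _ _ fst f0); [exact: cvg_fst|exact: cf0].
have finL : (mu2 (L `*` I) < +oo)%E by exact: fin_rect.
have mLI := measurable_rect T (- N) N.
have i1 := L2fun_integrable mLI finL (L2fun_bounded mLI finL (bounded_mfunM bf0 b01)).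
have b11 : bmf2 Q e11.
  by apply: (bounded_mfun_cyl openT _ c11).
have [i5 i6] := integrable_diff_mul b11.
have i2 : mu2.-integrable Q (EFin \o (fun z => (u z - Phi0 z.1) * e11 z)).
  by move: (integrable_subR mQ i5 i6); apply: (eq_integrable mQ) => z _ /=; rewrite mulrBl.
have psiC t : 0 < t < T -> C1on lambda (fun p => e01 (p, t)) (fun p => e11 (p, t)).
  move=> tT; split=> p _; first exact: d11.
  exact: (slice_continuous_p openT c11).
have inner : {ae mu, forall t, I t -> \int[mu]_p (f (p, t) * dt zeta (p, t)) =
    \int[mu]_(p in L) (f0 p * e01 (p, t)) +
    -1 * \int[mu]_(p in K) ((u (p, t) - Phi0 p) * e11 (p, t))}.
  apply: aeS ae_slices => t h It; have [hW _] := h It; have tT := (IP t).1 It.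
  have [ib Eb] := slice_by_parts (psiC t tT) hW tT; rewrite -Eb.
  (* Extended by zero, so that f = f0 + g on the whole line; g vanishes almost everywhere off
     [K]. *)
  pose g := (fun p => du (p, t) - derive1 Phi0 p) \_ Om.
  have gE p : lambda < p -> g p = du (p, t) - derive1 Phi0 p.
    by move=> lp; rewrite /g patchE mem_set//; exact/mem_Omega.
  have g0 p : ~ lambda < p -> g p = 0.
    by move=> lp; rewrite /g patchE memNset// => /mem_Omega.
  have fE p : f (p, t) = f0 p + g p.
    rewrite /fsol; case: ifPn => lp; first by rewrite gE.
    by rewrite g0//; exact/negP.
  have [_ mdv] := W012_measurable hW.
  have mg : measurable_fun L g.
    apply: measurable_funTS; apply/(measurable_restrictT _ _).1; first exact: measurable_Omega.
    apply: measurable_funB => //; apply: continuous_measurable_Omega; exact: phiC.2.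
  have gs : {ae mu, forall p, L p -> ~ K p -> e01 (p, t) * g p = 0}.
    apply: aeS (W012_deriv_support hW (hsup tT)) => p dv0 _ nK.
    have [lp|nlp] := pselect (is_true (lambda < p)); last by rewrite g0// mulr0.
    by rewrite gE// dv0// ?derive_phi0_support// ?subr0 ?mulr0//; exact/mem_Omega.
  have ce p : {for p, continuous (fun x => e01 (x, t))}.
    exact: (slice_continuous_p openT c01).
  have me : measurable_fun L (fun p => e01 (p, t)) by apply: itv_measurable => p _ _; exact: ce.
  have igK : mu.-integrable K (EFin \o (fun p => e01 (p, t) * g p)).
    by move: ib; apply: (eq_integrable mK) => p /set_mem/KP lp /=; rewrite gE.
  have igL := integrable_support mL mK KL (measurable_funM me mg) gs igK.
  have ifL : mu.-integrable L (EFin \o (fun p => f0 p * e01 (p, t))).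
    by apply: itv_integrable => p _ _; apply: cvgM; [exact: cf0|exact: ce].
  rewrite (@Rintegral_support _ _ _ mu setT L)//; last first.
    by apply: aeW => p _ /outL Mp; rewrite dt0// mulr0.
  have -> : \int[mu]_(p in K) (e01 (p, t) * (du (p, t) - derive1 Phi0 p)) =
      \int[mu]_(p in L) (e01 (p, t) * g p).
    rewrite (@Rintegral_support _ _ _ mu L K)//.
    by apply: eq_Rintegral => p /set_mem/KP lp; rewrite gE.
  rewrite -(RintegralD mL ifL igL); apply: eq_Rintegral => p _.
  by rewrite dtE// fE mulrDl [g p * _]mulrC.
rewrite (ae_Rintegral inner).
have j1 := Fubini_rect_integrable mL mI i1; have j2 := Fubini_rect_integrable mK mI i2.
rewrite (RintegralD mI j1); last exact: (integrableZl mI (-1) j2).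
rewrite (RintegralZl (-1) mI j2) -(Fubini_rect mL mI i1) -(Fubini_rect mK mI i2).
have -> : \int[mu]_p (f0 p * zeta (p, 0)) = \int[mu]_(p in L) (f0 p * e00 (p, 0)).
  rewrite (@Rintegral_support _ _ _ mu setT L)//; last first.
    by apply: aeW => p _ /outL Mp; rewrite zM ?mulr0// lexx ltW.
  by apply: eq_Rintegral => p _; rewrite zE// lexx ltW.
rewrite (@integral_initial_value _ T T0 setT f0 e00 e01 (- N) N openT LT bf0 c00 c01).
- by ring.
- by move=> p _; rewrite -zE ?zT// lexx ltW.
Unshelve. all: by end_near. Qed.

(** After k = kappa(p) the factor kappa^(-3) of W cancels against the Jacobian p kappa^3, leaving u
    p; W0 becomes phi0 p in the same way. The vanishing of W0 for k <= 0 makes its integral one over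
    the positive half-line. *)
Lemma second_lhs (xi e00 e01 : R * R -> R) :
  (forall k, k <= 0 -> W0 k = 0) ->
  (forall p t, 0 <= t <= T -> xi (p, t) = e00 (p, t)) ->
  {within setT `*` [set` `[0, T]], continuous e00} ->
  {within setT `*` [set` `[0, T]], continuous e01} ->
  (forall p t : R, 0 < t < T -> is_derive t 1 (fun s => e00 (p, s)) (e01 (p, t))) ->
  continuous (fun k => xi (k, 0)) -> (forall p, xi (p, T) = 0) ->
  \int[mu]_(t in I) \int[mu]_k (Wsol lambda u (k, t) * dt xi (k, t))
  + \int[mu]_k (W0 k * xi (k, 0)) =
  \int[mu2]_(z in Q) ((u z - Phi0 z.1) * (z.1 * e01 (kappa lambda z.1, z.2))).
Proof.
move=> W0n xE c00 c01 d01 cxi xT.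
have nearx p t : 0 < t < T -> \forall s \near t, xi (p, s) = e00 (p, s).
  move=> /andP[t0 tT]; near=> s; apply: xE; apply/andP; split; apply: ltW.
    by near: s; exact: lt_nbhsr.
  by near: s; exact: lt_nbhsl.
have dtE p t : 0 < t < T -> dt xi (p, t) = e01 (p, t).
  move=> tT; rewrite /dt derive1E/= (near_eq_derive _ (nearx p t tT))//.
  by apply: derive_val; exact: d01.
pose pos : set R := [set` `]0, +oo[].
have posP k : pos k <-> 0 < k by rewrite /pos/= in_itv/= andbT.
have mpos : measurable (pos : set (measurableTypeR R)) by exact: measurable_itv.
have mK : measurable (K : set (measurableTypeR R)) by exact: measurable_itv.
have mI : measurable (I : set (measurableTypeR R)) by exact: measurable_itv.
pose kk z : R * R := (kappa lambda z.1, z.2).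
have ckk z : (Om `*` [set` `[0, T]]) z -> {for z, continuous kk}.
  case: z => p t [/mem_Omega lp _] U [[P S] /= [Pp St] PS].
  have H1 : nbhs p [set q | P (kappa lambda q)] by exact: (continuous_kappa lambda_gt0 lp).
  change (nbhs (p, t) [set z | U (kk z)]).
  by exists ([set q | P (kappa lambda q)], S) => // -[q s] [/= Pq Ss]; apply: PS.
have ckap (g : R * R -> R) : {within setT `*` [set` `[0, T]], continuous g} ->
    {within Om `*` [set` `[0, T]], continuous (fun z => g (kk z))}.
  by move=> cg; apply: (within_continuous_comp _ ckk cg) => -[p t] [_ It].
have cfst : {within Om `*` [set` `[0, T]], continuous (fun z : R * R => z.1)}.
  by apply: (@within_cyl_fst _ lambda T id) => p _; exact: cvg_id.
have cht : {within Om `*` [set` `[0, T]], continuous (fun z => z.1 * e01 (kk z))}.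
  by move=> z; apply: cvgM; [exact: cfst|exact: (ckap _ c01)].
have ch : {within Om `*` [set` `[0, T]], continuous (fun z => z.1 * e00 (kk z))}.
  by move=> z; apply: cvgM; [exact: cfst|exact: (ckap _ c00)].
have [i5 i6] := integrable_diff_mul (bcyl cht).
have -> : \int[mu]_k (W0 k * xi (k, 0)) =
    - \int[mu2]_(z in Q) (Phi0 z.1 * (z.1 * e01 (kk z))).
  rewrite (@Rintegral_support _ _ _ mu setT pos)//; last first.
    by apply: aeW => k _ nk; rewrite W0n ?mul0r// leNgt; apply/negP => /posP.
  rewrite (integral_kappa lambda_gt0 (G := fun k => W0 k * xi (k, 0))); last first.
    apply: measurable_funTS; apply: continuous_measurable_fun => k.
    by apply: cvgM; [exact: smooth_continuous|exact: cxi].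
  apply: (@etrans _ _ (\int[mu]_(p in K) (Phi0 p * (p * e00 (kk (p, 0)))))); last first.
    apply: (@integral_initial_value _ T T0 Om Phi0 (fun z => z.1 * e00 (kk z)) _ A B
      (@open_Omega _ lambda) KOm bphi ch cht).
    - move=> p t /mem_Omega lp tT.
      by apply: (is_derive_eq (is_derive_mul (is_derive_const p t) (d01 (kappa lambda p) t tT))); rewrite mulr0 addr0.
    - by move=> p _; rewrite /kk/= -xE ?xT ?mulr0// lexx ltW.
  - rewrite (@Rintegral_support _ _ _ mu Om K _ KOm); last first.
      apply: aeW => p /mem_Omega lp nK; have := phi0_support lp nK; rewrite phi0E// => E.
      transitivity (kappa lambda p ^+ 3 * W0 (kappa lambda p) * (xi (kappa lambda p, 0) * p)).
        by ring.
      by rewrite E mul0r.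
    apply: eq_Rintegral => p /set_mem/KP lp; rewrite phi0E// /kk/= xE ?lexx ?ltW//; ring.
have inner : {ae mu, forall t, I t -> \int[mu]_k (Wsol lambda u (k, t) * dt xi (k, t)) =
    \int[mu]_(p in K) (u (p, t) * (p * e01 (kk (p, t))))}.
  apply: aeS ae_slices => t h It; have [hW _] := h It; have tT := (IP t).1 It.
  have [mv _] := W012_measurable hW.
  rewrite (@Rintegral_support _ _ _ mu setT pos)//; last first.
    apply: aeW => k _ nk; rewrite /Wsol ifN ?mul0r//.
    by apply/negP => /posP.
  rewrite (integral_kappa lambda_gt0 (G := fun k => Wsol lambda u (k, t) * dt xi (k, t))).
    rewrite (@Rintegral_support _ _ _ mu Om K _ KOm); last first.
      apply: aeS (hsup tT) => p u0 /[dup] Op /mem_Omega lp nK.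
      by rewrite WsolE// u0// mulr0 !mul0r.
    apply: eq_Rintegral => p /set_mem/KP lp; rewrite WsolE// dtE// /kk/=.
    by field; rewrite gt_eqF// kappa_gt0.
  apply: measurable_funM; last first.
    apply: (eq_measurable_fun (fun k => e01 (k, t))); first by move=> k _; rewrite dtE.
    apply: measurable_funTS; apply: continuous_measurable_fun => k.
    exact: (slice_continuous_p openT c01).
  (* The substitution needs W(., t) to be measurable on (0, +oo): it is a power of 1/k times u(., t)
     composed with the continuous function varpi. *)
  have mV : measurable_fun pos (fun k : R => k^-1).
    apply: open_continuous_measurable_fun; first exact: rray_open.
    by move=> k /set_mem/posP k0; apply: inv_continuous; rewrite gt_eqF.
  have mvp : measurable_fun pos (varpi lambda).
    apply: measurable_funM => //; apply: measurable_funTS.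
    apply: continuous_measurable_fun => k.
    have s0 : 0 < 1 + lambda ^+ 2 * k ^+ 2.
      by have := mulr_ge0 (sqr_ge0 lambda) (sqr_ge0 k); lra.
    have d1 := is_derive_add (is_derive_const 1 k)
      (is_derive_mul (is_derive_const (lambda ^+ 2) k) (is_derive_exprn 2 k)).
    exact: (is_derive_continuous (@is_derive_comp _ _ (fun k => 1 + lambda ^+ 2 * k ^+ 2) k _ _
      (is_derive1_sqrt s0) d1)).
  apply: (eq_measurable_fun (fun k : R => k^-1 ^+ 3 * u (varpi lambda k, t) : R)).
    by move=> k /set_mem/posP k0; rewrite /Wsol k0 div1r exprVn.
  apply: measurable_funM; first exact: measurable_funX.
  apply: (measurable_comp _ _ mv mvp); first exact: measurable_Omega.
  by move=> _ [k /posP k0 <-]; apply/mem_Omega; exact: varpi_gt.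
rewrite (ae_Rintegral inner) -(Fubini_rect mK mI i5) -(RintegralB mQ i5 i6).
by apply: eq_Rintegral => z _; rewrite mulrBl.
Unshelve. all: by end_near. Qed.

End solution.

(** * Values of the kernel slices *)

Section slice_values.
Context {R : realType}.
Variables (lambda : R) (u : R * R -> R).
Hypothesis lambda_gt0 : 0 < lambda.
Local Notation kap := (kappa lambda).

(** The kernel weight is p kappa^2 and W brings kappa^(-3); their product p / kappa is gamma. *)
Lemma Phi_slice_gt (m : R -> R) p t : lambda < p ->
  Phi_slice lambda (fun k => Wsol lambda u (k, t) * m k) p =
  gamma lambda p * m (kap p) * u (p, t).
Proof.
move=> lp; have p0 : 0 < p by exact: lt_trans lp.
have k0 := kappa_gt0 lambda_gt0 lp.
rewrite /Phi_slice gtr0_norm// gtr0_sg// div1r -/(kap p) WsolE//.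
rewrite -kappaX2// /gamma (sqrt_kappaE lambda p).
by field; rewrite gt_eqF.
Qed.

(** On this branch sgn(p) = -1, so W is evaluated at a nonpositive k, where it is 0 by
    definition. *)
Lemma Phi_slice_lt (m : R -> R) p t : p < - lambda ->
  Phi_slice lambda (fun k => Wsol lambda u (k, t) * m k) p = 0.
Proof.
move=> pl; have p0 : p < 0 by rewrite (lt_trans pl)// oppr_lt0.
rewrite /Phi_slice ltr0_sg// /Wsol ifN ?mul0r ?mulr0//.
by rewrite -leNgt mulN1r oppr_le0 invr_ge0 sqrtr_ge0.
Qed.

End slice_values.

(** * The two identities *)

Theorem theorem1 (R : realType) (lambda T : R) (f0 W0 : R -> R)
    (u du du2 : R * R -> R) (eps : R)
    (hlambda : 0 < lambda) (hT : 0 < T)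
    (hf0 : smooth f0) (hW0 : smooth W0) (hW0_ge0 : forall k, 0 <= W0 k)
    (hW0_neg : forall k : R, k <= 0 -> W0 k = 0)
    (hu : L2_W012 lambda T u du)
    (hdu2 : is_weak_dp lambda T (fun z => u z ^+ 2) du2)
    (hweak : forall eta, calV lambda T eta ->
       weak_form lambda T f0 W0 u du du2 eta)
    (heps : 0 < eps)
    (hsupp : forall t : R, 0 < t < T ->
       ess_support (fun k => Wsol lambda u (k, t)) `<=` `]eps, 1 / eps[) :
  let mu := @lebesgue_measure R in
  let W := Wsol lambda u in
  let f := fsol lambda f0 W0 du in
  forall zeta xi : R * R -> R,
  test_fun T zeta -> uniform_compact_support T zeta -> test_fun T xi ->
  (- (\int[mu]_(t in `]0, T[) (\int[mu]_p (f (p, t) * dt zeta (p, t))))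
   - (\int[mu]_p (f0 p * zeta (p, 0)))
   = (\int[mu]_(t in `]0, T[)
        pair_dPhi lambda (fun p => f (p, t) * dp zeta (p, t))
          (fun k => W (k, t)))
   + (\int[mu]_(t in `]0, T[)
        pair_Phi lambda (fun p => f (p, t) * dp (dp zeta) (p, t))
          (fun k => W (k, t))))
  /\
  (- (\int[mu]_(t in `]0, T[) (\int[mu]_k (W (k, t) * dt xi (k, t))))
   - (\int[mu]_k (W0 k * xi (k, 0)))
   = - (\int[mu]_(t in `]0, T[)
          pair_dPhi lambda (fun p => f (p, t) * derive1 Ekin p)
            (fun k => W (k, t) * xi (k, t)))
   - (\int[mu]_(t in `]0, T[)
        pair_Phi lambda (fun p => f (p, t) * derive1n 2 Ekin p)
          (fun k => W (k, t) * xi (k, t)))).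
Proof.
move=> mu W f zeta xi [szeta _ zetaT] [M zetaM] [sxi Cxi xiT].
have [A0 [B0 [lA0 AB0 supp0]]] := Wsol_support hlambda heps.
have sup0 t : 0 < t < T ->
    {ae mu, forall p, Omega lambda p -> ~ [set` `[A0, B0]] p -> u (p, t) = 0}.
  by move=> tT; apply: supp0; exact: hsupp.
have phi_out := phi0_support hlambda hT hW0 hu hdu2 hweak lA0 AB0 sup0.
(* phi0 vanishes off [A0, B0] but need not vanish at A0 or B0 by this argument alone; the new
   endpoints lie strictly outside. *)
pose A := (lambda + A0) / 2; pose B := B0 + 1.
have lA : lambda < A by rewrite /A; lra.
have AA0 : A < A0 by rewrite /A; lra.
have B0B : B0 < B by rewrite /B; lra.
have AB : A < B by rewrite (lt_trans AA0)// (lt_trans AB0).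
have sup t : 0 < t < T ->
    {ae mu, forall p, Omega lambda p -> ~ [set` `[A, B]] p -> u (p, t) = 0}.
  move=> tT; apply: aeS (sup0 t tT) => p h Op nK; apply: h => // K0; apply: nK.
  by move: K0; rewrite /= !in_itv/= => /andP[h1 h2]; apply/andP; split; move: h1 h2; lra.
have phiA : phi0 lambda W0 A = 0.
  by apply: phi_out => //; rewrite /= in_itv/= => /andP[]; lra.
have phiB : phi0 lambda W0 B = 0.
  apply: phi_out; first exact: lt_trans AB.
  by rewrite /= in_itv/= => /andP[_]; lra.
have tI t : 0 < t < T -> 0 <= t <= T by move=> /andP[t0 tT]; rewrite !ltW.
have fE t p : lambda < p -> f (p, t) = (f0 p - derive1 (phi0 lambda W0) p) + du (p, t).
  by move=> lp; rewrite /f /fsol lp; ring.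
have cylS : Omega lambda `*` [set` `[0, T]] `<=` setT `*` [set` `[0, T]].
  by move=> [p t] [_ It].
have pairT := pairing hlambda hT hf0 hW0 hu hdu2 hweak lA AB sup.
split.
(* Order 2 is what makes d_p zeta a C^1 test function, with derivatives e 2 0 and e 1 1. *)
- have [e [eE ce de]] := szeta 2.
  have eE' p t : 0 <= t <= T -> zeta (p, t) = e 0%N 0%N (p, t).
    by move=> tT; rewrite eE//; split => //=; rewrite in_itv.
  have e10T p : e 1%N 0%N (p, T) = 0.
    apply: (@eta_terminal _ T hT (e 0%N 0%N) (e 1%N 0%N) (ce 0%N 0%N isT) (ce 1%N 0%N isT)).
      by move=> q t tT; exact: (de 0%N 0%N isT q t Logic.I tT).1.
    by move=> q; rewrite -eE' ?zetaT// lexx ltW.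
  rewrite (first_lhs hlambda hT hf0 hW0 hu hdu2 hweak lA AB sup phiA phiB eE'
    (ce 0%N 0%N isT) (ce 0%N 1%N isT) (ce 1%N 1%N isT)
    (fun p t tT => (de 0%N 0%N isT p t Logic.I tT).2)
    (fun p t tT => (de 0%N 1%N isT p t Logic.I tT).1) zetaM zetaT).
  have nC : C1cyl lambda T (e 1%N 0%N) (e 2%N 0%N) (e 1%N 1%N).
    split; [exact: continuous_subspaceW cylS (ce 1%N 0%N isT)|
      exact: continuous_subspaceW cylS (ce 2%N 0%N isT)|
      exact: continuous_subspaceW cylS (ce 1%N 1%N isT)|].
    by move=> p t _ tT; exact: (de 1%N 0%N isT p t Logic.I tT).
  have dpE p t : 0 < t < T -> dp zeta (p, t) = e 1%N 0%N (p, t).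
    move=> tT; rewrite /dp/=; have -> : (fun x => zeta (x, t)) = (fun x => e 0%N 0%N (x, t)).
      by apply/funext => x; rewrite eE'// tI.
    by rewrite derive1E; apply: derive_val; exact: (de 0%N 0%N isT p t Logic.I tT).1.
  have dppE p t : 0 < t < T -> dp (dp zeta) (p, t) = e 2%N 0%N (p, t).
    move=> tT; rewrite {1}/dp/=; have -> : (fun x => dp zeta (x, t)) = (fun x => e 1%N 0%N (x, t)).
      by apply/funext => x; rewrite dpE.
    by rewrite derive1E; apply: derive_val; exact: (de 1%N 0%N isT p t Logic.I tT).1.
  have mC := C1cyl_fst T (C1on_cst lambda 1).
  (* The constant factor m = 1 is inserted so that the slice formulas apply. *)
  have W1 t : (fun k => W (k, t)) = (fun k => W (k, t) * 1).
    by apply/funext => k; rewrite mulr1.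
  rewrite /pair_dPhi /pair_Phi.
  rewrite (pairT _ _ _ _ _ _ (fun t => Phi_slice lambda (fun k => W (k, t)))
    (fun t p => f (p, t) * dp zeta (p, t)) (fun t p => f (p, t) * dp (dp zeta) (p, t)) mC nC).
  + by apply: eq_Rintegral => z _; rewrite mul1r mulr0 addr0.
  + by move=> p _; rewrite e10T mulr0.
  + by move=> t p tT lp; rewrite W1 (@Phi_slice_gt _ _ u hlambda (fun=> 1)).
  + by move=> t p tT lp; rewrite W1 (@Phi_slice_lt _ _ u hlambda (fun=> 1)).
  + by move=> t p tT lp; rewrite fE// dpE.
  + by move=> t p tT lp; rewrite fE// dppE.
- have [e [eE ce de]] := sxi 1.
  have eE' p t : 0 <= t <= T -> xi (p, t) = e 0%N 0%N (p, t).
    by move=> tT; rewrite eE//; split => //=; rewrite in_itv.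
  have cxi : continuous (fun k => xi (k, 0)).
    have [sx _ _] : Cc_smooth setT (fun p => xi (p, 0)) by apply: Cxi; rewrite lexx ltW.
    exact: smooth_continuous.
  have E := second_lhs hlambda hT hW0 hu hdu2 hweak lA AB sup hW0_neg eE'
    (ce 0%N 0%N isT) (ce 0%N 1%N isT)
    (fun p t tT => (de 0%N 0%N isT p t Logic.I tT).2) cxi xiT.
  (* Here n(p) = p is the derivative of the kinetic energy, and the terminal condition comes from m,
     that is, from xi. *)
  have nC := C1cyl_fst T (C1on_id lambda).
  pose kk z : R * R := (kappa lambda z.1, z.2).
  have mC : C1cyl lambda T (fun z => e 0%N 0%N (kk z))
      (fun z => e 1%N 0%N (kk z) * - (z.1 * kappa lambda z.1 ^+ 3)) (fun z => e 0%N 1%N (kk z)).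
    have ckk z : (Omega lambda `*` [set` `[0, T]]) z -> {for z, continuous kk}.
      case: z => p t [/mem_Omega lp _] U [[P S] /= [Pp St] PS].
      have H1 : nbhs p [set q | P (kappa lambda q)] by exact: (continuous_kappa hlambda lp).
      change (nbhs (p, t) [set z | U (kk z)]).
      by exists ([set q | P (kappa lambda q)], S) => // -[q s] [/= Pq Ss]; apply: PS.
    have ckap (g : R * R -> R) : {within setT `*` [set` `[0, T]], continuous g} ->
        {within Omega lambda `*` [set` `[0, T]], continuous (fun z => g (kk z))}.
      by move=> cg; apply: (within_continuous_comp _ ckk cg) => -[p t] [_ It].
    split; [exact: ckap (ce 0%N 0%N isT)| |exact: ckap (ce 0%N 1%N isT)|].
      move=> z; apply: cvgM; first exact: (ckap _ (ce 1%N 0%N isT)).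
      exact: (@within_cyl_fst _ lambda T (fun p => - (p * kappa lambda p ^+ 3)) (C1on_kappa hlambda).2).
    move=> p t lp tT; split; last exact: (de 0%N 0%N isT (kappa lambda p) t Logic.I tT).2.
    apply: (@is_derive_comp _ (fun k => e 0%N 0%N (k, t)) (kappa lambda)).
      exact: (de 0%N 0%N isT (kappa lambda p) t Logic.I tT).1.
    exact: is_derive_kappa.
  have dE : derive1 (@Ekin R) = id.
    apply/funext => p; rewrite derive1E; apply: derive_val.
    apply: (is_derive_eq (is_derive_mul (is_derive_exprn 2 p) (is_derive_const (2^-1) p))).
    by rewrite /= mulr0 add0r expr1; field.
  have ddE p : derive1n 2 (@Ekin R) p = 1.
    by rewrite /= dE derive1E; apply: derive_val; exact: is_derive_idfun.
  (* Both sides carry a global minus sign; without it they match [second_lhs] and [pairing]. *)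
  rewrite -opprD -[RHS]opprD; congr (- _).
  rewrite [LHS]E /pair_dPhi /pair_Phi.
  rewrite (pairT _ _ _ _ _ _ (fun t => Phi_slice lambda (fun k => W (k, t) * xi (k, t)))
    (fun t p => f (p, t) * derive1 (@Ekin R) p)
    (fun t p => f (p, t) * derive1n 2 (@Ekin R) p) mC nC).
  + by apply: eq_Rintegral => z _; rewrite mulr0 add0r.
  + by move=> p _; rewrite /kk/= -eE' ?xiT ?mul0r// lexx ltW.
  + move=> t p tT lp; rewrite (@Phi_slice_gt _ _ u hlambda (fun k => xi (k, t)))//.
    by rewrite eE'// tI.
  + by move=> t p tT lp; rewrite (@Phi_slice_lt _ _ u hlambda (fun k => xi (k, t))).
  + by move=> t p tT lp; rewrite fE// dE.
  + by move=> t p tT lp; rewrite fE// ddE.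
Qed.
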